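(* Let $d\geq 2$, $0<s<1$, $p>1$, $q\geq 1$, $\tau\geq 1$, $0<a\leq 1$, $\alpha,\beta,\gamma\in\mathbb{R}$, and $\Lambda>1$. Define $\sigma\in\mathbb{R}$ by $\gamma=a\sigma+(1-a)\beta$. Assume $$\frac{1}{\tau}+\frac{\gamma}{d}=a\left(\frac{1}{p}+\frac{\alpha-s}{d}\right)+(1-a)\left(\frac{1}{q}+\frac{\beta}{d}\right)$$ and $$-(d-1)s\leq \alpha-\sigma<0.$$ Then there exists a positive constant $C$, independent of $u$, such that: (i) if $\frac{1}{\tau}+\frac{\gamma}{d}>0$, then for all radial $u\in L^1_{loc}(\mathbb{R}^d\setminus\{0\})$ with compact support in $\mathbb{R}^d$, $$\left\||x|^\gamma u\right\|_{L^\tau(\mathbb{R}^d)}\leq C\,\|u\|^a_{\dot W^{s,p,\alpha,\Lambda}(\mathbb{R}^d)}\left\||x|^\beta u\right\|^{1-a}_{L^q(\mathbb{R}^d)};$$ (ii) if $\frac{1}{\tau}+\frac{\gamma}{d}<0$, then for all radial $u\in L^1_{loc}(\mathbb{R}^d\setminus\{0\})$ which is $0$ in a neighborhood of $0$, $$\left\||x|^\gamma u\right\|_{L^\tau(\mathbb{R}^d)}\leq C\,\|u\|^a_{\dot W^{s,p,\alpha,\Lambda}(\mathbb{R}^d)}\left\||x|^\beta u\right\|^{1-a}_{L^q(\mathbb{R}^d)}.$$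
   Context: For $p>1$, $0<s<1$, $\alpha\in\mathbb{R}$, $\Lambda>1$, an open set $\Omega\subset\mathbb{R}^d$ and a measurable function $g$ on $\Omega$, $$\|g\|^p_{\dot W^{s,p,\alpha,\Lambda}(\Omega)}=\int_\Omega\int_\Omega\frac{|g(x)-g(y)|^p|x|^{\alpha p}}{|x-y|^{d+sp}}\chi_\Lambda(|x|,|y|)\,dx\,dy,$$ where, for $r_1,r_2\geq 0$, $\chi_\Lambda(r_1,r_2)=1$ if $\Lambda^{-1}r_1\leq r_2\leq\Lambda r_1$ and $\chi_\Lambda(r_1,r_2)=0$ otherwise. The quantities in the inequalities may be infinite; the conventions are $+\infty\cdot 0=0\cdot(+\infty)=0$, $(+\infty)^0=1$ (this corresponds to the case $a=1$), and $+\infty\leq+\infty$. *)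

(* Defs.v *)
From HB Require Import structures.
From mathcomp Require Import all_boot all_order all_algebra.
From mathcomp Require Import all_classical all_reals all_analysis.

Set Implicit Arguments.
Unset Strict Implicit.
Unset Printing Implicit Defensive.

Import Order.TTheory GRing.Theory Num.Theory.
Import numFieldNormedType.Exports.

Local Open Scope classical_set_scope.
Local Open Scope ring_scope.

(* R^d is 'rV[R]_d, with the library's topology (the product topology) and the
   product sigma-algebra, which is the Borel one. *)

Definition rV_display : measure_display -> measure_display.
Proof. exact. Qed.

Section measurable_rV.
Context {d : measure_display} {T : sigmaRingType d} (n : nat).

Let coord (i : 'I_n) (x : 'rV[T]_n) : T := x ord0 i.

Let rV_set0 : g_sigma_preimage coord set0.
Proof. exact: sigma_algebra0. Qed.

Let rV_setC A : g_sigma_preimage coord A -> g_sigma_preimage coord (~` A).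
Proof. exact: sigma_algebraC. Qed.

Let rV_bigcup (F : (set 'rV[T]_n)^nat) :
  (forall i, g_sigma_preimage coord (F i)) ->
  g_sigma_preimage coord (\bigcup_i (F i)).
Proof. exact: sigma_algebra_bigcup. Qed.

HB.instance Definition _ := @isMeasurable.Build (rV_display d)
  'rV[T]_n (g_sigma_preimage coord) rV_set0 rV_setC rV_bigcup.

End measurable_rV.

Section measurable_coord.
Context {d d' : measure_display} {T : measurableType d}.
Context {T' : measurableType d'} {n : nat}.

Lemma measurable_coord (i : 'I_n) :
  measurable_fun [set: 'rV[T]_n] (fun x : 'rV[T]_n => x ord0 i).
Proof.
move=> _ Y mY; rewrite setTI; apply: sub_sigma_algebra => /=.
rewrite -bigcup_seq/=; exists i => /=; first by rewrite mem_index_enum.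
by exists Y => //; rewrite setTI.
Qed.

Lemma measurable_fun_rV (f : T' -> 'rV[T]_n) :
  (forall i, measurable_fun [set: T'] (fun t => f t ord0 i)) ->
  measurable_fun [set: T'] f.
Proof.
move=> mf _ A mA; rewrite setTI.
have : preimage_set_system [set: T'] f
    (g_sigma_preimage (fun i (x : 'rV[T]_n) => x ord0 i)) (f @^-1` A).
  by exists A => //; rewrite setTI.
rewrite -g_sigma_preimageE; apply: smallest_sub.
  exact: sigma_algebra_measurable.
move=> _ [B + <-]; rewrite -bigcup_seq => -[i _ [C mC <-]].
by rewrite !setTI -[X in measurable X]setTI; exact: (mf i).
Qed.

End measurable_coord.

Section rV_cons.
Context {R : realType} {n : nat}.

Definition rV_cons (z : measurableTypeR R * 'rV[R]_n) : 'rV[R]_n.+1 :=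
  \row_i (if unlift ord0 i is Some j then z.2 ord0 j else z.1).

Definition rV_uncons (x : 'rV[R]_n.+1) : measurableTypeR R * 'rV[R]_n :=
  (x ord0 ord0, \row_i x ord0 (lift ord0 i)).

Lemma rV_consK : cancel rV_cons rV_uncons.
Proof.
move=> [a x]; rewrite /rV_uncons !mxE unlift_none/=; congr pair.
by apply/rowP => i; rewrite !mxE liftK.
Qed.

Lemma measurable_rV_cons :
  measurable_fun [set: measurableTypeR R * 'rV[R]_n] rV_cons.
Proof.
apply: measurable_fun_rV => i.
under eq_fun do rewrite mxE.
case: (unliftP ord0 i) => [j _|_]; last exact: measurable_fst.
by apply: (measurableT_comp (measurable_coord j)); exact: measurable_snd.
Qed.

Lemma measurable_rV_uncons : measurable_fun [set: 'rV[R]_n.+1] rV_uncons.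
Proof.
apply/measurable_fun_pairP; split; first exact: measurable_coord.
apply: measurable_fun_rV => i /=.
by under eq_fun do rewrite mxE; exact: measurable_coord.
Qed.

End rV_cons.

Section lebesgue_rV_succ.
Local Open Scope ereal_scope.
Context {R : realType} {n : nat}.
Variable m : {sigma_finite_measure set 'rV[R]_n -> \bar R}.

HB.instance Definition _ :=
  isMeasurableFun.Build _ _ _ _ (@rV_cons R n) measurable_rV_cons.

Definition lebesgue_rV_succ : set 'rV[R]_n.+1 -> \bar R :=
  pushforward (@lebesgue_measure R \x m) rV_cons.

Let lebesgue_rV_succ0 : lebesgue_rV_succ set0 = 0.
Proof. exact: measure0. Qed.

Let lebesgue_rV_succ_ge0 A : 0 <= lebesgue_rV_succ A.
Proof. exact: measure_ge0. Qed.

Let lebesgue_rV_succ_sigma_additive : semi_sigma_additive lebesgue_rV_succ.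
Proof. exact: measure_semi_sigma_additive. Qed.

HB.instance Definition _ := isMeasure.Build _ _ _ lebesgue_rV_succ
  lebesgue_rV_succ0 lebesgue_rV_succ_ge0 lebesgue_rV_succ_sigma_additive.

Let lebesgue_rV_succ_sigma_finite : sigma_finite setT lebesgue_rV_succ.
Proof.
have /sigma_finiteP[F [TF ndF Foo]] := sigma_finiteT (@lebesgue_measure R).
have /sigma_finiteP[G [TG ndG Goo]] := sigma_finiteT m.
exists (fun i => rV_uncons @^-1` (F i `*` G i)) => [|i].
  rewrite -preimage_bigcup; apply/esym/seteqP; split => // x _ /=.
  have [k _ Fkx] : (\bigcup_i F i) (rV_uncons x).1 by rewrite -TF.
  have [l _ Glx] : (\bigcup_i G i) (rV_uncons x).2 by rewrite -TG.
  exists (maxn k l) => //; split.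
    by move: Fkx; exact/subsetPset/ndF/leq_maxl.
  by move: Glx; exact/subsetPset/ndG/leq_maxr.
have [mF Fioo] := Foo i; have [mG Gioo] := Goo i; split.
  rewrite -[X in measurable X]setTI; apply: measurable_rV_uncons => //.
  exact: measurableX.
rewrite /lebesgue_rV_succ /pushforward -comp_preimage.
rewrite (_ : rV_uncons \o rV_cons = id) ?preimage_id; last first.
  exact/funext/rV_consK.
by rewrite product_measure1E// lte_mul_pinfty// ge0_fin_numE.
Qed.

HB.instance Definition _ := @Measure_isSigmaFinite.Build _ _ _ lebesgue_rV_succ
  lebesgue_rV_succ_sigma_finite.

End lebesgue_rV_succ.

(* Lebesgue measure on R^n (on Borel sets), as the n-fold product of Lebesgue
   measure on R. *)
Fixpoint lebesgue_rV (R : realType) (n : nat) :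
    {sigma_finite_measure set 'rV[R]_n -> \bar R} :=
  match n with
  | 0 => @dirac _ 'rV[R]_0 0 R
  | n'.+1 => lebesgue_rV_succ (lebesgue_rV R n')
  end.

Section radial_CKN.
Context {R : realType} {d : nat}.
Implicit Types (x y : 'rV[R]_d) (u g : 'rV[R]_d -> R) (D : set 'rV[R]_d).

Local Notation mu := (lebesgue_rV R d).

(* The library's norm on 'rV[R]_d is the sup norm. *)
Definition enorm x : R := Num.sqrt (\sum_(i < d) x ord0 i ^+ 2).

Definition radial u := forall x y, enorm x = enorm y -> u x = u y.

Definition L1loc D u := measurable_fun D u /\
  forall K, K `<=` D -> compact K -> (\int[mu]_(x in K) `|u x|%:E < +oo)%E.

Definition chi (Lambda r1 r2 : R) : R :=
  if Lambda^-1 * r1 <= r2 <= Lambda * r1 then 1 else 0.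

(* The integrand takes junk values (division by zero, real powers of zero) only
   where x = y or x = 0, a null set of R^d x R^d. *)
Definition sobolev_seminorm D (s p alpha Lambda : R) g : \bar R :=
  ((\int[mu]_(y in D) \int[mu]_(x in D)
      (`|g x - g y| `^ p * enorm x `^ (alpha * p)
       / enorm (x - y) `^ (d%:R + s * p)
       * chi Lambda (enorm x) (enorm y))%R%:E) `^ p^-1%R)%E.

(* || |x|^gamma u ||_{L^tau(R^d)} *)
Definition weighted_Lnorm (tau gamma : R) u : \bar R :=
  Lnorm mu tau%:E (fun x => (enorm x `^ gamma * u x)%:E).

End radial_CKN.

(* Main.v *)
Require Import Defs.
From HB Require Import structures.
From mathcomp Require Import all_boot all_order all_algebra.
From mathcomp Require Import all_classical all_reals all_analysis.
From mathcomp Require Import measurable_realfun ring lra.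

Set Implicit Arguments.
Unset Strict Implicit.
Unset Printing Implicit Defensive.

Import Order.TTheory GRing.Theory Num.Theory.
Import numFieldNormedType.Exports.

Local Open Scope classical_set_scope.
Local Open Scope ring_scope.

(* Cover R^d minus the origin by the shells E_i = {rho_i <= |x| < Lambda rho_i},
   rho_i = rho_0 om^i with om = Lambda^(-1/2) in case (i) and om = Lambda^(1/2)
   in case (ii); on E_i x E_i the cutoff chi is 1 and the weights are constant
   up to a factor.

   On a single shell, u is a function of the radius. Cut a cone into 2^(j(d-1))
   narrow cells: two points of one cell whose radii are 2^-j-close are themselves
   2^-j-close, so the d-dimensional seminorm dominates a dyadic oscillation sum
   in the radial variable alone, with the exponent s of a one-dimensional
   seminorm. Telescoping the dyadic averages and interpolating pointwise gives
   a Gagliardo-Nirenberg inequality for u minus its average v_i on E_i, under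
   the one-dimensional condition a (1/p - s) + (1 - a) / q <= 1 / tau; this is
   the hypothesis alpha - sigma >= - (d - 1) s.

   Put delta = d (1/tau + gamma/d), so that om^delta < 1 in both cases. Comparing
   v_i and v_(i+1) on the common part of the two shells shows that
   rho_i^delta |v_i| contracts by the factor om^delta up to the local errors, and
   the support condition gives v_0 = 0. The local products are summable because
   a tau / p + (1 - a) tau / q >= 1, which follows from alpha - sigma < 0. *)

(** * Interpolation of dyadic sums *)

Section real_inequalities.
Context {R : realType}.
Implicit Types (x y z g m k D : R).

(** Why narrow cells recover the one-dimensional exponent: at scale [2^-j], keeping only pairs in a
    common angular cell retains a fraction of order [2^-(j (d - 1))] of the pairs, while the kernel
    [|x - y|^-(d + s p)] is at least of order [2^(j (d + s p))] there. The product is the weight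
    [2^(j (1 + s p))] of a one-dimensional seminorm. Radial scales are measured by volume, so every
    radial cell of level [j] has the share [2^-j] of its shell, and the oscillation estimates hold
    on any measure space with such a partition.

    Bounds are kept as logarithms [g], [m], [k], so that interpolation is a convex combination of
    exponents. Logarithms need positive bounds, so vanishing norms are treated apart; and for
    [a = 1] the L^q norm may be infinite, so every L^q bound is guarded by [a < 1].

    With [Lambda = b^2] the radii advance by a factor [b] or [1/b]: shells of ratio [b] are disjoint
    tiles, while neighbouring shells of ratio [b^2] share a tile on which their averages can be
    compared. *)

Lemma geometric_sum_le (r : R) n : 0 <= r < 1 ->
  \sum_(j < n) r ^+ j <= (1 - r)^-1.
Proof.
move=> /andP[r0 r1].
have : (1 - r) * \sum_(j < n) r ^+ j <= 1.
  rewrite -opprB mulNr -subrX1 opprB; have := exprn_ge0 n r0; lra.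
by rewrite -ler_pdivlMl ?subr_gt0// mulr1.
Qed.

Lemma geometric_expR_sum_le (e : R) n : 0 < e ->
  \sum_(j < n) expR (- (e * j%:R)) <= (1 - expR (- e))^-1.
Proof.
move=> e0; have E : 0 <= expR (- e) < 1.
  by rewrite expR_ge0 -expR0 ltr_expR; lra.
apply: le_trans (geometric_sum_le n E).
by apply: ler_sum => j _; rewrite -mulNr mulrC expRM_natl.
Qed.

(* The left-hand terms are [expR (- `|y - e * j|)]. *)
Lemma two_sided_geometric_sum_le (e : R) : 0 < e -> exists2 K : R, 0 < K &
  forall n (y : R), \sum_(j < n)
    Num.min (expR (y - e * j%:R)) (expR (e * j%:R - y)) <= K.
Proof.
move=> e0; set r := expR (- e).
have r0 : 0 < r by rewrite expR_gt0.
have r1 : r < 1 by rewrite -expR0 ltr_expR; lra.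
have r1' : 0 < 1 - r by lra.
have shift n y : \sum_(j < n.+1)
    Num.min (expR (y - e * j%:R)) (expR (e * j%:R - y)) =
    Num.min (expR y) (expR (- y)) + \sum_(j < n)
    Num.min (expR ((y - e) - e * j%:R)) (expR (e * j%:R - (y - e))).
  rewrite big_ord_recl/= mulr0 subr0 sub0r; congr (_ + _).
  apply: eq_bigr => j _; rewrite /bump/= add1n -natr1.
  by congr Num.min; congr expR; ring.
have le0 n y : y <= 0 -> \sum_(j < n)
    Num.min (expR (y - e * j%:R)) (expR (e * j%:R - y)) <= (1 - r)^-1.
  move=> y0; apply: le_trans (geometric_expR_sum_le n e0).
  apply: ler_sum => j _; rewrite ge_min ler_expR; apply/orP; left; lra.
set V := (1 - r)^-1; have V1 : 1 <= V by rewrite invf_ge1//; lra.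
have rV : V * r = V - 1 by rewrite /V; field; lra.
exists (2 * V); first by lra.
(* The subtracted term [(V - 1) e^-y] is the geometric tail [r e^-y + r^2 e^-y + ...] to the left of
   the first index. This reserve makes the induction close, since one step replaces [y] by
   [y - e]. *)
have main : forall n y, \sum_(j < n)
    Num.min (expR (y - e * j%:R)) (expR (e * j%:R - y)) <=
    2 * V - (V - 1) * expR (- y) * (0 < y)%R%:R.
  elim=> [|n IH] y.
    rewrite big_ord0; case: ltP => y0 /=; rewrite ?mulr0 ?subr0 ?mulr1; last by lra.
    have : expR (- y) <= 1 by rewrite -expR0 ler_expR; lra.
    by move=> ?; nra.
  case: (ltP 0 y) => y0 /=; last first.
    by rewrite mulr0 subr0; apply: le_trans (le0 _ _ y0) _; rewrite -/V; lra.
  rewrite shift mulr1; have := IH (y - e).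
  have ey : expR (- (y - e)) * r = expR (- y).
    by rewrite -expRD; congr expR; ring.
  have ey0 : 0 < expR (- y) by exact: expR_gt0.
  have m1 : Num.min (expR y) (expR (- y)) <= expR (- y) by rewrite ge_min lexx orbT.
  have y1 : expR (- y) <= 1 by rewrite -expR0 ler_expR; lra.
  case: (ltP 0 (y - e)) => ye /=; rewrite ?mulr1 ?mulr0 ?subr0.
    have -> : (V - 1) * expR (- (y - e)) = V * expR (- y).
      by rewrite -rV -ey; ring.
    by lra.
  by move=> _; have := le0 n (y - e) ye; rewrite -/V; nra.
move=> n y; apply: le_trans (main n y) _.
by rewrite gerBl mulr_ge0// ?ler0n// mulr_ge0 ?expR_ge0// subr_ge0.
Qed.

End real_inequalities.

Section interpolation.
Context {R : realType}.
Implicit Types (x y z g m k D c : R).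

(** A weighted geometric mean of three upper bounds, read after taking logarithms. The third bound
    is required only when its weight is positive: it will be the L^q bound with weight [1 - a]. *)
Lemma le_expR_interp c x A B E (l1 l2 l3 : R) : 0 < c -> 0 <= x ->
    0 <= l1 -> 0 <= l2 -> 0 <= l3 -> l1 + l2 + l3 = 1 ->
    x <= c * expR A -> x <= c * expR B -> (0 < l3 -> x <= c * expR E) ->
  x <= c * expR (l1 * A + l2 * B + l3 * E).
Proof.
move=> c0; rewrite le_eqVlt => /predU1P[<- *|x0 l10 l20 l30 l1E xA xB xE].
  by rewrite mulr_ge0 ?expR_ge0// ltW.
have lnE t : (x <= c * expR t) = (ln (x / c) <= t).
  rewrite mulrC -ler_pdivrMr// -{1}[x / c]lnK ?ler_expR//.
  by rewrite posrE divr_gt0.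
rewrite lnE; rewrite !lnE in xA xB xE.
have H1 := ler_wpM2l l10 xA; have H2 := ler_wpM2l l20 xB.
have H3 : l3 * ln (x / c) <= l3 * E.
  move: l30; rewrite le_eqVlt => /predU1P[<-|l3p]; first by rewrite !mul0r.
  by rewrite ler_pM2l// xE.
have -> : ln (x / c) = l1 * ln (x / c) + l2 * ln (x / c) + l3 * ln (x / c).
  by rewrite -!mulrDl l1E mul1r.
lra.
Qed.

Lemma expR_le_add1 x p t : 0 <= x <= p -> expR (x * t) <= expR (p * t) + 1.
Proof.
move=> /andP[x0 xp]; case: (leP 0 t) => t0.
  rewrite ler_wpDr// ler_expR; nra.
rewrite ler_wpDl ?expR_ge0// -expR0 ler_expR; nra.
Qed.

(** Passage to the limit in [n], made explicit: [expR t >= 1 + t] shows that any [n] beyond [b]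
    makes the decaying term smaller than [D - B]. *)
Lemma le_of_le_expR_decay c g e D B : 0 < c -> 0 < e ->
  (forall n : nat, D <= c * expR (g - e * n%:R) + B) -> D <= B.
Proof.
move=> c0 e0 H; rewrite leNgt; apply/negP => BD.
set b := c * expR g / ((D - B) * e).
have b0 : 0 <= b.
  rewrite /b divr_ge0// ?mulr_ge0 ?expR_ge0// ?subr_ge0 ltW//.
have := H (Num.truncn b).+1; set n := (Num.truncn b).+1.
have bn : b < n%:R by exact: truncnS_gt.
rewrite expRB.
have : expR (e * n%:R) > e * n%:R.
  by apply: lt_le_trans (expR_ge1Dx _); lra.
have gD : c * expR g < (D - B) * (e * n%:R).
  have -> : (D - B) * (e * n%:R) = n%:R * ((D - B) * e) by ring.
  by rewrite -ltr_pdivrMr// mulr_gt0// subr_gt0.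
have en : 0 < e * n%:R by rewrite mulr_gt0// ltr0n.
move=> en'; apply/negP; rewrite -ltNge -ltrBrDr mulrA.
rewrite ltr_pdivrMr ?expR_gt0//; apply: lt_trans gD _.
by rewrite ltr_pM2l// subr_gt0.
Qed.

(* Since [tau * l1 <= p], the power [(G / N) ^ (tau * l1)] is at most
   [(G / N) ^ p + 1]. *)
Lemma powR_le_interp (p tau a l1 C D g m k : R) : 0 < tau ->
    0 <= l1 -> tau * l1 <= p -> 0 < C -> 0 <= D ->
    D <= C * expR (l1 * g + (a - l1) * m + (1 - a) * k) ->
  D `^ tau <= C `^ tau * expR (tau * (a * m + (1 - a) * k)) *
    (expR (p * (g - m)) + 1).
Proof.
move=> tau0 l10 l1p C0 D0 DC.
have := ge0_ler_powR (ltW tau0) (D0 : D \is Num.nneg)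
  (mulr_ge0 (ltW C0) (expR_ge0 _) : _ \is Num.nneg) DC.
move=> /le_trans; apply.
rewrite powRM ?expR_ge0 ?(ltW C0)// -expRM -mulrA.
rewrite ler_wpM2l ?powR_ge0//.
have -> : (l1 * g + (a - l1) * m + (1 - a) * k) * tau =
  tau * (a * m + (1 - a) * k) + (tau * l1) * (g - m) by ring.
rewrite expRD ler_wpM2l ?expR_ge0// expR_le_add1// l1p andbT mulr_ge0// ltW//.
Qed.

(* Two geometric majorants of opposite slopes [+-t] leave only a bounded
   number of effective terms, whence the scale-free bound. *)
Lemma two_sided_sum_bound (c t : R) : 0 < c -> 0 < t -> exists2 K : R, 0 < K &
  forall n (X : nat -> R) H y,
    (forall j, X j <= c * expR (H + (y - t * j%:R))) ->
    (forall j, X j <= c * expR (H - (y - t * j%:R))) ->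
    \sum_(j < n) X j <= K * expR H.
Proof.
move=> c0 t0; have [K K0 HK] := two_sided_geometric_sum_le t0.
exists (c * K); first exact: mulr_gt0.
move=> n X H y H1 H2.
have -> : c * K * expR H = c * expR H * K by ring.
have cH : 0 < c * expR H by rewrite mulr_gt0 ?expR_gt0.
apply: le_trans (ler_wpM2l (ltW cH) (HK n y)).
rewrite mulr_sumr; apply: ler_sum => j _.
have [_|_] := leP (expR (y - t * j%:R)) (expR (t * j%:R - y)).
  by rewrite -mulrA -expRD.
by rewrite -mulrA -expRD -opprB; exact: H2.
Qed.

Section pointwise.
Variables (p q tau s a L c : R).
Hypotheses (p1 : 1 < p) (q1 : 1 <= q) (tau1 : 1 <= tau) (s0 : 0 < s).
Hypotheses (ha : 0 < a <= 1) (L0 : 0 < L) (c0 : 0 < c).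
Hypothesis kappa_le : a * (p^-1 - s) + (1 - a) / q <= tau^-1.

Let kappa := a * (p^-1 - s) + (1 - a) / q.

Let a0 : 0 < a. Proof. by case/andP: ha. Qed.
Let a1 : a <= 1. Proof. by case/andP: ha. Qed.
Let p0 : 0 < p. Proof. exact: lt_trans p1. Qed.
Let q0 : 0 < q. Proof. exact: lt_le_trans q1. Qed.
Let tau0 : 0 < tau. Proof. exact: lt_le_trans tau1. Qed.
Let pV0 : 0 < p^-1. Proof. by rewrite invr_gt0. Qed.
Let qV0 : 0 < q^-1. Proof. by rewrite invr_gt0. Qed.
Let tV0 : 0 < tau^-1. Proof. by rewrite invr_gt0. Qed.

Local Ltac section_facts :=
  move: p1 q1 tau1 s0 a0 a1 L0 c0 p0 q0 tau0 pV0 qV0 tV0 => ? ? ? ? ? ? ? ? ? ? ? ? ? ?.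
Local Ltac slra := section_facts; lra.

(** At a fixed point, [X j] is the jump between dyadic averages of levels [j] and [j + 1], and [D]
    the distance of the value from the total average; [g] stands for the oscillation at the point,
    [m] for its mean, [k] for the L^q mean. Interpolation with weights [l1], [a - l1], [1 - a] gives
    the rate [kappa - l1 / p] in [j]. The choice [l1 = min a (p / tau)] makes it negative and keeps
    [tau * l1 <= p]. *)
Lemma pointwise_bound_subcritical : kappa < a / p -> kappa < tau^-1 ->
  exists2 C : R, 0 < C & forall (X : nat -> R) g m k D, 0 <= D ->
    (forall j, 0 <= X j <= c * expR (g - s * L * j%:R)) ->
    (forall j, X j <= c * expR (m + (p^-1 - s) * L * j%:R)) ->
    (a < 1 -> forall j, X j <= c * expR (k + q^-1 * L * j%:R)) ->
    (forall n, D <= c * expR (g - s * L * n%:R) + \sum_(j < n) X j) ->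
  D `^ tau <= C * expR (tau * (a * m + (1 - a) * k)) * (expR (p * (g - m)) + 1).
Proof.
move=> ka kt.
pose l1 : R := Num.min a (p / tau).
have l1a : l1 <= a by rewrite ge_min lexx.
have l1t : tau * l1 <= p.
  by rewrite -ler_pdivlMl// mulrC ge_min lexx orbT.
have l10 : 0 < l1 by rewrite lt_min a0 divr_gt0.
have l1k : kappa < l1 / p.
  rewrite ltr_pdivlMr// lt_min; apply/andP; split.
    by rewrite -ltr_pdivlMr.
  by rewrite mulrC ltr_pM2l.
pose e : R := (l1 / p - kappa) * L.
have e0 : 0 < e by rewrite mulr_gt0// subr_gt0.
have K0 : 0 < (1 - expR (- e))^-1.
  by rewrite invr_gt0 subr_gt0 expR_lt1 oppr_lt0.
exists ((c * (1 - expR (- e))^-1) `^ tau); first by rewrite powR_gt0// mulr_gt0.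
move=> X g m k D D0 Xg Xm Xk HD.
apply: (@powR_le_interp p tau a l1) => //; first exact: ltW.
  by rewrite mulr_gt0.
set H := l1 * g + _ + _.
apply: (@le_of_le_expR_decay c g (s * L)) => //; first exact: mulr_gt0.
move=> n; apply: le_trans (HD n) _; rewrite lerD2l.
have cH : 0 <= c * expR H by rewrite mulr_ge0 ?expR_ge0 ?ltW.
rewrite mulrAC; apply: le_trans (ler_wpM2l cH (geometric_expR_sum_le n e0)).
rewrite mulr_sumr; apply: ler_sum => j _.
rewrite -mulrA -expRD.
have -> : H - e * j%:R = l1 * (g - s * L * j%:R) +
    (a - l1) * (m + (p^-1 - s) * L * j%:R) +
    (1 - a) * (k + q^-1 * L * j%:R).
  by rewrite /H /e /kappa; ring.
have /andP[X0 Xgj] := Xg j.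
apply: le_expR_interp => //; try (move: a1 => ?; lra).
by move=> a1'; apply: Xk; lra.
Qed.

(** Here [l1 = p / tau] gives rate 0 and the interpolated jumps do not decay. Moving the weight
    between [g] and [m] by [d] in either direction gives two bounds of rates [-d / p] and [d / p]
    that cross, and the sum concentrates around the crossing. *)
Lemma pointwise_bound_critical : kappa < a / p -> kappa = tau^-1 ->
  exists2 C : R, 0 < C & forall (X : nat -> R) g m k D, 0 <= D ->
    (forall j, 0 <= X j <= c * expR (g - s * L * j%:R)) ->
    (forall j, X j <= c * expR (m + (p^-1 - s) * L * j%:R)) ->
    (a < 1 -> forall j, X j <= c * expR (k + q^-1 * L * j%:R)) ->
    (forall n, D <= c * expR (g - s * L * n%:R) + \sum_(j < n) X j) ->
  D `^ tau <= C * expR (tau * (a * m + (1 - a) * k)) * (expR (p * (g - m)) + 1).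
Proof.
move=> ka kt.
pose l1 : R := p / tau.
have l1k : l1 = p * kappa by rewrite kt.
have l1a : l1 < a by rewrite l1k mulrC -ltr_pdivlMr.
have l1t : tau * l1 <= p by rewrite /l1 mulrC divfK// gt_eqF.
have l10 : 0 < l1 by rewrite divr_gt0.
pose d : R := Num.min l1 (a - l1).
have d0 : 0 < d by rewrite lt_min l10 subr_gt0.
have dl : d <= l1 by rewrite ge_min lexx.
have da : d <= a - l1 by rewrite ge_min lexx orbT.
have e0 : 0 < d / p * L by rewrite !mulr_gt0.
have [K K0 HK] := two_sided_sum_bound c0 e0.
exists (K `^ tau); first by rewrite powR_gt0.
move=> X g m k D D0 Xg Xm Xk HD.
apply: (@powR_le_interp p tau a l1) => //; first exact: ltW.
set H := l1 * g + _ + _.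
apply: (@le_of_le_expR_decay c g (s * L)) => //; first exact: mulr_gt0.
move=> n; apply: le_trans (HD n) _; rewrite lerD2l.
have kE : a * (p^-1 - s) + (1 - a) / q = l1 / p.
  by rewrite -/kappa l1k mulrAC divff ?mul1r// gt_eqF.
apply: (HK n X H (d * (g - m))) => j; have /andP[X0 Xgj] := Xg j.
- have -> : H + (d * (g - m) - d / p * L * j%:R) =
      (l1 + d) * (g - s * L * j%:R) +
      (a - l1 - d) * (m + (p^-1 - s) * L * j%:R) +
      (1 - a) * (k + q^-1 * L * j%:R).
    apply/eqP; rewrite -subr_eq0; apply/eqP.
    transitivity ((l1 / p - (a * (p^-1 - s) + (1 - a) / q)) * L * j%:R).
      by rewrite /H; ring.
    by rewrite kE subrr !mul0r.
  apply: le_expR_interp => //; try (move: a1 => ?; lra).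
  by move=> a1'; apply: Xk; lra.
- have -> : H - (d * (g - m) - d / p * L * j%:R) =
      (l1 - d) * (g - s * L * j%:R) +
      (a - l1 + d) * (m + (p^-1 - s) * L * j%:R) +
      (1 - a) * (k + q^-1 * L * j%:R).
    apply/eqP; rewrite -subr_eq0; apply/eqP.
    transitivity ((l1 / p - (a * (p^-1 - s) + (1 - a) / q)) * L * j%:R).
      by rewrite /H; ring.
    by rewrite kE subrr !mul0r.
  apply: le_expR_interp => //; try (move: a1 => ?; lra).
  by move=> a1'; apply: Xk; lra.
Qed.

(* Here [a] is at most the exponent [th = 1 / (1 + s q)] for which the bounds
   in terms of [g] and [k] alone balance; the remaining power of [D] is kept
   and measured in L^q. *)
Lemma pointwise_bound_low : a / p <= kappa ->
  exists2 C : R, 0 < C & forall (X : nat -> R) g m k D, 0 <= D ->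
    (forall j, 0 <= X j <= c * expR (g - s * L * j%:R)) ->
    (a < 1 -> forall j, X j <= c * expR (k + q^-1 * L * j%:R)) ->
    (forall n, D <= c * expR (g - s * L * n%:R) + \sum_(j < n) X j) ->
  D `^ tau <= C * expR (tau * (a * m + (1 - a) * k)) *
    (expR (p * (g - m)) + 1 + D `^ q * expR (- (q * k))).
Proof.
move=> ka.
pose th : R := q^-1 / (s + q^-1).
have sq0 : 0 < s + q^-1 by slra.
have th0 : 0 < th by rewrite divr_gt0.
have th1 : th < 1 by rewrite ltr_pdivrMr// mul1r; slra.
have thE : th * s = (1 - th) * q^-1
  by rewrite /th; move: (q^-1) sq0 => V V0; field; lra.
have ath : a <= th.
  rewrite ler_pdivlMr//; move: ka; rewrite /kappa; slra.
have a1' : a < 1 by slra.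
pose d : R := Num.min th (1 - th).
have d0 : 0 < d by rewrite lt_min th0 subr_gt0.
have dl : d <= th by rewrite ge_min lexx.
have da : d <= 1 - th by rewrite ge_min lexx orbT.
have e0 : 0 < d * (s + q^-1) * L by rewrite !mulr_gt0.
have [K K0 HK] := two_sided_sum_bound c0 e0.
(* [D] is split as [D^b * D^(1 - b)]: the first factor is estimated by [DK], and [b * th = a] gives
   [g] the coefficient [a]; the second factor is kept. *)
pose b : R := a / th.
have bth : b * th = a by rewrite divfK// gt_eqF.
have b0 : 0 < b by rewrite divr_gt0.
have b1 : b <= 1 by rewrite ler_pdivrMr// mul1r.
exists (K `^ (tau * b)); first by rewrite powR_gt0.
move=> X g m k D D0 Xg /(_ a1') Xk HD.
have DK : D <= K * expR (th * g + (1 - th) * k).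
  apply: (@le_of_le_expR_decay c g (s * L)) => //; first exact: mulr_gt0.
  move=> n; apply: le_trans (HD n) _; rewrite lerD2l.
  apply: (HK n X _ (d * (g - k))) => j; have /andP[X0 Xgj] := Xg j.
  - have -> : th * g + (1 - th) * k + (d * (g - k) - d * (s + q^-1) * L * j%:R)
      = (th + d) * (g - s * L * j%:R) + (1 - th - d) * (k + q^-1 * L * j%:R)
        + 0 * 0.
      apply/eqP; rewrite -subr_eq0; apply/eqP.
      transitivity ((th * s - (1 - th) * q^-1) * L * j%:R); first by ring.
      by rewrite thE subrr !mul0r.
    by apply: le_expR_interp => //; move: a1 => ?; lra.
  - have -> : th * g + (1 - th) * k - (d * (g - k) - d * (s + q^-1) * L * j%:R)
      = (th - d) * (g - s * L * j%:R) + (1 - th + d) * (k + q^-1 * L * j%:R)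
        + 0 * 0.
      apply/eqP; rewrite -subr_eq0; apply/eqP.
      transitivity ((th * s - (1 - th) * q^-1) * L * j%:R); first by ring.
      by rewrite thE subrr !mul0r.
    by apply: le_expR_interp => //; move: a1 => ?; lra.
move: D0; rewrite le_eqVlt => /predU1P[<-|D0].
  by rewrite powR0 ?gt_eqF// !(mulr_ge0, addr_ge0) ?powR_ge0 ?expR_ge0.
pose y : R := ln D; have DE : D = expR y by rewrite /y lnK.
have lKK : expR (ln K) = K by apply: lnK; rewrite posrE.
have yE : b * y <= b * (ln K + (th * g + (1 - th) * k)).
  rewrite (ler_pM2l b0).
  by rewrite -ler_expR -DE; apply: le_trans DK _; rewrite expRD lKK.
rewrite DE -!expRM -expRD.
have -> : K `^ (tau * b) = expR (tau * b * ln K).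
  by rewrite /powR gt_eqF.
rewrite -expRD.
set x1 := p * (g - m); set x2 := y * q + - (q * k).
(* [y * tau] is at most the total exponent plus a sub-convex combination of
   [x1] and [x2] *)
have w : a * tau / p + (1 - b) * tau / q <= 1.
  have -> : a * tau / p + (1 - b) * tau / q = (a / p + (1 - b) / q) * tau by ring.
  rewrite -ler_pdivlMr// mul1r; apply: le_trans kappa_le.
  rewrite le_eqVlt; apply/orP; left; apply/eqP.
  rewrite /b /th; move: (q^-1) sq0 qV0 (p^-1) => V V0 V1 W; field.
  by rewrite !gt_eqF.
have yle : y * tau <= tau * b * ln K + tau * (a * m + (1 - a) * k)
    + (a * tau / p * x1 + (1 - b) * tau / q * x2).
  have -> : a * tau / p * x1 = a * tau * (g - m) by rewrite /x1; field; slra.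
  have -> : (1 - b) * tau / q * x2 = (1 - b) * tau * (y - k).
    by rewrite /x2; field; slra.
  have := ler_wpM2l (ltW tau0) yE.
  have -> : tau * (b * (ln K + (th * g + (1 - th) * k))) =
    tau * b * ln K + tau * (b * th * g + (b - b * th) * k) by ring.
  rewrite bth; nra.
apply: le_trans (_ : expR (tau * b * ln K + tau * (a * m + (1 - a) * k)
    + (a * tau / p * x1 + (1 - b) * tau / q * x2)) <= _).
  by rewrite ler_expR.
rewrite [leLHS]expRD ler_wpM2l ?expR_ge0//.
set w1 := a * tau / p in w *; set w2 := (1 - b) * tau / q in w *.
have w10 : 0 <= w1 by rewrite /w1 !mulr_ge0// ltW.
have w20 : 0 <= w2.
  by rewrite /w2 !mulr_ge0 ?subr_ge0//; apply: ltW.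
have wmax M : 0 <= M -> x1 <= M -> x2 <= M -> w1 * x1 + w2 * x2 <= M.
  move=> M0 /(ler_wpM2l w10) H1 /(ler_wpM2l w20) H2.
  by have := ler_wpM2r M0 w; rewrite mul1r mulrDl; lra.
have := expR_ge0 x1; have := expR_ge0 x2.
have [x10|x10] := leP x1 0; have [x20|x20] := leP x2 0 => E2 E1.
- apply: le_trans (_ : 1 <= _); last by lra.
  by rewrite expR_le1 wmax.
- apply: le_trans (_ : expR x2 <= _); last by lra.
  by rewrite ler_expR wmax//; lra.
- apply: le_trans (_ : expR x1 <= _); last by lra.
  by rewrite ler_expR wmax//; lra.
have [x12|x12] := leP x1 x2.
- apply: le_trans (_ : expR x2 <= _); last by lra.
  by rewrite ler_expR wmax//; lra.
- apply: le_trans (_ : expR x1 <= _); last by lra.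
  by rewrite ler_expR wmax//; lra.
Qed.

(** The three cases joined. The term in [D^q] comes only from the last case, which forces [a < 1]:
    for [a = 1], [kappa = 1/p - s] is below [a / p]. *)
Lemma pointwise_bound :
  exists2 C : R, 0 < C & forall (X : nat -> R) g m k D, 0 <= D ->
    (forall j, 0 <= X j <= c * expR (g - s * L * j%:R)) ->
    (forall j, X j <= c * expR (m + (p^-1 - s) * L * j%:R)) ->
    (a < 1 -> forall j, X j <= c * expR (k + q^-1 * L * j%:R)) ->
    (forall n, D <= c * expR (g - s * L * n%:R) + \sum_(j < n) X j) ->
  D `^ tau <= C * expR (tau * (a * m + (1 - a) * k)) *
    (expR (p * (g - m)) + 1 + (a < 1)%R%:R * (D `^ q * expR (- (q * k)))).
Proof.
have [ka|ka] := ltP kappa (a / p); last first.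
  have [C C0 H] := pointwise_bound_low ka; exists C => // X g m k D D0 Xg Xm Xk HD.
  have -> : (a < 1)%R%:R = 1 :> R.
    case: ltP => // a1'; exfalso.
    have aE : a = 1 by apply/eqP; rewrite eq_le a1.
    by move: ka; rewrite /kappa aE subrr mul0r addr0 !mul1r; slra.
  by rewrite mul1r; apply: H Xg Xk HD.
have [C C0 H] : exists2 C : R, 0 < C & forall (X : nat -> R) g m k D, 0 <= D ->
    (forall j, 0 <= X j <= c * expR (g - s * L * j%:R)) ->
    (forall j, X j <= c * expR (m + (p^-1 - s) * L * j%:R)) ->
    (a < 1 -> forall j, X j <= c * expR (k + q^-1 * L * j%:R)) ->
    (forall n, D <= c * expR (g - s * L * n%:R) + \sum_(j < n) X j) ->
  D `^ tau <= C * expR (tau * (a * m + (1 - a) * k)) * (expR (p * (g - m)) + 1).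
  move: (kappa_le); rewrite -/kappa le_eqVlt => /predU1P[kt|kt].
    exact: pointwise_bound_critical.
  exact: pointwise_bound_subcritical.
exists C => // X g m k D D0 Xg Xm Xk HD.
apply: le_trans (H _ _ _ _ _ D0 Xg Xm Xk HD) _.
rewrite ler_wpM2l ?mulr_ge0 ?expR_ge0 ?(ltW C0)// lerDl.
by rewrite mulr_ge0// mulr_ge0 ?powR_ge0 ?expR_ge0.
Qed.

End pointwise.

End interpolation.

(** * Dyadic averages and oscillations *)

Section average.
Context d (T : measurableType d) (R : realType) (mu : {measure set T -> \bar R}).
Implicit Types (J : set T) (f : T -> R).

Definition average J f : R := (fine (mu J))^-1 * \int[mu]_(y in J) f y.

(** Either [z <= Z], or [z / Z >= 1] is at most its [p]-th power. The free level [Z] lets this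
    replace Hölder's inequality. *)
Lemma le_young_powR (p z Z : R) : 1 <= p -> 0 <= z -> 0 < Z ->
  z <= Z + Z `^ (1 - p) * z `^ p.
Proof.
move=> p1 z0 Z0; have [zZ|Zz] := leP z Z.
  by apply: (le_trans zZ); rewrite lerDl mulr_ge0 ?powR_ge0.
have z0' : 0 < z by exact: lt_trans Z0 Zz.
rewrite ler_wpDl ?(ltW Z0)//.
have zE : z = Z * (z / Z) by rewrite mulrC divfK// gt_eqF.
have zZ1 : 1 <= z / Z by rewrite ler_pdivlMr// mul1r ltW.
rewrite {2}zE powRM ?(ltW Z0) ?divr_ge0 ?(ltW Z0)// mulrA -powRD; last first.
  by apply/implyP => _; rewrite gt_eqF.
rewrite subrK powRr1 ?(ltW Z0)// {1}zE ler_wpM2l ?(ltW Z0)//.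
exact: le1r_powR.
Qed.

(** Jensen's inequality up to the factor 2: [le_young_powR] is integrated at the level [Z] of the
    mean [p]-th power, and each of its two terms contributes [v * Z]. *)
Lemma average_sub_le J f (v c p Z : R) : 1 <= p -> measurable J ->
    mu J = v%:E -> 0 < v -> 0 < Z -> mu.-integrable J (EFin \o f) ->
    (\int[mu]_(y in J) (`|f y - c| `^ p)%:E <= (v * Z `^ p)%:E)%E ->
  `|average J f - c| <= 2 * Z.
Proof.
move=> p1 mJ muJ v0 Z0 intf fp.
have mf : measurable_fun J f by apply/measurable_EFinP; exact: measurable_int intf.
have intc : mu.-integrable J (EFin \o cst c).
  apply/integrableP; split; first exact/measurable_EFinP/measurable_cst.
  under eq_integral do rewrite /=.
  by rewrite integral_cst// muJ -EFinM ltey.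
have intfc : mu.-integrable J (EFin \o (fun y => f y - c)).
  by have := integrableB mJ intf intc; congr (mu.-integrable J).
have mfc : measurable_fun J (fun y => f y - c).
  by apply: measurable_funB => //; exact: measurable_cst.
have -> : average J f - c = v^-1 * (\int[mu]_(y in J) (f y - c)).
  rewrite RintegralB// Rintegral_cst// muJ/= /average muJ/=.
  by rewrite mulrBr mulrCA mulVf ?mulr1// gt_eqF.
rewrite normrM gtr0_norm ?invr_gt0// ler_pdivrMl//.
apply: le_trans (le_normr_Rintegral mJ intfc) _.
rewrite -lee_fin /Rintegral fineK; last first.
  rewrite ge0_fin_numE ?integral_ge0//.
  by move/integrableP : intfc => [].
apply: (@le_trans _ _ (\int[mu]_(y in J) (Z%:E + (Z `^ (1 - p))%:E * (`|f y - c| `^ p)%:E))%E).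
  apply: ge0_le_integral => //.
  - by apply/measurable_EFinP; exact: measurableT_comp.
  - apply: emeasurable_funD; first exact: measurable_cst.
    apply: emeasurable_funM; first exact: measurable_cst.
    apply/measurable_EFinP; apply: (measurableT_comp (measurable_powR _)).
    exact: measurableT_comp.
  - by move=> y _; rewrite -EFinM -EFinD lee_fin le_young_powR.
have mp : measurable_fun J (fun y => (`|f y - c| `^ p)%:E).
  apply/measurable_EFinP; apply: (measurableT_comp (measurable_powR _)).
  exact: measurableT_comp.
rewrite ge0_integralD//; last first.
- by apply: emeasurable_funM => //; exact: measurable_cst.
- by move=> y _; rewrite mule_ge0// lee_fin powR_ge0.
- by move=> y _; rewrite lee_fin ltW.
rewrite integral_cst// muJ ge0_integralZl_EFin ?powR_ge0//.
apply: le_trans (leeD (lexx _) (lee_wpmul2l _ fp)) _.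
  by rewrite lee_fin powR_ge0.
rewrite -!EFinM -EFinD lee_fin.
have -> : Z `^ (1 - p) * (v * Z `^ p) = v * Z.
  rewrite mulrCA -powRD ?subrK ?powRr1 ?(ltW Z0)//.
  by apply/implyP => _; rewrite gt_eqF.
by rewrite mulrCA; lra.
Qed.

End average.

Lemma ler_of_eq (R : numDomainType) (x y : R) : x = y -> x <= y.
Proof. by move=> ->. Qed.

Lemma measurable_eq_nat d (T : measurableType d) (R : realType) (idx : T -> nat) :
    (forall k, measurable [set y | idx y = k]) ->
  measurable_fun setT (fun z : T * T => (idx z.1 == idx z.2)%:R : R).
Proof.
move=> mi; pose D := \bigcup_k ([set y | idx y = k] `*` [set y | idx y = k]).
have mD : measurable D.
  by apply: bigcup_measurable => k _; exact: measurableX.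
rewrite (_ : (fun _ => _) = \1_D); first exact: measurable_indic.
apply/funext => -[x y]/=; rewrite indicE; congr (_%:R); congr nat_of_bool.
apply/eqP/idP; rewrite inE; first by move=> xy; exists (idx x).
by move=> [k _ [/= -> ->]].
Qed.

Lemma le_term_nneseries (R : realType) (u : (\bar R)^nat) j :
  (forall i, 0 <= u i)%E -> (u j <= \sum_(i <oo) u i)%E.
Proof.
move=> u0; apply: le_trans (nneseries_lim_ge j.+1 _); last by move=> *; exact: u0.
by rewrite big_mkcond/= big_nat_recr//= leeDr// sume_ge0.
Qed.

Section dyadic_oscillation.
Context d (T : measurableType d) (R : realType).
Variable mu : {sigma_finite_measure set T -> \bar R}.
Variables (E : set T) (M : R) (idx : nat -> T -> nat) (f : T -> R) (s p : R).
Let L : R := ln 2.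

Definition dyadic_cell j x := E `&` [set y | idx j y = idx j x].

Definition osc_term j x : \bar R := (\int[mu]_(y in E)
   (`|f x - f y| `^ p * (idx j x == idx j y)%:R)%:E)%E.

(** A dyadic model of the inner integral of a one-dimensional Gagliardo seminorm, divided by [M]: a
    pair that first separates at level [j + 1] receives a total weight of order [2^((1 + s p) j)],
    as if its distance were [2^-j]. *)
Definition osc x : \bar R :=
  (\sum_(j <oo) (expR ((1 + s * p) * L * j%:R) / M)%:E * osc_term j x)%E.

Hypotheses (mE : measurable E) (muE : mu E = M%:E) (M0 : 0 < M).
Hypothesis midx : forall j k, measurable [set y | idx j y = k].
Hypothesis mu_cell : forall j x, E x ->
  mu (dyadic_cell j x) = (M * expR (- (L * j%:R)))%:E.
Hypothesis idx0 : forall x y, E x -> E y -> idx 0 x = idx 0 y.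
Hypothesis idx_nested : forall j x y, E x -> E y ->
  idx j.+1 x = idx j.+1 y -> idx j x = idx j y.
Hypotheses (mf : measurable_fun setT f) (intf : mu.-integrable E (EFin \o f)).
Hypotheses (p1 : 1 < p) (s0 : 0 < s).

Let L0 : 0 < L. Proof. by rewrite ln_gt0// ltr1n. Qed.
Let p0 : 0 < p. Proof. exact: lt_trans p1. Qed.

Lemma measurable_osc_kernel j :
  measurable_fun setT (fun z : T * T => (`|f z.1 - f z.2| `^ p * (idx j z.1 == idx j z.2)%:R)%:E).
Proof.
apply/measurable_EFinP; apply: measurable_funM; last exact: measurable_eq_nat.
apply: (measurableT_comp (measurable_powR _)); apply: measurableT_comp => //.
apply: measurable_funB; first exact: measurableT_comp measurable_fst.
exact: measurableT_comp measurable_snd.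
Qed.

Lemma osc_kernel_ge0 j x y : (0 <= (`|f x - f y| `^ p * (idx j x == idx j y)%:R)%:E)%E.
Proof. by rewrite lee_fin mulr_ge0 ?powR_ge0. Qed.

Lemma osc_term_ge0 j x : (0 <= osc_term j x)%E.
Proof. by apply: integral_ge0 => y _; exact: osc_kernel_ge0. Qed.

Lemma measurable_osc_term j : measurable_fun setT (osc_term j).
Proof.
pose h := (fun z : T * T => (`|f z.1 - f z.2| `^ p * (idx j z.1 == idx j z.2)%:R)%:E)
  \_ (setT `*` E).
have mh : measurable_fun setT h.
  apply/(measurable_restrictT _ _).1; first exact: measurableX.
  exact: measurable_funS (measurable_osc_kernel j).
have h0 z : (0 <= h z)%E.
  by apply: erestrict_ge0 => *; exact: osc_kernel_ge0.
have := measurable_fun_fubini_tonelli_F (m2 := mu) h mh h0.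
congr (measurable_fun _ _); apply/funext => x; rewrite /fubini_F /osc_term.
rewrite [RHS]integral_mkcond; apply: eq_integral => y _.
by rewrite /h /patch in_setX in_setT.
Qed.

Lemma osc_ge0 x : (0 <= osc x)%E.
Proof.
apply: nneseries_ge0 => j _ _; rewrite mule_ge0 ?osc_term_ge0//.
by rewrite lee_fin divr_ge0 ?expR_ge0// ltW.
Qed.

Lemma measurable_osc : measurable_fun setT osc.
Proof.
apply: ge0_emeasurable_sum => [j x _ _|j _].
  by rewrite mule_ge0 ?osc_term_ge0// lee_fin divr_ge0 ?expR_ge0// ltW.
by apply: emeasurable_funM; [exact: measurable_cst|exact: measurable_osc_term].
Qed.

Lemma measurable_dyadic_cell j x : measurable (dyadic_cell j x).
Proof. exact: measurableI. Qed.

Lemma dyadic_cell_eq j x y : E x -> dyadic_cell j x y ->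
  dyadic_cell j y = dyadic_cell j x.
Proof. by move=> Ex [Ey /= xy]; rewrite /dyadic_cell xy. Qed.

Lemma dyadic_cellS j x y : E x -> dyadic_cell j.+1 x y -> dyadic_cell j x y.
Proof. by move=> Ex [Ey /= xy]; split => //=; exact: idx_nested. Qed.

Lemma dyadic_cell0 x : E x -> dyadic_cell 0 x = E.
Proof.
by move=> Ex; apply/seteqP; split => [y []//|y Ey]; split => //=; exact: idx0.
Qed.

Lemma integral_cell_le_osc j x : E x ->
  (\int[mu]_(y in dyadic_cell j x) (`|f y - f x| `^ p)%:E <=
    (M * expR (- ((1 + s * p) * L * j%:R)))%:E * osc x)%E.
Proof.
move=> Ex.
have tj : (\int[mu]_(y in dyadic_cell j x) (`|f y - f x| `^ p)%:E <= osc_term j x)%E.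
  rewrite (eq_integral (fun y => (`|f x - f y| `^ p * (idx j x == idx j y)%:R)%:E)); last first.
    by move=> y /[!inE] -[Ey /= ->]; rewrite eqxx mulr1 distrC.
  apply: ge0_subset_integral => //; first exact: measurable_dyadic_cell.
    apply: measurable_funTS.
    exact: measurableT_comp (measurable_osc_kernel j) (measurable_pair1 x).
  by move=> y [].
apply: le_trans tj _.
set c := expR _.
have -> : osc_term j x = (((M * c)%:E * ((expR ((1 + s * p) * L * j%:R) / M)%:E * osc_term j x)))%E.
  rewrite muleA -EFinM /c expRN.
  rewrite (_ : _ * _ = 1) ?mul1e//.
  by field; rewrite !gt_eqF ?expR_gt0.
apply: lee_wpmul2l; first by rewrite lee_fin mulr_ge0 ?expR_ge0// ltW.
apply: (le_term_nneseries (u := fun j => ((expR ((1 + s * p) * L * j%:R) / M)%:E *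
  osc_term j x)%E)).
move=> i; rewrite mule_ge0 ?osc_term_ge0// lee_fin divr_ge0 ?expR_ge0//.
exact: ltW.
Qed.

Let expL : expR L = 2. Proof. by rewrite lnK// posrE. Qed.

Lemma integrable_cell j x : mu.-integrable (dyadic_cell j x) (EFin \o f).
Proof.
by apply: integrableS intf => //; [exact: measurable_dyadic_cell|move=> y []].
Qed.

(** Only the [j]-th term of [osc] is used. A cell has measure [M 2^-j], so of the weight
    [2^((1 + s p) j)] the mean [p]-th power of the deviation keeps the decay [2^-(s p j)]. *)
Lemma cell_average_sub_le j x g : E x -> (osc x <= (expR (p * g))%:E)%E ->
  `|average mu (dyadic_cell j x) f - f x| <= 2 * expR (g - s * L * j%:R).
Proof.
move=> Ex oscg.
apply: (@average_sub_le _ _ _ mu _ _ (M * expR (- (L * j%:R))) _ p) => //.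
- exact: ltW.
- exact: measurable_dyadic_cell.
- exact: mu_cell.
- by rewrite mulr_gt0 ?expR_gt0.
- exact: expR_gt0.
- exact: integrable_cell.
- apply: le_trans (integral_cell_le_osc j Ex) _.
  apply: le_trans (lee_wpmul2l _ oscg) _.
    by rewrite lee_fin mulr_ge0 ?expR_ge0// ltW.
  rewrite -EFinM lee_fin -!mulrA ler_pM2l// -expRM -!expRD ler_expR.
  by apply: ler_of_eq; ring.
Qed.

Definition avg_jump j x :=
  `|average mu (dyadic_cell j.+1 x) f - average mu (dyadic_cell j x) f|.

Lemma avg_jump_le j x g : E x -> (osc x <= (expR (p * g))%:E)%E ->
  avg_jump j x <= 4 * expR (g - s * L * j%:R).
Proof.
move=> Ex oscg; have H1 := cell_average_sub_le j Ex oscg.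
have H2 := cell_average_sub_le j.+1 Ex oscg.
apply: le_trans (ler_distD (f x) _ _) _.
rewrite [X in _ + X]distrC.
have H3 : expR (g - s * L * j.+1%:R) <= expR (g - s * L * j%:R).
  by rewrite ler_expR lerD2l lerN2 ler_wpM2l ?mulr_ge0 ?ler_nat// ltW.
lra.
Qed.

(** The jump is constant on a cell of level [j + 1], so its [p]-th power may be averaged there.
    Bounding it by the integral over all of [E] and dividing by the measure [M 2^-(j + 1)] of the
    cell produces the growth [2^(j / p)]. *)
Lemma avg_jump_le_integral j x m : E x ->
  (\int[mu]_(y in E) osc y <= (M * expR (p * m))%:E)%E ->
  avg_jump j x <= 16 * expR (m + (p^-1 - s) * L * j%:R).
Proof.
move=> Ex oscm; set K := dyadic_cell j.+1 x.
have mK : measurable K by exact: measurable_dyadic_cell.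
have KE : K `<=` E by move=> y [].
pose c := 4 `^ p * expR (- (s * p * L * j%:R)).
have c0 : 0 < c by rewrite mulr_gt0 ?powR_gt0 ?expR_gt0.
have J0 : 0 <= avg_jump j x by exact: normr_ge0.
have pw y : K y -> ((avg_jump j x `^ p)%:E <= c%:E * (osc y + (expR (p * m))%:E))%E.
  move=> Ky; have Ey := KE _ Ky.
  have -> : avg_jump j x = avg_jump j y.
    rewrite /avg_jump (dyadic_cell_eq Ex Ky).
    by rewrite (dyadic_cell_eq Ex (dyadic_cellS Ex Ky)).
  have := osc_ge0 y; case oy : (osc y) => [r| |]//; last first.
    by move=> _; rewrite addye// gt0_muley ?lte_fin// leey.
  rewrite lee_fin => r0; rewrite -EFinD -EFinM lee_fin.
  (* [expR (p * m)] is added because [osc y] may be 0 and then has no logarithm; its integral over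
     the cell is of the order already allowed. *)
  have rm : 0 < r + expR (p * m) by rewrite ltr_wpDl// expR_gt0.
  pose g := ln (r + expR (p * m)) / p.
  have gE : expR (p * g) = r + expR (p * m).
    by rewrite /g mulrC divfK ?gt_eqF// lnK.
  have oscg : (osc y <= (expR (p * g))%:E)%E.
    by rewrite oy gE lee_fin lerDl expR_ge0.
  have := @ge0_ler_powR _ p (ltW p0) _ _ _ _ (avg_jump_le j Ey oscg).
  rewrite !nnegrE normr_ge0 mulr_ge0 ?expR_ge0// => /(_ isT isT) /le_trans; apply.
  rewrite powRM ?expR_ge0// -expRM -gE /c -(mulrA (4 `^ p)) -expRD ler_pM2l ?powR_gt0//.
  by rewrite ler_expR; apply: ler_of_eq; ring.
have moscK : measurable_fun K osc by apply: measurable_funTS; exact: measurable_osc.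
have : (\int[mu]_(y in K) (avg_jump j x `^ p)%:E <=
    \int[mu]_(y in K) (c%:E * (osc y + (expR (p * m))%:E)))%E.
  apply: ge0_le_integral => //.
  - by move=> y _; rewrite lee_fin powR_ge0.
  - apply: emeasurable_funM; first exact: measurable_cst.
    by apply: emeasurable_funD => //; exact: measurable_cst.
have oscD y : (0 <= osc y + (expR (p * m))%:E)%E.
  by rewrite adde_ge0 ?osc_ge0// lee_fin expR_ge0.
have mD : measurable_fun K (fun y => osc y + (expR (p * m))%:E)%E.
  by apply: emeasurable_funD => //; exact: measurable_cst.
have osc0 y : K y -> (0 <= osc y)%E by move=> _; exact: osc_ge0.
have e0 y : K y -> (0 <= (expR (p * m))%:E)%E.
  by move=> _; rewrite lee_fin expR_ge0.
rewrite integral_cst// ge0_integralZl_EFin ?(ltW c0)//.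
rewrite ge0_integralD//.
have muK : (mu : {measure set T -> \bar R}) K = (M * expR (- (L * j.+1%:R)))%:E.
  exact: mu_cell.
rewrite integral_cst// muK.
set v := M * expR _; have v0 : 0 < v by rewrite mulr_gt0 ?expR_gt0.
have vM : v <= M.
  by rewrite /v ger_pMr// expR_le1 oppr_le0 mulr_ge0// ltW.
move=> H.
have {H} : ((avg_jump j x `^ p)%:E * v%:E <=
    c%:E * ((M * expR (p * m))%:E + (expR (p * m))%:E * v%:E))%E.
  apply: le_trans H _; apply: lee_wpmul2l; first by rewrite lee_fin ltW.
  rewrite leeD2r//; apply: le_trans oscm; apply: ge0_subset_integral => //.
    by apply: measurable_funTS; exact: measurable_osc.
  by move=> y _; exact: osc_ge0.
rewrite -!EFinM lee_fin => H.
have {H} H : avg_jump j x `^ p <= (2 * c * expR (p * m)) * (M / v).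
  rewrite mulrA ler_pdivlMr//; apply: le_trans H _.
  have : 0 <= c * expR (p * m) * (M - v).
    by rewrite !mulr_ge0 ?expR_ge0 ?subr_ge0// ltW.
  lra.
have Mv : M / v = 2 * expR (L * j%:R).
  rewrite /v invfM mulrA divff ?gt_eqF// mul1r -expRN opprK.
  by rewrite -natr1 mulrDr mulr1 expRD expL mulrC.
rewrite {}Mv in H.
rewrite leNgt; apply/negP => /(gt0_ltr_powR p0) lt.
have {lt} := lt (mulr_ge0 (ler0n _ _) (expR_ge0 _)) J0; apply/negP; rewrite -leNgt.
apply: le_trans H _.
rewrite powRM ?expR_ge0// -expRM.
(* One factor 4 is the constant of [avg_jump_le]; the other absorbs two factors 2, since
   [4 <= 4^p]. *)
have -> : (16 : R) = 4 * 4 by rewrite -natrM.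
rewrite powRM//.
have -> : 2 * c * expR (p * m) * (2 * expR (L * j%:R)) =
   4 * (4 `^ p * expR ((m + (p^-1 - s) * L * j%:R) * p)).
  have -> : (m + (p^-1 - s) * L * j%:R) * p =
     - (s * p * L * j%:R) + p * m + L * j%:R.
    by field; rewrite gt_eqF.
  by rewrite /c !expRD; ring.
rewrite -!mulrA ler_wpM2r ?mulr_ge0 ?powR_ge0 ?expR_ge0//.
by apply: le1r_powR; [rewrite ler1n|exact: ltW].
Qed.

Section Lq_bound.
Variables (q k : R).
Hypothesis q1 : 1 <= q.
Hypothesis fq : (\int[mu]_(y in E) (`|f y| `^ q)%:E <= (M * expR (q * k))%:E)%E.

Let q0 : 0 < q. Proof. exact: lt_le_trans q1. Qed.

Lemma cell_average_le j x : E x ->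
  `|average mu (dyadic_cell j x) f| <= 2 * expR (k + q^-1 * L * j%:R).
Proof.
move=> Ex; rewrite -[average _ _ _]subr0.
apply: (@average_sub_le _ _ _ mu _ _ (M * expR (- (L * j%:R))) _ q) => //.
- exact: measurable_dyadic_cell.
- exact: mu_cell.
- by rewrite mulr_gt0 ?expR_gt0.
- exact: expR_gt0.
- exact: integrable_cell.
- under eq_integral do rewrite subr0.
  rewrite -expRM -mulrA -expRD.
  have -> : - (L * j%:R) + (k + q^-1 * L * j%:R) * q = q * k.
    by field; rewrite gt_eqF.
  apply: le_trans fq; apply: ge0_subset_integral => //.
  + exact: measurable_dyadic_cell.
  + apply/measurable_EFinP; apply: (measurableT_comp (measurable_powR _)).
    by apply: measurableT_comp => //; exact: measurable_funTS.
  + by move=> y [].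
Qed.

Lemma avg_jump_le_Lq j x : E x ->
  avg_jump j x <= 16 * expR (k + q^-1 * L * j%:R).
Proof.
move=> Ex; apply: le_trans (ler_normB _ _) _.
have H1 := cell_average_le j Ex; have H2 := cell_average_le j.+1 Ex.
have : expR (k + q^-1 * L * j.+1%:R) <= 2 * expR (k + q^-1 * L * j%:R).
  rewrite -expL -expRD ler_expR -natr1.
  have : q^-1 * L <= L by rewrite ger_pMl// invf_le1.
  by rewrite mulrDr mulr1; lra.
have := expR_ge0 (k + q^-1 * L * j%:R); lra.
Qed.

End Lq_bound.

Lemma sub_average_le n x g : E x -> (osc x <= (expR (p * g))%:E)%E ->
  `|f x - average mu E f| <=
    16 * expR (g - s * L * n%:R) + \sum_(j < n) avg_jump j x.
Proof.
move=> Ex oscg.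
have H : `|average mu (dyadic_cell n x) f - average mu E f| <=
    \sum_(j < n) avg_jump j x.
  rewrite -(dyadic_cell0 Ex); elim: n => [|n IH].
    by rewrite subrr normr0 big_ord0.
  rewrite big_ord_recr/=; apply: le_trans (ler_distD (average mu (dyadic_cell n x) f) _ _) _.
  by rewrite addrC lerD.
have := cell_average_sub_le n Ex oscg; rewrite distrC => H2.
apply: le_trans (ler_distD (average mu (dyadic_cell n x) f) _ _) _.
by apply: lerD => //; apply: (le_trans H2); rewrite ler_wpM2r ?expR_ge0// ler_nat.
Qed.

End dyadic_oscillation.

Definition dyadic_partition d (T : measurableType d) (R : realType)
    (mu : {measure set T -> \bar R}) (E : set T) (M : R) (idx : nat -> T -> nat) :=
  [/\ [/\ measurable E, mu E = M%:E & 0 < M],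
      (forall j k, measurable [set y | idx j y = k]),
      (forall j x, E x -> mu (dyadic_cell E idx j x) = (M * expR (- (ln 2 * j%:R)))%:E),
      (forall x y, E x -> E y -> idx 0 x = idx 0 y) &
      (forall j x y, E x -> E y -> idx j.+1 x = idx j.+1 y -> idx j x = idx j y)].

Lemma powR_add_le (R : realType) (x y t : R) : 0 <= t -> 0 <= x -> 0 <= y ->
  (x + y) `^ t <= 2 `^ t * (x `^ t + y `^ t).
Proof.
move=> t0 x0 y0.
wlog xy : x y x0 y0 / x <= y => [H|].
  have [|/ltW yx] := leP x y; first exact: H.
  by rewrite addrC [X in _ * X]addrC; exact: H.
apply: le_trans (_ : (2 * y) `^ t <= _).
  apply: ge0_ler_powR => //; rewrite ?nnegrE ?addr_ge0 ?mulr_ge0//.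
  by rewrite mulr_natl mulr2n lerD2r.
by rewrite powRM// ler_wpM2l ?powR_ge0// lerDr powR_ge0.
Qed.

Section dyadic_gagliardo_nirenberg.
Context d (T : measurableType d) (R : realType).
Variable mu : {sigma_finite_measure set T -> \bar R}.
Variables (E : set T) (M : R) (idx : nat -> T -> nat) (f : T -> R).
Variables (p q tau s a C : R).
Hypothesis Eidx : dyadic_partition mu E M idx.
Hypotheses (mf : measurable_fun setT f) (intf : mu.-integrable E (EFin \o f)).
Hypotheses (p1 : 1 < p) (q1 : 1 <= q) (tau1 : 1 <= tau) (s0 : 0 < s) (C0 : 0 < C).
Hypothesis HC : forall (X : nat -> R) g m k D, 0 <= D ->
    (forall j, 0 <= X j <= 16 * expR (g - s * ln 2 * j%:R)) ->
    (forall j, X j <= 16 * expR (m + (p^-1 - s) * ln 2 * j%:R)) ->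
    (a < 1 -> forall j, X j <= 16 * expR (k + q^-1 * ln 2 * j%:R)) ->
    (forall n, D <= 16 * expR (g - s * ln 2 * n%:R) + \sum_(j < n) X j) ->
  D `^ tau <= C * expR (tau * (a * m + (1 - a) * k)) *
    (expR (p * (g - m)) + 1 + (a < 1)%R%:R * (D `^ q * expR (- (q * k)))).

(** The pointwise bound is integrated over [E]. Normalised by [expR (p * m)], the oscillation has
    mean at most 1; the constant 2 is the 1 of that bound plus the 1 from keeping [g] finite, whence
    the 3. The last term is controlled by [|f - av|^q <= 2^q (|f|^q + |av|^q)] and
    [|av| <= 2 expR k]. *)
Lemma integral_sub_average_le (m k : R) :
    (\int[mu]_(x in E) osc mu E M idx f s p x <= (M * expR (p * m))%:E)%E ->
    (a < 1 -> (\int[mu]_(y in E) (`|f y| `^ q)%:E <= (M * expR (q * k))%:E)%E) ->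
  (\int[mu]_(x in E) (`|f x - average mu E f| `^ tau)%:E <=
    (C * (3 + 2 `^ q * (1 + 2 `^ q)) * M * expR (tau * (a * m + (1 - a) * k)))%:E)%E.
Proof.
move=> oscm fq.
have [[mE muE M0] midx mu_cell idx0 nested] := Eidx.
have p0 : 0 < p by exact: lt_trans p1.
have q0 : 0 < q by exact: lt_le_trans q1.
have tau0 : 0 < tau by exact: lt_le_trans tau1.
pose av := average mu E f.
pose D x := `|f x - av|.
pose W := C * expR (tau * (a * m + (1 - a) * k)).
have W0 : 0 < W by rewrite mulr_gt0 ?expR_gt0.
have mD t : measurable_fun setT (fun x => (D x `^ t)%:E).
  apply/measurable_EFinP; apply: (measurableT_comp (measurable_powR _)).
  apply: measurableT_comp => //; apply: measurable_funB => //.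
have mosc : measurable_fun setT (osc mu E M idx f s p) by exact: measurable_osc.
have osc0 x : (0 <= osc mu E M idx f s p x)%E by exact: osc_ge0.
set O := osc mu E M idx f s p in oscm mosc osc0 *.
have pw x : E x -> ((D x `^ tau)%:E <= W%:E * ((expR (- (p * m)))%:E * O x + 2%:E +
    ((a < 1)%R%:R * expR (- (q * k)))%:E * (D x `^ q)%:E))%E.
  move=> Ex; have := osc0 x; case Ox : (O x) => [r| |]// => [|_]; last first.
    have -> : ((expR (- (p * m)))%:E * +oo = +oo)%E.
      by rewrite gt0_muley ?lte_fin ?expR_gt0.
    by rewrite -addeA addye ?gt0_muley ?lte_fin ?leey//.
  rewrite lee_fin => r0; rewrite -!EFinM lee_fin.
  have rm : 0 < r + expR (p * m) by rewrite ltr_wpDl// expR_gt0.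
  pose g := ln (r + expR (p * m)) / p.
  have gE : expR (p * g) = r + expR (p * m).
    by rewrite /g mulrC divfK ?gt_eqF// lnK.
  have oscg : (O x <= (expR (p * g))%:E)%E.
    by rewrite Ox gE lee_fin lerDl expR_ge0.
  have := HC (X := fun j => avg_jump mu E idx f j x) (g := g) (m := m) (k := k)
    (D := D x) (normr_ge0 _).
  have -> : expR (p * (g - m)) = expR (- (p * m)) * r + 1.
    by rewrite mulrBr expRD gE mulrDl -expRD subrr expR0 mulrC.
  rewrite -/W -[_ + 1 + 1]addrA [D x `^ q * expR _]mulrC mulrA => H; apply: H.
  - move=> j; rewrite normr_ge0/=.
    apply: le_trans (avg_jump_le mE M0 midx mu_cell mf intf p1 s0 j Ex oscg) _.
    by rewrite ler_wpM2r ?expR_ge0// ler_nat.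
  - move=> j.
    exact: (avg_jump_le_integral mE M0 midx mu_cell nested mf intf p1 s0).
  - move=> a1 j.
    exact: (avg_jump_le_Lq mE M0 midx mu_cell mf intf q1 (fq a1)).
  - by move=> n; exact: (sub_average_le mE M0 midx mu_cell idx0 mf intf p1).
have fqD : (((a < 1)%R%:R * expR (- (q * k)))%:E * \int[mu]_(x in E) (D x `^ q)%:E <=
    (2 `^ q * (1 + 2 `^ q) * M)%:E)%E.
  have [a1|a1] := ltP a 1; last first.
    by rewrite mul0r mul0e lee_fin !mulr_ge0 ?addr_ge0 ?powR_ge0// ltW.
  (* A point of [E] is needed to read [E] as a cell of level 0, whose average is bounded by
     [cell_average_le]. *)
  have [x Ex] : E !=set0.
    apply/set0P; apply: contraTN M0 => /eqP E0; rewrite -leNgt.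
    by have := muE; rewrite E0 measure0 => -[->].
  have avk : `|av| <= 2 * expR k.
    have := cell_average_le mE M0 midx mu_cell mf intf q1 (fq a1) 0 Ex.
    by rewrite (dyadic_cell0 idx0 Ex) mulr0 addr0.
  have mfq : measurable_fun E (fun y => (`|f y| `^ q)%:E).
    apply: measurable_funTS.
    apply/measurable_EFinP; apply: (measurableT_comp (measurable_powR _)).
    exact: measurableT_comp.
  have H1 : (\int[mu]_(x in E) (D x `^ q)%:E <=
      \int[mu]_(x in E) ((2 `^ q)%:E * ((`|f x| `^ q)%:E + (`|av| `^ q)%:E)))%E.
    apply: ge0_le_integral => //.
    - by move=> y _; rewrite lee_fin powR_ge0.
    - exact: measurable_funTS.
    - apply: emeasurable_funM; first exact: measurable_cst.
      by apply: emeasurable_funD => //; exact: measurable_cst.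
    - move=> y _; rewrite -EFinD -EFinM lee_fin.
      apply: le_trans (powR_add_le (ltW q0) (normr_ge0 _) (normr_ge0 _)).
      by apply: ge0_ler_powR; rewrite /D ?nnegrE ?addr_ge0 ?(ltW q0) ?ler_normB.
  have f0 y : E y -> (0 <= (`|f y| `^ q)%:E)%E by rewrite lee_fin powR_ge0.
  have a0 y : E y -> (0 <= (`|av| `^ q)%:E)%E by rewrite lee_fin powR_ge0.
  have fa0 y : E y -> (0 <= (`|f y| `^ q)%:E + (`|av| `^ q)%:E)%E.
    by move=> Ey; rewrite adde_ge0 ?f0 ?a0.
  have mfa : measurable_fun E (fun y => (`|f y| `^ q)%:E + (`|av| `^ q)%:E)%E.
    by apply: emeasurable_funD => //; exact: measurable_cst.
  rewrite ge0_integralZl_EFin ?powR_ge0// in H1.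
  rewrite ge0_integralD// in H1.
  rewrite integral_cst// in H1.
  have muE' : (mu : {measure set T -> \bar R}) E = M%:E by exact: muE.
  rewrite muE' in H1.
  apply: le_trans (lee_wpmul2l _ H1) _; first by rewrite lee_fin mul1r expR_ge0.
  have H2 : ((2 `^ q)%:E * (\int[mu]_(x in E) (`|f x| `^ q)%:E + (`|av| `^ q)%:E * M%:E) <=
      (2 `^ q)%:E * ((M * expR (q * k))%:E + (2 `^ q * expR (q * k))%:E * M%:E))%E.
    apply: lee_wpmul2l; first by rewrite lee_fin powR_ge0.
    apply: leeD; first exact: fq.
    rewrite -EFinM lee_fin ler_wpM2r ?(ltW M0)//.
    rewrite [q * k]mulrC expRM -powRM ?expR_ge0//.
    apply: ge0_ler_powR => //; first exact: ltW.
    by rewrite nnegrE mulr_ge0 ?expR_ge0.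
  apply: le_trans (lee_wpmul2l _ H2) _; first by rewrite lee_fin mul1r expR_ge0.
  rewrite -!EFinM lee_fin mul1r; apply: ler_of_eq.
  transitivity (2 `^ q * (1 + 2 `^ q) * M * (expR (- (q * k)) * expR (q * k))).
    by ring.
  by rewrite -expRD addNr expR0 mulr1.
apply: (@le_trans _ _ (\int[mu]_(x in E) (W%:E * ((expR (- (p * m)))%:E * O x + 2%:E +
    ((a < 1)%R%:R * expR (- (q * k)))%:E * (D x `^ q)%:E)))%E).
  apply: ge0_le_integral => //.
  - exact: measurable_funTS.
  - apply: measurable_funTS; apply: emeasurable_funM; first exact: measurable_cst.
    apply: emeasurable_funD; last by apply: emeasurable_funM => //; exact: measurable_cst.
    apply: emeasurable_funD; last exact: measurable_cst.
    by apply: emeasurable_funM => //; exact: measurable_cst.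
have A1 x : (0 <= (expR (- (p * m)))%:E * O x)%E.
  by rewrite mule_ge0// lee_fin expR_ge0.
have A2 x : (0 <= ((a < 1)%R%:R * expR (- (q * k)))%:E * (D x `^ q)%:E)%E.
  by rewrite mule_ge0// lee_fin ?powR_ge0// mulr_ge0 ?expR_ge0.
have m1 : measurable_fun E (fun x => (expR (- (p * m)))%:E * O x)%E.
  by apply: measurable_funTS; apply: emeasurable_funM => //; exact: measurable_cst.
have m2 : measurable_fun E (fun x => ((a < 1)%R%:R * expR (- (q * k)))%:E * (D x `^ q)%:E)%E.
  by apply: measurable_funTS; apply: emeasurable_funM => //; exact: measurable_cst.
have m3 : measurable_fun E (fun x => (expR (- (p * m)))%:E * O x + 2%:E)%E.
  by apply: emeasurable_funD => //; exact: measurable_cst.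
have A3 x : (0 <= (expR (- (p * m)))%:E * O x + 2%:E)%E.
  by rewrite adde_ge0.
have m4 : measurable_fun E (fun x => (expR (- (p * m)))%:E * O x + 2%:E +
    ((a < 1)%R%:R * expR (- (q * k)))%:E * (D x `^ q)%:E)%E by exact: emeasurable_funD.
have A4 x : (0 <= (expR (- (p * m)))%:E * O x + 2%:E +
    ((a < 1)%R%:R * expR (- (q * k)))%:E * (D x `^ q)%:E)%E by rewrite adde_ge0.
have mOE : measurable_fun E O by exact: measurable_funTS.
have mDE : measurable_fun E (fun x => (D x `^ q)%:E) by exact: measurable_funTS.
have D0 x : (0 <= (D x `^ q)%:E)%E by rewrite lee_fin powR_ge0.
have c0 : 0 <= (a < 1)%R%:R * expR (- (q * k)) by rewrite mulr_ge0 ?expR_ge0.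
rewrite ge0_integralZl_EFin ?(ltW W0)//.
rewrite ge0_integralD// ge0_integralD//.
rewrite ge0_integralZl_EFin ?expR_ge0// [X in (_ + X)%E]ge0_integralZl_EFin//.
have muE' : (mu : {measure set T -> \bar R}) E = M%:E by exact: muE.
rewrite integral_cst// muE'.
apply: (@le_trans _ _ (W%:E * ((expR (- (p * m)))%:E * (M * expR (p * m))%:E + 2%:E * M%:E +
   (2 `^ q * (1 + 2 `^ q) * M)%:E))%E).
  apply: lee_wpmul2l; first by rewrite lee_fin ltW.
  apply: leeD => //; apply: leeD => //.
  by apply: lee_wpmul2l => //; rewrite lee_fin expR_ge0.
rewrite -!EFinM lee_fin /W; apply: ler_of_eq.
have -> : expR (- (p * m)) * (M * expR (p * m)) = M.
  by rewrite mulrCA -expRD addNr expR0 mulr1.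
by ring.
Qed.

End dyadic_gagliardo_nirenberg.

(** * Lebesgue measure and radial functions *)

Lemma measurable_forall d (T : measurableType d) (I : finType) (A : I -> set T) :
  (forall i, measurable (A i)) -> measurable [set x | forall i, A i x].
Proof.
move=> mA; rewrite (_ : [set x | _] = \bigcap_(i in [set: I]) A i); last first.
  by apply/seteqP; split => x /= H i; [move=> _|]; apply: H.
by apply: fin_bigcap_measurable => //; exact: finite_finset.
Qed.

Lemma measurable_rsum d (T : measurableType d) (R : realType) (D : set T)
    (I : Type) (s : seq I) (h : I -> T -> R) :
  (forall i, measurable_fun D (h i)) ->
  measurable_fun D (fun x => \sum_(i <- s) h i x).
Proof.
move=> mh; elim: s => [|i s IH].
  by under eq_fun do rewrite big_nil; exact: measurable_cst.
by under eq_fun do rewrite big_cons; exact: measurable_funD.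
Qed.

Section lebesgue_rV_facts.
Context {R : realType}.

Lemma lebesgue_rVSX (n : nat) (J : set (measurableTypeR R)) (B : set 'rV[R]_n) :
  measurable J -> measurable B ->
  lebesgue_rV R n.+1 [set x | J (x ord0 ord0) /\ B (\row_i x ord0 (lift ord0 i))]
    = (lebesgue_measure J * lebesgue_rV R n B)%E.
Proof.
move=> mJ mB; rewrite -product_measure1E//=.
rewrite /lebesgue_rV_succ /pushforward; congr (_ _).
have E (t : R) (y : 'rV[R]_n) : (\row_i rV_cons (t, y) ord0 (lift ord0 i)) = y.
  by apply/rowP => i; rewrite !mxE liftK.
apply/seteqP; split => -[t y]; rewrite /preimage/= E mxE unlift_none//=.
Qed.

Definition rV_box (n : nat) (J : set R) : set 'rV[R]_n := [set x | forall i, J (x ord0 i)].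
Arguments rV_box : clear implicits.

Lemma measurable_rV_box n (J : set (measurableTypeR R)) :
  measurable J -> measurable (rV_box n J).
Proof.
move=> mJ; apply: measurable_forall => i.
by rewrite -[X in measurable X]setTI; exact: measurable_coord.
Qed.

Lemma lebesgue_rV_boxE n (J : set (measurableTypeR R)) : measurable J ->
  lebesgue_rV R n (rV_box n J) = (\prod_(i < n) lebesgue_measure J)%E.
Proof.
move=> mJ; elim: n => [|n IH].
  by rewrite big_ord0/= diracE mem_set// => -[].
rewrite big_ord_recl -IH -lebesgue_rVSX//; last exact: measurable_rV_box.
congr (lebesgue_rV _ _ _); apply/seteqP; split => x /= H.
  by split => [|i]; rewrite ?mxE; apply: H.
move=> i; case: (unliftP ord0 i) => [j ->|->]; last by case: H.
by have [_ /(_ j)] := H; rewrite mxE.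
Qed.

Lemma lebesgue_measure_scale (c : R) (A : set (measurableTypeR R)) :
  0 < c -> measurable A ->
  (c%:E * lebesgue_measure ( *%R c @^-1` A) = lebesgue_measure A)%E.
Proof.
move=> c0 mA.
pose f (x : measurableTypeR R) : measurableTypeR R := c * x.
have mf : measurable_fun setT f by exact: mulrl_measurable.
pose pf : {measure set (measurableTypeR R) -> \bar R} :=
  pushforward (@lebesgue_measure R) f.
apply/esym; transitivity (mscale (NngNum (ltW c0)) (pf mf) A) => //.
apply: lebesgue_measure_unique => //.
move=> X [[a b] /= _ <-].
rewrite /mscale/= /pushforward /=.
have -> : f @^-1` `]a, b] = `]c^-1 * a, c^-1 * b]%classic.
  apply/seteqP; split => x /=; rewrite !in_itv/= ltr_pdivrMl// ler_pdivlMl//.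
rewrite !lebesgue_measure_itv/= !lte_fin ltr_pM2l ?invr_gt0//.
case: ifP => _; last by rewrite mule0.
by rewrite -!EFinD -EFinM; congr EFin; field; rewrite gt_eqF.
Qed.

Lemma measurable_rV_scale n (c : R) :
  measurable_fun [set: 'rV[R]_n] (fun x : 'rV[R]_n => c *: x).
Proof.
apply: measurable_fun_rV => i; under eq_fun do rewrite mxE.
apply: measurable_funM; [exact: measurable_cst|exact: measurable_coord].
Qed.

(** By induction on the dimension: the rescaled product measure has the right value on rectangles,
    and these determine a product measure. *)
Lemma lebesgue_rV_scale n (c : R) (A : set 'rV[R]_n) : 0 < c -> measurable A ->
  ((c ^+ n)%:E * lebesgue_rV R n [set x | A (c *: x)] = lebesgue_rV R n A)%E.
Proof.
move=> c0; elim: n A => [|n IH] A mA.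
  by rewrite expr0 mul1e/= !diracE/=; congr (_%:E); congr (_%:R); congr nat_of_bool;
    apply/idP/idP; rewrite !inE/= scaler0.
pose f (z : measurableTypeR R * 'rV[R]_n) : measurableTypeR R * 'rV[R]_n :=
  (c * z.1, c *: z.2).
have mf : measurable_fun setT f.
  apply/measurable_fun_pairP; split.
    by apply: measurable_funM; [exact: measurable_cst|exact: measurable_fst].
  exact: (measurableT_comp (measurable_rV_scale _) measurable_snd).
pose pf : {measure set (measurableTypeR R * 'rV[R]_n) -> \bar R} :=
  pushforward (lebesgue_measure \x lebesgue_rV R n)%E f.
pose m' := mscale (NngNum (exprn_ge0 n.+1 (ltW c0))) (pf mf).
have m'E (J : set (measurableTypeR R)) (B : set 'rV[R]_n) :
    measurable J -> measurable B ->
    m' (J `*` B) = (lebesgue_measure J * lebesgue_rV R n B)%E.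
  move=> mJ mB; rewrite /m' /mscale/= /pushforward.
  have -> : f @^-1` (J `*` B) = ( *%R c @^-1` J) `*` [set x | B (c *: x)] by [].
  have mJc : measurable ( *%R c @^-1` J).
    by rewrite -[X in measurable X]setTI; exact: mulrl_measurable.
  have mBc : measurable [set x | B (c *: x)].
    by rewrite -[X in measurable X]setTI; exact: measurable_rV_scale.
  rewrite product_measure1E// -(lebesgue_measure_scale c0 mJ) -IH//.
  by rewrite exprS EFinM muleACA.
have mA' : measurable (rV_cons @^-1` A).
  by rewrite -[X in measurable X]setTI; exact: measurable_rV_cons.
have mAc : measurable [set x | A (c *: x)].
  by rewrite -[X in measurable X]setTI; exact: measurable_rV_scale.
apply/esym; transitivity (m' (rV_cons @^-1` A)).
  exact: (product_measure_unique m'E).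
transitivity ((c ^+ n.+1)%:E *
    (lebesgue_measure \x lebesgue_rV R n) (f @^-1` (rV_cons @^-1` A)))%E => //.
congr (_ * _)%E.
transitivity ((lebesgue_measure \x lebesgue_rV R n)
    (rV_cons @^-1` [set x | A (c *: x)]))%E => //.
congr (_ _); apply/seteqP; split => -[t y] /=.
  by congr A; apply/rowP => i; rewrite !mxE; case: unlift => // j; rewrite !mxE.
by congr A; apply/rowP => i; rewrite !mxE; case: unlift => // j; rewrite !mxE.
Qed.

Lemma enormZ n (c : R) (x : 'rV[R]_n) : 0 <= c -> enorm (c *: x) = c * enorm x.
Proof.
move=> c0; rewrite /enorm; transitivity (Num.sqrt (c ^+ 2 * \sum_(i < n) x ord0 i ^+ 2)).
  by rewrite mulr_sumr; congr Num.sqrt; apply: eq_bigr => i _; rewrite mxE exprMn.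
by rewrite sqrtrM ?sqr_ge0// sqrtr_sqr ger0_norm.
Qed.

Lemma enorm_ge0 n (x : 'rV[R]_n) : 0 <= enorm x.
Proof. exact: sqrtr_ge0. Qed.

Lemma sqr_enorm n (x : 'rV[R]_n) : enorm x ^+ 2 = \sum_(i < n) x ord0 i ^+ 2.
Proof. by rewrite sqr_sqrtr// sumr_ge0// => i _; exact: sqr_ge0. Qed.

Lemma le_coord_enorm n (x : 'rV[R]_n) i : `|x ord0 i| <= enorm x.
Proof.
rewrite -[leLHS]ger0_norm// -[leRHS]ger0_norm ?enorm_ge0// -ler_sqr ?nnegrE//.
rewrite !real_normK ?num_real// sqr_enorm (bigD1 i)//= lerDl.
by rewrite sumr_ge0// => j _; exact: sqr_ge0.
Qed.

Lemma enorm_le_sum n (x : 'rV[R]_n) : enorm x <= \sum_(i < n) `|x ord0 i|.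
Proof.
rewrite -(@ler_pXn2r _ 2) ?nnegrE ?enorm_ge0 ?sumr_ge0// sqr_enorm expr2 mulr_suml.
apply: ler_sum => i _; rewrite -real_normK ?num_real// expr2 ler_wpM2l//.
by rewrite (bigD1 i)//= lerDl sumr_ge0.
Qed.

Lemma enorm_eq0 n (x : 'rV[R]_n) : enorm x = 0 -> x = 0.
Proof.
move=> x0; apply/rowP => i; rewrite mxE; apply/normr0_eq0/eqP.
by rewrite eq_le normr_ge0 andbT -x0 le_coord_enorm.
Qed.

Lemma measurable_enorm n : measurable_fun [set: 'rV[R]_n] (@enorm R n).
Proof.
have ms : measurable_fun [set: R] (Num.sqrt : R -> R).
  by apply: continuous_measurable_fun; exact: sqrt_continuous.
apply: (measurableT_comp ms); apply: measurable_rsum => i.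
by apply: measurable_funX; exact: measurable_coord.
Qed.

Definition is_cone n (C : set 'rV[R]_n) :=
  forall (c : R) x, 0 < c -> C x -> C (c *: x).

Lemma measurable_enorm_preimage n (J : set (measurableTypeR R)) : measurable J ->
  measurable [set x : 'rV[R]_n | J (enorm x)].
Proof. by move=> mJ; rewrite -[X in measurable X]setTI; exact: measurable_enorm. Qed.

Lemma cone_ballE n (C : set 'rV[R]_n) (r : R) : measurable C -> is_cone C -> 0 < r ->
  (lebesgue_rV R n (C `&` [set x | (enorm x < r)%R]) =
   (r ^+ n)%:E * lebesgue_rV R n (C `&` [set x | (enorm x < 1)%R]))%E.
Proof.
move=> mC coneC r0.
have mB (t : R) : measurable [set x : 'rV[R]_n | enorm x < t].
  have := @measurable_enorm_preimage n `]-oo, t[%classic (measurable_itv _).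
  by congr measurable; apply/seteqP; split => x /=; rewrite in_itv.
rewrite -(@lebesgue_rV_scale n r (C `&` [set x | (enorm x < r)%R])) //; last exact: measurableI.
congr (_ * lebesgue_rV R n _)%E; apply/seteqP; split => x /=; rewrite enormZ ?(ltW r0)//.
  move=> [Cx xr]; split; last by move: xr; rewrite -[ltRHS]mulr1 ltr_pM2l.
  by rewrite -[x]scale1r -(@mulVf _ r) ?gt_eqF// -scalerA; apply: coneC => //; rewrite invr_gt0.
by move=> [Cx x1]; split; [exact: coneC|rewrite -[ltRHS]mulr1 ltr_pM2l].
Qed.

Lemma lebesgue_rV_ball_fin n (r : R) :
  (lebesgue_rV R n [set x | (enorm x < r)%R] < +oo)%E.
Proof.
have mJ : measurable (`[- r, r]%classic : set (measurableTypeR R)) by exact: measurable_itv.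
apply: (@le_lt_trans _ _ (lebesgue_rV R n (rV_box n `[- r, r]%classic))).
  apply: le_measure; rewrite ?inE.
  - have := @measurable_enorm_preimage n `]-oo, r[%classic (measurable_itv _).
    by congr measurable; apply/seteqP; split => x /=; rewrite in_itv.
  - exact: measurable_rV_box.
  - move=> x /= xr i /=; rewrite in_itv/= -ler_norml.
    exact: le_trans (le_coord_enorm _ _) (ltW xr).
rewrite lebesgue_rV_boxE// lebesgue_measure_itv/=.
elim: n => [|n IH]; first by rewrite big_ord0 ltey.
rewrite big_ord_recl lte_mul_pinfty//.
- by case: ifP => //; rewrite lte_fin => h; rewrite lee_fin; lra.
- by case: ifP => _.
Qed.

(** This box serves as a test set: a cone containing it has positive solid angle. *)
Lemma lebesgue_rV_box_cone_gt0 n :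
  (0 < lebesgue_rV R n.+1 [set x : 'rV[R]_n.+1 | 1 < x ord0 ord0 <= 2 /\
     forall i, 0 < x ord0 (lift ord0 i) <= 1]%R)%E.
Proof.
pose J1 : set (measurableTypeR R) := `]1, 2]%classic.
pose J2 : set (measurableTypeR R) := `]0, 1]%classic.
have -> : [set x : 'rV[R]_n.+1 | (1 < x ord0 ord0 <= 2) /\
   forall i, (0 < x ord0 (lift ord0 i) <= 1)] =
  [set x | J1 (x ord0 ord0) /\ rV_box n J2 (\row_i x ord0 (lift ord0 i))].
  apply/seteqP; split => x /= [H1 H2].
    by split; [rewrite /J1/= in_itv|move=> i; rewrite mxE /J2/= in_itv/=].
  split; first by move: H1; rewrite /J1/= in_itv.
  by move=> i; have := H2 i; rewrite mxE /J2/= in_itv.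
have mJ2 : measurable J2 by exact: measurable_itv.
rewrite lebesgue_rVSX; [|exact: measurable_itv|exact: measurable_rV_box].
rewrite lebesgue_rV_boxE; last exact: measurable_itv.
rewrite /J1 /J2 !lebesgue_measure_itv/= !lte_fin ltr1n ltr01 !sube0.
rewrite mule_gt0//; first by rewrite lte_fin; lra.
by elim: n => [|n IH]; rewrite ?big_ord0// big_ord_recl mul1e.
Qed.

End lebesgue_rV_facts.

Lemma ge0_integral_mrestr d (T : measurableType d) (R : realType)
    (mu : {measure set T -> \bar R}) (D : set T) (mD : measurable D)
    (f : T -> \bar R) : measurable_fun setT f -> (forall x, (0 <= f x)%E) ->
  (\int[mrestr mu mD]_x f x = \int[mu]_(x in D) f x)%E.
Proof.
move=> mf f0; rewrite (@ge0_negligible_integral _ _ _ _ setT (~` D))//=.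
- rewrite setTD setCK; apply: eq_measure_integral => A mA AD.
  by rewrite /= /mrestr setIidl.
- exact: measurableC.
- by rewrite /= /mrestr setICl measure0.
Qed.

Section radial_integration.
Context {R : realType} (n : nat).
Local Notation mu := (lebesgue_rV R n.+1).
Implicit Types C : set 'rV[R]_n.+1.

Lemma measurable_enorm_lt (r : R) : measurable [set x : 'rV[R]_n.+1 | enorm x < r].
Proof.
have := @measurable_enorm_preimage R n.+1 `]-oo, r[%classic (measurable_itv _).
by congr measurable; apply/seteqP; split => x /=; rewrite in_itv.
Qed.

Definition cone_mass C := fine (mu (C `&` [set x | (enorm x < 1)%R])).

Lemma cone_mass_ge0 C : 0 <= cone_mass C.
Proof. exact: fine_ge0. Qed.

Lemma cone_massE C : measurable C ->
  (mu (C `&` [set x | (enorm x < 1)%R]) = (cone_mass C)%:E)%E.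
Proof.
move=> mC; rewrite fineK// ge0_fin_numE//.
apply: le_lt_trans (lebesgue_rV_ball_fin n.+1 1); apply: le_measure; rewrite ?inE//.
  by apply: measurableI => //; exact: measurable_enorm_lt.
exact: measurable_enorm_lt.
Qed.

Lemma cone_mass_gt0 C : measurable C -> is_cone C ->
  [set x : 'rV[R]_n.+1 | 1 < x ord0 ord0 <= 2 /\
     forall i, 0 < x ord0 (lift ord0 i) <= 1] `<=` C -> 0 < cone_mass C.
Proof.
move=> mC coneC sC; pose r : R := 2 * n.+1%:R + 1.
have r0 : 0 < r by rewrite /r ltr_wpDl// mulr_ge0.
have := @lebesgue_rV_box_cone_gt0 R n.
set B := [set x | _] => B0.
have Br : B `<=` C `&` [set x | enorm x < r].
  move=> x Bx; split; first exact: sC.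
  rewrite /= (le_lt_trans (enorm_le_sum x))// /r.
  apply: (@le_lt_trans _ _ (\sum_(i < n.+1) (2 : R))).
    apply: ler_sum => i _; have [/andP[x1 x2] xi] := Bx.
    case: (unliftP ord0 i) => [j ->|->]; last by rewrite ler_norml; lra.
    by have /andP[? ?] := xi j; rewrite ler_norml; lra.
  by rewrite sumr_const card_ord -(mulr_natr (2 : R)) ltrDl.
have mCr : measurable (C `&` [set x | enorm x < r]).
  by apply: measurableI => //; exact: measurable_enorm_lt.
have mB : measurable B.
  have -> : B = [set x | `]1, 2]%classic (x ord0 ord0 : measurableTypeR R)] `&`
    [set x | forall i, `]0, 1]%classic (x ord0 (lift ord0 i) : measurableTypeR R)].
    by apply/seteqP; split => x /= [H1 H2]; (split;
      [move: H1; rewrite in_itv|move=> i; move: (H2 i); rewrite in_itv]).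
  apply: measurableI.
    by rewrite -[X in measurable X]setTI; apply: measurable_coord => //; exact: measurable_itv.
  apply: measurable_forall => i.
  by rewrite -[X in measurable X]setTI; apply: measurable_coord => //; exact: measurable_itv.
have : (0 < mu (C `&` [set x | (enorm x < r)%R]))%E.
  by apply: lt_le_trans B0 _; apply: le_measure; rewrite ?inE.
rewrite cone_ballE// cone_massE// -EFinM lte_fin pmulr_rgt0//.
exact: exprn_gt0.
Qed.

Lemma cone_massT_gt0 : 0 < cone_mass setT.
Proof. exact: cone_mass_gt0. Qed.

Definition cone_ratio C := cone_mass C / cone_mass setT.

Lemma cone_ratio_ge0 C : 0 <= cone_ratio C.
Proof. by rewrite divr_ge0 ?cone_mass_ge0. Qed.

(** This replaces polar coordinates. Both sides are measures in [J]; they agree on half-lines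
    because a cone meets the ball of radius [r] in measure [r^d] times its share of the unit ball,
    and finite values on these half-lines give uniqueness. *)
Lemma cone_measureE C (J : set (measurableTypeR R)) :
    measurable C -> is_cone C -> measurable J ->
  (mu (C `&` [set x | J (enorm x)]) = (cone_ratio C)%:E * mu [set x | J (enorm x)])%E.
Proof.
move=> mC coneC mJ.
have me : measurable_fun setT (@enorm R n.+1 : _ -> measurableTypeR R).
  exact: measurable_enorm.
pose p1 : {measure set (measurableTypeR R) -> \bar R} :=
  pushforward (mrestr mu mC) (@enorm R n.+1 : _ -> measurableTypeR R).
pose p2 : {measure set (measurableTypeR R) -> \bar R} :=
  pushforward mu (@enorm R n.+1 : _ -> measurableTypeR R).
pose p3 := mscale (NngNum (cone_ratio_ge0 C)) (p2 me).
have -> : mu (C `&` [set x | J (enorm x)]) = p1 me J.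
  by rewrite /p1/= /pushforward /mrestr/= setIC.
change (p1 me J = p3 J).
have finB D (r : R) : measurable D -> (mu (D `&` [set x | (enorm x < r)%R]) < +oo)%E.
  move=> mD; apply: le_lt_trans (lebesgue_rV_ball_fin n.+1 r).
  apply: le_measure; rewrite ?inE//; last exact: measurable_enorm_lt.
  by apply: measurableI => //; exact: measurable_enorm_lt.
have p1E (r : R) : p1 me `]-oo, r[%classic = mu (C `&` [set x | (enorm x < r)%R]).
  rewrite /p1/= /pushforward /mrestr; congr (mu _).
  by apply/seteqP; split => x /=; rewrite in_itv/= => -[].
apply: (@measure_unique _ R (measurableTypeR R) (@RGenInftyO.G R)
  (fun k : nat => `]-oo, k%:R[%classic) _ _ _ _ (p1 me) p3) => //.
- exact: RGenInftyO.measurableE.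
- move=> _ _ [x ->] [y ->]; exists (Num.min x y).
  apply/seteqP; split => z /=; rewrite !in_itv/= lt_min; first by move=> [-> ->].
  by move=> /andP[-> ->].
- by move=> k; exists k%:R.
- apply/seteqP; split => // x _; exists (Num.truncn x).+1 => //=.
  by rewrite in_itv/= truncnS_gt.
- move=> _ [r ->]; rewrite p1E /p3/= /mscale/= /pushforward.
  have -> : [set x | enorm x < r]%R = setT `&` [set x : 'rV[R]_n.+1 | enorm x < r]%R.
    by rewrite setTI.
  have -> : @enorm R n.+1 @^-1` `]-oo, r[ = setT `&` [set x : 'rV[R]_n.+1 | enorm x < r]%R.
    by rewrite setTI; apply/seteqP; split => x /=; rewrite in_itv.
  rewrite setTI; case: (ltP 0 r) => r0; last first.
    rewrite (_ : [set x | enorm x < r] = set0) ?setI0 ?measure0 ?mule0//.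
    by apply/seteqP; split => x //=; rewrite ltNge (le_trans r0) ?enorm_ge0.
  have coneT : is_cone [set: 'rV[R]_n.+1] by [].
  have -> : mu [set x | enorm x < r]%R = ((r ^+ n.+1)%:E * (cone_mass setT)%:E)%E.
    by rewrite -[X in mu X]setTI (cone_ballE _ coneT r0)// cone_massE.
  rewrite (cone_ballE mC coneC r0) cone_massE//.
  rewrite -!EFinM; congr EFin; rewrite /cone_ratio mulrCA divfK//.
  by rewrite gt_eqF// cone_massT_gt0.
- by move=> k; rewrite p1E; exact: finB.
Qed.

Lemma cone_integralE C (F : R -> \bar R) : measurable C -> is_cone C ->
    measurable_fun setT F -> (forall r, (0 <= F r)%E) ->
  (\int[mu]_(x in C) F (enorm x) = (cone_ratio C)%:E * \int[mu]_x F (enorm x))%E.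
Proof.
move=> mC coneC mF F0.
have me : measurable_fun setT (@enorm R n.+1 : _ -> measurableTypeR R).
  exact: measurable_enorm.
have mFe : measurable_fun setT (fun x : 'rV[R]_n.+1 => F (enorm x)).
  exact: (measurableT_comp mF me).
pose p1 : {measure set (measurableTypeR R) -> \bar R} :=
  pushforward (mrestr mu mC) (@enorm R n.+1 : _ -> measurableTypeR R).
pose p2 : {measure set (measurableTypeR R) -> \bar R} :=
  pushforward mu (@enorm R n.+1 : _ -> measurableTypeR R).
pose p3 := mscale (NngNum (cone_ratio_ge0 C)) (p2 me).
rewrite -ge0_integral_mrestr//.
transitivity (\int[p1 me]_r F r)%E.
  by rewrite /p1 ge0_integral_pushforward.
transitivity (\int[p3]_r F r)%E.
  apply: eq_measure_integral => A mA _.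
  rewrite /p1 /p3/= /mscale/= /pushforward /mrestr/= setIC.
  exact: cone_measureE.
by rewrite /p3 ge0_integral_mscale// /p2 ge0_integral_pushforward.
Qed.

End radial_integration.

Lemma measurable_truncn_fiber d (T : measurableType d) (R : realType) (h : T -> R) k :
  measurable_fun setT h -> measurable [set y | Num.truncn (h y) = k].
Proof.
move=> mh.
have mle i : measurable [set y | (Num.truncn (h y) <= i)%N].
  rewrite (_ : [set y | _] = h @^-1` `]-oo, i.+1%:R[%classic).
    by rewrite -[X in measurable X]setTI; apply: mh => //; exact: measurable_itv.
  by apply/seteqP; split => y /=; rewrite in_itv/= truncn_le_nat.
case: k => [|k].
  rewrite (_ : [set y | _] = [set y | (Num.truncn (h y) <= 0)%N])//.
  by apply/seteqP; split => y /=; rewrite leqn0 => /eqP.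
rewrite (_ : [set y | _] = [set y | (Num.truncn (h y) <= k.+1)%N] `\`
  [set y | (Num.truncn (h y) <= k)%N]); first exact: measurableD.
apply/seteqP; split => y /=; first by move=> ->; rewrite ltnn.
by move=> [yk /negP]; rewrite -ltnNge => ky; apply/eqP; rewrite eqn_leq yk ky.
Qed.

(** The integer part of [x] is half that of [2 x], rounded down. This makes the radial cells
    nested. *)
Lemma truncn_double (R : realType) (x y : R) : 0 <= x -> 0 <= y ->
  Num.truncn (2 * x) = Num.truncn (2 * y) -> Num.truncn x = Num.truncn y.
Proof.
have half (z : R) : 0 <= z -> Num.truncn z = (Num.truncn (2 * z))./2.
  move=> z0; apply: truncn_def.
  have z20 : 0 <= 2 * z by rewrite mulr_ge0.
  have /andP[h1 h2] := truncn_itv z20.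
  have kE : (Num.truncn (2 * z))%:R =
      (odd (Num.truncn (2 * z)))%:R + 2 * ((Num.truncn (2 * z))./2)%:R :> R.
    move: (Num.truncn _) => K; have /(congr1 (fun i => i%:R : R)) := odd_double_half K.
    by rewrite natrD -muln2 natrM mulrC => ->.
  have h1' : (Num.truncn (2 * z))%:R <= 2 * z :> R by exact: h1.
  have h2' : 2 * z < (Num.truncn (2 * z))%:R + 1 :> R by rewrite natr1; exact: h2.
  rewrite kE in h1' h2'; move: h1' h2' {h1 h2 kE}.
  move: (odd _) (_./2) => o m h1 h2.
  have o1 : (o%:R : R) <= 1 by case: o {h1 h2}.
  have o0 : 0 <= (o%:R : R) by [].
  rewrite -natr1; apply/andP; split; lra.
by move=> x0 y0 xy; rewrite half// xy -half.
Qed.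

(** * Shells and their cells of equal volume *)

Section shells.
Context {R : realType} (n : nat).
Local Notation mu := (lebesgue_rV R n.+1).
Local Notation c0 := (@cone_mass R n setT).

Definition shell (r r' : R) : set 'rV[R]_n.+1 := [set x | r <= enorm x < r'].

Lemma measurable_shell r r' : measurable (shell r r').
Proof.
have := @measurable_enorm_preimage R n.+1 `[r, r'[%classic (measurable_itv _).
by congr measurable; apply/seteqP; split => x /=; rewrite in_itv.
Qed.

(** In the variable [|x|^d] the measure is [c0] times length, so equal steps of this variable cut
    out equal volumes. *)
Lemma lebesgue_rV_shell_pow (lo hi : R) : 0 < lo -> lo <= hi ->
  mu [set x | lo <= enorm x ^+ n.+1 < hi] = (c0 * (hi - lo))%:E.
Proof.
move=> lo0 lohi.
have ballE h : 0 < h ->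
    [set x : 'rV[R]_n.+1 | enorm x ^+ n.+1 < h] = [set x | enorm x < h `^ n.+1%:R^-1].
  move=> h0; have hE : (h `^ n.+1%:R^-1) ^+ n.+1 = h.
    by rewrite -powR_mulrn ?powR_ge0// -powRrM mulVf ?pnatr_eq0// powRr1// ltW.
  apply/seteqP; split => x /=.
    by rewrite -{1}hE ltr_pXn2r ?nnegrE ?enorm_ge0 ?powR_ge0.
  by move=> H; rewrite -{1}hE ltr_pXn2r ?nnegrE ?enorm_ge0 ?powR_ge0.
have ball_mu h : 0 < h -> mu [set x | enorm x ^+ n.+1 < h] = (c0 * h)%:E.
  move=> h0; rewrite ballE// -[X in mu X]setTI cone_ballE//; last exact: powR_gt0.
  rewrite cone_massE// -EFinM mulrC; congr (_ * _)%:E.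
  by rewrite -powR_mulrn ?powR_ge0// -powRrM mulVf ?pnatr_eq0// powRr1// ltW.
have mB h : 0 < h -> measurable [set x : 'rV[R]_n.+1 | enorm x ^+ n.+1 < h].
  by move=> h0; rewrite ballE//; exact: measurable_enorm_lt.
have hi0 : 0 < hi by exact: lt_le_trans lohi.
have -> : [set x : 'rV[R]_n.+1 | lo <= enorm x ^+ n.+1 < hi] =
   [set x | enorm x ^+ n.+1 < hi] `\` [set x | enorm x ^+ n.+1 < lo].
  by apply/seteqP; split => x /=; [move=> /andP[h1 ->]; rewrite ltNge h1|
    move=> [-> /negP]; rewrite -leNgt => ->].
rewrite measureD; [|exact: mB|exact: mB|by rewrite [X in (X < _)%E](ball_mu _ hi0) ltey].
have -> : [set x : 'rV[R]_n.+1 | enorm x ^+ n.+1 < hi] `&` [set x | enorm x ^+ n.+1 < lo]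
    = [set x | enorm x ^+ n.+1 < lo].
  by rewrite setIC setIidl// => x /= h; exact: lt_le_trans lohi.
rewrite [X in (X - _)%E](ball_mu _ hi0) [X in (_ - X)%E](ball_mu _ lo0).
by rewrite -EFinB -mulrBr.
Qed.

Lemma lebesgue_rV_shell r r' : 0 < r -> r <= r' ->
  mu (shell r r') = (c0 * (r' ^+ n.+1 - r ^+ n.+1))%:E.
Proof.
move=> r0 rr'; have r0' : 0 < r' by exact: lt_le_trans r0 rr'.
rewrite -lebesgue_rV_shell_pow ?exprn_gt0//; last first.
  by rewrite lerXn2r ?nnegrE// ltW.
congr (mu _); apply/seteqP; split => x /=; rewrite /shell/=.
all: by rewrite ltr_pXn2r ?ler_pXn2r ?nnegrE ?enorm_ge0 ?(ltW r0) ?(ltW r0').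
Qed.

Section shell_partition.
Variables (r0 Lam : R).
Hypotheses (r00 : 0 < r0) (Lam1 : 1 < Lam).

Let V := Lam ^+ n.+1 - 1.
Let E := shell r0 (Lam * r0).

Definition shell_mass := c0 * V * r0 ^+ n.+1.

(** [((r / r0)^d - 1) / V] is the fraction of the volume of the shell that lies inside radius [r].
    It runs through [[0, 1[], and the index is its dyadic interval of length [2^-j]. *)
Definition shell_idx j (r : R) :=
  Num.truncn (2 ^+ j * (((r / r0) ^+ n.+1 - 1) / V)).

Let V0 : 0 < V. Proof. by rewrite subr_gt0 exprn_egt1. Qed.

Lemma shell_mass_gt0 : 0 < shell_mass.
Proof. by rewrite !mulr_gt0 ?cone_massT_gt0 ?exprn_gt0. Qed.

Lemma measurable_shell_idx j k : measurable [set r : R | shell_idx j r = k].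
Proof.
apply: measurable_truncn_fiber.
apply: measurable_funM; first exact: measurable_cst.
apply: measurable_funM; last exact: measurable_cst.
apply: measurable_funB; last exact: measurable_cst.
by apply: measurable_funX; apply: measurable_funM => //; exact: measurable_cst.
Qed.

Lemma shell_coord_itv x : E x -> 0 <= ((enorm x / r0) ^+ n.+1 - 1) / V < 1.
Proof.
move=> /andP[h1 h2]; apply/andP; split.
  by rewrite divr_ge0 ?(ltW V0)// subr_ge0 exprn_ege1// ler_pdivlMr// mul1r.
rewrite ltr_pdivrMr// mul1r ltrD2r ltr_pXn2r// ?nnegrE ?divr_ge0 ?enorm_ge0 ?(ltW r00)//.
  by rewrite ltr_pdivrMr.
by rewrite ltW// (lt_trans _ Lam1).
Qed.

Lemma shell_partition :
  dyadic_partition mu E shell_mass (fun j x => shell_idx j (enorm x)).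
Proof.
split.
- split; [exact: measurable_shell| |exact: shell_mass_gt0].
  have -> : shell_mass = c0 * ((Lam * r0) ^+ n.+1 - r0 ^+ n.+1).
    by rewrite exprMn /shell_mass /V; ring.
  by apply: lebesgue_rV_shell => //; rewrite ler_peMl ?ltW.
- move=> j k; have := @measurable_enorm_preimage R n.+1 _ (measurable_shell_idx j k).
  by [].
- move=> j x Ex.
  set k := shell_idx j (enorm x).
  have /andP[t0 t1] := shell_coord_itv Ex.
  have P0 : 0 < (2 : R) ^+ j by rewrite exprn_gt0.
  (* [lo] and [hi] are the values of [|y|^d] at volume fractions [k / 2^j] and [(k + 1) / 2^j]. *)
  pose lo := r0 ^+ n.+1 * (1 + V * (k%:R / 2 ^+ j)).
  pose hi := r0 ^+ n.+1 * (1 + V * (k.+1%:R / 2 ^+ j)).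
  have lo1 : r0 ^+ n.+1 <= lo.
    by rewrite /lo ler_peMr ?exprn_ge0 ?(ltW r00)// lerDl !mulr_ge0 ?(ltW V0)// invr_ge0 ltW.
  have k2 : k.+1%:R <= (2 : R) ^+ j.
    rewrite -natrX ler_nat /k /shell_idx truncn_lt_nat; last by rewrite mulr_ge0// ltW.
    by rewrite natrX gtr_pMr.
  have hi1 : hi <= (Lam * r0) ^+ n.+1.
    rewrite exprMn mulrC /hi ler_pM2l ?exprn_gt0//.
    have -> : Lam ^+ n.+1 = 1 + V * 1 by rewrite /V; ring.
    by rewrite lerD2l ler_pM2l// ler_pdivrMr// mul1r.
  have -> : dyadic_cell E (fun j x => shell_idx j (enorm x)) j x =
      [set y | lo <= enorm y ^+ n.+1 < hi].
    have eqv y : r0 <= enorm y -> (shell_idx j (enorm y) = k) <->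
        lo <= enorm y ^+ n.+1 < hi.
      move=> ry; set t := ((enorm y / r0) ^+ n.+1 - 1) / V.
      have t0' : 0 <= t.
        by rewrite divr_ge0 ?(ltW V0)// subr_ge0 exprn_ege1// ler_pdivlMr// mul1r.
      have yE : enorm y ^+ n.+1 = r0 ^+ n.+1 * (1 + V * t).
        rewrite /t [V * _]mulrC divfK ?gt_eqF// addrC subrK expr_div_n.
        by rewrite mulrC divfK// gt_eqF// exprn_gt0.
      rewrite yE /lo /hi ler_pM2l ?exprn_gt0// ltr_pM2l ?exprn_gt0// lerD2l ltrD2l.
      rewrite ler_pM2l// ltr_pM2l// ler_pdivrMr// ltr_pdivlMr//.
      rewrite ![t * _]mulrC -truncn_eq; last by rewrite mulr_ge0// ltW.
      by rewrite {1}/shell_idx -/t; split => /eqP.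
    apply/seteqP; split => y /=.
      by move=> [/andP[h1 h2] /= /eqv]; apply.
    move=> /[dup] /andP[h1 h2] h.
    have ry : r0 <= enorm y.
      rewrite -(@ler_pXn2r _ n.+1) ?nnegrE ?enorm_ge0 ?(ltW r00)//.
      exact: le_trans lo1 h1.
    split; last exact/eqv.
    apply/andP; split=> //.
    rewrite -(@ltr_pXn2r _ n.+1) ?nnegrE ?enorm_ge0 ?mulr_ge0 ?(ltW r00)//.
      exact: lt_le_trans h2 hi1.
    by rewrite ltW// (lt_trans _ Lam1).
  transitivity ((c0 * (hi - lo))%:E).
    apply: lebesgue_rV_shell_pow; first by apply: lt_le_trans lo1; rewrite exprn_gt0.
    by rewrite /lo /hi ler_pM2l ?exprn_gt0// lerD2l ler_pM2l// ler_pM2r ?invr_gt0// ler_nat.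
  congr EFin; rewrite /shell_mass /lo /hi expRN mulrC -/(ln 2) expRM_natr lnK ?posrE//.
  by rewrite -natr1; field; rewrite gt_eqF.
- move=> x y Ex Ey; rewrite /shell_idx !expr0 !mul1r.
  have tr z : E z -> Num.truncn (((enorm z / r0) ^+ n.+1 - 1) / V) = 0%N.
    by move=> Ez; apply: truncn_def; exact: shell_coord_itv.
  by rewrite !tr.
- move=> j x y Ex Ey; rewrite /shell_idx !(exprS 2 j) -!(mulrA 2); apply: truncn_double.
    by have /andP[h _] := shell_coord_itv Ex; apply: mulr_ge0 => //; exact: exprn_ge0.
  by have /andP[h _] := shell_coord_itv Ey; apply: mulr_ge0 => //; exact: exprn_ge0.
Qed.

End shell_partition.
End shells.

Arguments shell {R} n r r'.
Arguments shell_mass {R} n r0 Lam.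
Arguments shell_idx {R} n r0 Lam j r.

(** * From the seminorm to radial oscillations *)

(** Turns closeness of the volume coordinates [(|x| / r0)^d] into closeness of the radii. *)
Lemma ler_norm_subX (R : realDomainType) (A B : R) k : 1 <= A -> 1 <= B ->
  `|A - B| <= `|A ^+ k.+1 - B ^+ k.+1|.
Proof.
wlog AB : A B / B <= A => [H A1 B1|A1 B1].
  have [BA|/ltW AB] := leP B A; first exact: H.
  by rewrite distrC [leRHS]distrC; exact: H.
have ABk i : A - B <= A ^+ i.+1 - B ^+ i.+1.
  elim: i => [|i IH]; first by rewrite !expr1.
  have -> : A ^+ i.+2 - B ^+ i.+2 = A * (A ^+ i.+1 - B ^+ i.+1) + B ^+ i.+1 * (A - B).
    by rewrite !(exprS _ i.+1); ring.
  have := exprn_ege1 i.+1 B1; nra.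
have k0 := ABk k; rewrite !ger0_norm ?subr_ge0//.
by rewrite lerXn2r ?nnegrE//; lra.
Qed.

(** The sum is at most a constant times its last nonzero term, since read backwards it is geometric.
    With [Y] of order [1 / |x - y|] it turns a sum over scales into the kernel [|x - y|^-e]. *)
Lemma dyadic_sum_le (R : realType) (e : R) : 0 < e -> exists2 K : R, 0 < K &
  forall (Y : R) J, 0 < Y ->
    \sum_(j < J) expR (e * ln 2 * j%:R) * ((2 ^+ j : R) <= Y)%R%:R <= K * Y `^ e.
Proof.
move=> e0; have L0 : 0 < ln (2 : R) by rewrite ln_gt0// ltr1n.
have eL : 0 < e * ln (2 : R) by exact: mulr_gt0.
exists ((1 - expR (- (e * ln 2)))^-1).
  by rewrite invr_gt0 subr_gt0 expR_lt1 oppr_lt0.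
move=> Y J Y0; have K0 : 0 <= (1 - expR (- (e * ln (2 : R))))^-1.
  by rewrite invr_ge0 subr_ge0 expR_le1 oppr_le0 ltW.
elim: J => [|J IH]; first by rewrite big_ord0 mulr_ge0 ?powR_ge0.
have [JY|JY] := leP (2 ^+ J) Y; last first.
  by rewrite big_ord_recr/= (lt_geF JY) mulr0 addr0.
apply: (@le_trans _ _ (\sum_(j < J.+1) expR (e * ln 2 * j%:R))).
  by apply: ler_sum => j _; rewrite ler_piMr ?expR_ge0// lern1 leq_b1.
apply: (@le_trans _ _ (expR (e * ln 2 * J%:R) * \sum_(j < J.+1) expR (- (e * ln 2 * j%:R)))).
  rewrite mulr_sumr (reindex_inj rev_ord_inj)/=; apply: ler_sum => j _.
  have jJ : (j <= J)%N by rewrite -ltnS.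
  by rewrite -expRD ler_expR subSS natrB// mulrBr.
have JYe : expR (e * ln 2 * J%:R) <= Y `^ e.
  have -> : expR (e * ln 2 * J%:R) = (2 ^+ J) `^ e.
    by rewrite -powR_mulrn// -powRrM /powR pnatr_eq0/=; congr expR; ring.
  by apply: ge0_ler_powR; rewrite ?nnegrE ?exprn_ge0// ltW.
rewrite mulrC; apply: ler_pM => //.
- by apply: sumr_ge0 => j _; exact: expR_ge0.
- exact: geometric_expR_sum_le.
Qed.

Lemma nneseries_le (R : realType) (u : (\bar R)^nat) (B : \bar R) :
  (forall j, 0 <= u j)%E -> (forall J, \sum_(j < J) u j <= B)%E ->
  (\sum_(j <oo) u j <= B)%E.
Proof.
move=> u0 uB; apply: lime_le; first exact: is_cvg_nneseries.
by apply: nearW => J; rewrite big_mkord.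
Qed.

Lemma measurable_set_lt d (T : measurableType d) (R : realType) (f g : T -> R) :
  measurable_fun setT f -> measurable_fun setT g -> measurable [set x | f x < g x].
Proof.
move=> mf mg; have := measurable_fun_ltr mf mg measurableT (Y := [set true]) I.
by rewrite setTI; congr measurable; apply/seteqP; split.
Qed.

Lemma measurable_set_le d (T : measurableType d) (R : realType) (f g : T -> R) :
  measurable_fun setT f -> measurable_fun setT g -> measurable [set x | f x <= g x].
Proof.
move=> mf mg; have := measurable_fun_ler mf mg measurableT (Y := [set true]) I.
by rewrite setTI; congr measurable; apply/seteqP; split.
Qed.

Section cone_cells.
Context {R : realType} (n : nat).
Implicit Types x y : 'rV[R]_n.+1.

Definition pos_cone : set 'rV[R]_n.+1 :=
  [set x | 0 < x ord0 ord0 /\ forall i, 0 <= x ord0 (lift ord0 i) < x ord0 ord0].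

(* The part of [pos_cone] on which the projective coordinate [x_i / x_0] lies
   in the interval [W i / m.+1, (W i + 1) / m.+1[. *)
Definition cone_cell m (W : {ffun 'I_n -> 'I_m.+1}) : set 'rV[R]_n.+1 :=
  [set x | 0 < x ord0 ord0 /\ forall i,
    (W i)%:R * x ord0 ord0 <= m.+1%:R * x ord0 (lift ord0 i) < (W i).+1%:R * x ord0 ord0].

Lemma cone_pos_cone : is_cone pos_cone.
Proof.
move=> c x c0 [x0 xi]; split => [|i]; rewrite !mxE ?mulr_gt0//.
by have /andP[h1 h2] := xi i; rewrite mulr_ge0 ?(ltW c0)// ltr_pM2l.
Qed.

Lemma cone_cone_cell m W : is_cone (@cone_cell m W).
Proof.
move=> c x c0 [x0 xi]; split => [|i]; rewrite !mxE ?mulr_gt0//.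
by rewrite ![_ * (c * _)]mulrCA ler_pM2l// ltr_pM2l.
Qed.

Let mx i : measurable_fun setT (fun x : 'rV[R]_n.+1 => x ord0 i).
Proof. exact: measurable_coord. Qed.

Let mcx (c : R) i : measurable_fun setT (fun x : 'rV[R]_n.+1 => c * x ord0 i).
Proof. by apply: measurable_funM; [exact: measurable_cst|exact: mx]. Qed.

Lemma measurable_pos_cone : measurable pos_cone.
Proof.
apply: measurableI; first by apply: measurable_set_lt; [exact: measurable_cst|exact: mx].
apply: measurable_forall => i.
set A := (X in measurable X).
have -> : A = [set x | 0 <= x ord0 (lift ord0 i)] `&` [set x | x ord0 (lift ord0 i) < x ord0 ord0].
  by apply/seteqP; split => x /=; [move=> /andP|move=> [h1 h2]; apply/andP].
apply: measurableI; first by apply: measurable_set_le; [exact: measurable_cst|exact: mx].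
by apply: measurable_set_lt; exact: mx.
Qed.

Lemma measurable_cone_cell m W : measurable (@cone_cell m W).
Proof.
apply: measurableI; first by apply: measurable_set_lt; [exact: measurable_cst|exact: mx].
apply: measurable_forall => i.
set A := (X in measurable X).
have -> : A = [set x | (W i)%:R * x ord0 ord0 <= m.+1%:R * x ord0 (lift ord0 i)] `&`
   [set x | m.+1%:R * x ord0 (lift ord0 i) < (W i).+1%:R * x ord0 ord0].
  by apply/seteqP; split => x /=; [move=> /andP|move=> [h1 h2]; apply/andP].
by apply: measurableI; [apply: measurable_set_le|apply: measurable_set_lt]; exact: mcx.
Qed.

Lemma pos_cone_cover m x : pos_cone x -> exists W, @cone_cell m W x.
Proof.
move=> [x0 xi].
have t0 i : 0 <= m.+1%:R * (x ord0 (lift ord0 i) / x ord0 ord0).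
  by have /andP[h _] := xi i; rewrite mulr_ge0// divr_ge0// ltW.
have tm i : (Num.truncn (m.+1%:R * (x ord0 (lift ord0 i) / x ord0 ord0)) < m.+1)%N.
  rewrite truncn_lt_nat// gtr_pMr// ltr_pdivrMr// mul1r.
  by have /andP[] := xi i.
exists [ffun i => Ordinal (tm i)]; split => // i; rewrite ffunE/=.
have /andP[h1 h2] := truncn_itv (t0 i); apply/andP; split.
  by rewrite -ler_pdivlMr// -mulrA.
by rewrite -ltr_pdivrMr// -mulrA.
Qed.

Lemma cone_cell_uniq m W W' x : @cone_cell m W x -> @cone_cell m W' x -> W = W'.
Proof.
move=> [x0 xi] [_ xi']; apply/ffunP => i; apply/val_inj.
have tr (V : {ffun 'I_n -> 'I_m.+1}) :
    ((V i)%:R * x ord0 ord0 <= m.+1%:R * x ord0 (lift ord0 i) < (V i).+1%:R * x ord0 ord0) ->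
    Num.truncn (m.+1%:R * x ord0 (lift ord0 i) / x ord0 ord0) = V i.
  by move=> /andP[h1 h2]; apply: truncn_def; rewrite ler_pdivlMr// h1/= ltr_pdivrMr.
by rewrite /= -(tr W (xi i)) -(tr W' (xi' i)).
Qed.

(** The common index bounds the difference of the radii by [r0 V 2^-j], and the common cell bounds
    each difference of ratios [x_i / x_0] by [2^-j]. The coordinate [x_0] is recovered from
    [|x|^2 = x_0^2 P], where [P] is 1 plus the sum of the squared ratios. *)
Lemma cone_cell_dist (r0 Lam : R) j m W x y :
    0 < r0 -> 1 < Lam -> (m.+1 = 2 ^ j)%N ->
    shell n r0 (Lam * r0) x -> shell n r0 (Lam * r0) y ->
    @cone_cell m W x -> @cone_cell m W y ->
    shell_idx n r0 Lam j (enorm x) = shell_idx n r0 Lam j (enorm y) ->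
  enorm (x - y) <= n.+1%:R * (n.+1%:R * (Lam ^+ n.+1 - 1) + 2 * n%:R * Lam + Lam)
    * r0 / 2 ^+ j.
Proof.
move=> r00 Lam1 mj Ex Ey [x00 xi] [y00 yi] xy.
set V := Lam ^+ n.+1 - 1.
have V0 : 0 < V by rewrite subr_gt0 exprn_egt1.
have N0 : 0 < (2 : R) ^+ j by rewrite exprn_gt0.
have mN : m.+1%:R = (2 : R) ^+ j by rewrite mj natrX.
set e := (2 ^+ j)^-1 : R.
have e0 : 0 < e by rewrite invr_gt0.
move: (Ex) (Ey) => /andP[ax ax'] /andP[by_ by_'].
set a := enorm x in xy ax ax' *; set b := enorm y in xy by_ by_' *.
have ab : `|a - b| <= r0 * V * e.
  have A1 : 1 <= a / r0 by rewrite ler_pdivlMr// mul1r.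
  have B1 : 1 <= b / r0 by rewrite ler_pdivlMr// mul1r.
  have -> : a - b = r0 * (a / r0 - b / r0) by field; rewrite gt_eqF.
  rewrite normrM gtr0_norm// -mulrA ler_pM2l//.
  apply: le_trans (ler_norm_subX n A1 B1) _.
  have /andP[tx _] := shell_coord_itv r00 Lam1 Ex.
  have /andP[ty _] := shell_coord_itv r00 Lam1 Ey.
  have /andP[hx1 hx2] := truncn_itv (mulr_ge0 (ltW N0) tx).
  have /andP[hy1 hy2] := truncn_itv (mulr_ge0 (ltW N0) ty).
  move: hx1 hx2 hy1 hy2 xy; rewrite /shell_idx -/a -/b -/V.
  set k := Num.truncn _; set k' := Num.truncn _ => + + + + kk'.
  rewrite -{}kk' => hx1 hx2 hy1 hy2.
  have -> : (a / r0) ^+ n.+1 - (b / r0) ^+ n.+1 =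
     V * e * (2 ^+ j * (((a / r0) ^+ n.+1 - 1) / V) - 2 ^+ j * (((b / r0) ^+ n.+1 - 1) / V)).
    by rewrite /e; field; rewrite !gt_eqF.
  rewrite normrM [`|V * e|]ger0_norm ?mulr_ge0 ?(ltW V0) ?(ltW e0)//.
  rewrite ler_piMr ?mulr_ge0 ?(ltW V0) ?(ltW e0)//.
  rewrite -natr1 in hx2 hy2; rewrite ler_norml; lra.
have xi01 i : 0 <= x ord0 (lift ord0 i) <= x ord0 ord0.
  have /andP[h1 h2] := xi i; apply/andP; split.
    by rewrite -(@ler_pM2l _ m.+1%:R)// mulr0 (le_trans _ h1)// mulr_ge0// ltW.
  rewrite -(@ler_pM2l _ m.+1%:R)//; apply: (le_trans (ltW h2)).
  by rewrite ler_pM2r// ler_nat.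
have yi01 i : 0 <= y ord0 (lift ord0 i) <= y ord0 ord0.
  have /andP[h1 h2] := yi i; apply/andP; split.
    by rewrite -(@ler_pM2l _ m.+1%:R)// mulr0 (le_trans _ h1)// mulr_ge0// ltW.
  rewrite -(@ler_pM2l _ m.+1%:R)//; apply: (le_trans (ltW h2)).
  by rewrite ler_pM2r// ler_nat.
set x0 := x ord0 ord0 in x00 xi xi01 *; set y0 := y ord0 ord0 in y00 yi yi01 *.
pose X i := x ord0 (lift ord0 i) / x0; pose Y i := y ord0 (lift ord0 i) / y0.
have xE i : x ord0 (lift ord0 i) = x0 * X i by rewrite /X mulrC divfK// gt_eqF.
have yE i : y ord0 (lift ord0 i) = y0 * Y i by rewrite /Y mulrC divfK// gt_eqF.
have X01 i : 0 <= X i <= 1.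
  by have /andP[h1 h2] := xi01 i; rewrite /X divr_ge0 ?(ltW x00)//= ler_pdivrMr// mul1r.
have Y01 i : 0 <= Y i <= 1.
  by have /andP[h1 h2] := yi01 i; rewrite /Y divr_ge0 ?(ltW y00)//= ler_pdivrMr// mul1r.
have XY i : `|X i - Y i| <= e.
  have hX : (W i)%:R <= 2 ^+ j * X i < (W i)%:R + 1.
    have E1 : m.+1%:R * x ord0 (lift ord0 i) = 2 ^+ j * X i * x0.
      by rewrite mN xE; ring.
    by have := xi i; rewrite E1 ler_pM2r// ltr_pM2r// -[(W i).+1%:R]natr1.
  have hY : (W i)%:R <= 2 ^+ j * Y i < (W i)%:R + 1.
    have E1 : m.+1%:R * y ord0 (lift ord0 i) = 2 ^+ j * Y i * y0.
      by rewrite mN yE; ring.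
    by have := yi i; rewrite E1 ler_pM2r// ltr_pM2r// -[(W i).+1%:R]natr1.
  have -> : X i - Y i = e * (2 ^+ j * X i - 2 ^+ j * Y i).
    by rewrite /e; field; rewrite gt_eqF.
  rewrite normrM [`|e|]ger0_norm ?(ltW e0)// ler_piMr ?(ltW e0)// ler_norml.
  by move: hX hY => /andP[? ?] /andP[? ?]; lra.
pose P := 1 + \sum_i X i ^+ 2; pose Q := 1 + \sum_i Y i ^+ 2.
have aE : a ^+ 2 = x0 ^+ 2 * P.
  rewrite sqr_enorm big_ord_recl /P mulrDr mulr1 mulr_sumr; congr (_ + _).
  by apply: eq_bigr => i _; rewrite xE exprMn.
have bE : b ^+ 2 = y0 ^+ 2 * Q.
  rewrite sqr_enorm big_ord_recl /Q mulrDr mulr1 mulr_sumr; congr (_ + _).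
  by apply: eq_bigr => i _; rewrite yE exprMn.
have P1 : 1 <= P by rewrite lerDl sumr_ge0// => i _; exact: sqr_ge0.
have PQ : `|P - Q| <= 2 * n%:R * e.
  have -> : P - Q = \sum_i (X i ^+ 2 - Y i ^+ 2) by rewrite sumrB /P /Q; ring.
  apply: le_trans (ler_norm_sum _ _ _) _.
  apply: (@le_trans _ _ (\sum_(i < n) 2 * e)).
    apply: ler_sum => i _; rewrite subr_sqr normrM mulrC.
    have /andP[? ?] := X01 i; have /andP[? ?] := Y01 i.
    by apply: ler_pM => //; rewrite ger0_norm; lra.
  by rewrite sumr_const card_ord -mulr_natl; apply: ler_of_eq; ring.
have x0a : a <= n.+1%:R * x0.
  apply: le_trans (enorm_le_sum x) _; rewrite big_ord_recl.
  rewrite -natr1 mulrDl mul1r addrC ger0_norm ?(ltW x00)// lerD2r.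
  apply: (@le_trans _ _ (\sum_(i < n) x0)).
    by apply: ler_sum => i _; have /andP[h1 h2] := xi01 i; rewrite ger0_norm.
  by rewrite sumr_const card_ord mulr_natl.
have y0b : b <= n.+1%:R * y0.
  apply: le_trans (enorm_le_sum y) _; rewrite big_ord_recl.
  rewrite -natr1 mulrDl mul1r addrC ger0_norm ?(ltW y00)// lerD2r.
  apply: (@le_trans _ _ (\sum_(i < n) y0)).
    by apply: ler_sum => i _; have /andP[h1 h2] := yi01 i; rewrite ger0_norm.
  by rewrite sumr_const card_ord mulr_natl.
have y0L : y0 <= Lam * r0.
  apply: le_trans (ltW by_'); have := le_coord_enorm y ord0.
  by rewrite ger0_norm ?(ltW y00).
have xy0 : `|x0 - y0| <= (n.+1%:R * V + 2 * n%:R * Lam) * r0 * e.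
  have s0 : 0 < x0 + y0 by rewrite addr_gt0.
  rewrite -(@ler_pM2r _ (x0 + y0))// -{1}(ger0_norm (ltW s0)) -normrM -subr_sqr.
  have D0 : `|x0 ^+ 2 - y0 ^+ 2| <= `|P * (x0 ^+ 2 - y0 ^+ 2)|.
    by rewrite normrM ler_peMl// ger0_norm//; lra.
  apply: (le_trans D0).
  (* The factor [P >= 1] was inserted to make [a^2 - b^2] appear. Both resulting terms carry a
     factor [x0 + y0], because the first coordinate dominates the others on the cone and so
     [a + b <= d (x0 + y0)]. *)
  have -> : P * (x0 ^+ 2 - y0 ^+ 2) = (a - b) * (a + b) - y0 ^+ 2 * (P - Q).
    by rewrite -subr_sqr aE bE; ring.
  apply: le_trans (ler_normB _ _) _; rewrite (normrM (a - b)) (normrM (y0 ^+ 2)).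
  rewrite [`|y0 ^+ 2|]ger0_norm ?sqr_ge0//.
  have ab0 : 0 <= a + b by rewrite addr_ge0 ?enorm_ge0.
  rewrite [`|a + b|]ger0_norm//.
  have H1 : `|a - b| * (a + b) <= (r0 * V * e) * (n.+1%:R * (x0 + y0)).
    by apply: ler_pM => //; lra.
  have H2 : y0 ^+ 2 * `|P - Q| <= (Lam * r0 * (x0 + y0)) * (2 * n%:R * e).
    by apply: ler_pM => //; rewrite ?sqr_ge0// expr2; apply: ler_pM; rewrite ?(ltW y00)//; lra.
  apply: le_trans (lerD H1 H2) _; apply: ler_of_eq; ring.
apply: le_trans (enorm_le_sum _) _.
rewrite -[X in _ <= _ * X * _ / _]/(n.+1%:R * V + 2 * n%:R * Lam + Lam).
set B := n.+1%:R * V + 2 * n%:R * Lam in xy0 *.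
have B0 : 0 <= B by rewrite addr_ge0 ?mulr_ge0 ?(ltW V0)//; lra.
have e00 := ltW e0; have r000 := ltW r00.
apply: (@le_trans _ _ (\sum_(i < n.+1) (B + Lam) * r0 * e)); last first.
  by rewrite sumr_const card_ord -mulr_natl /e; apply: ler_of_eq; ring.
apply: ler_sum => i _; rewrite !mxE.
have Lre : 0 <= Lam * r0 * e by rewrite !mulr_ge0//; lra.
case: (unliftP ord0 i) => [k ->|->]; last by rewrite -/x0 -/y0; lra.
rewrite xE yE.
have -> : x0 * X k - y0 * Y k = (x0 - y0) * X k + y0 * (X k - Y k) by ring.
apply: le_trans (ler_normD _ _) _.
rewrite (normrM (x0 - y0)) (normrM y0).
have /andP[Xk0 Xk1] := X01 k.
have H1 : `|x0 - y0| * `|X k| <= B * r0 * e.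
  by apply: le_trans xy0; rewrite ler_piMr// ger0_norm.
have H2 : `|y0| * `|X k - Y k| <= Lam * r0 * e.
  by apply: ler_pM => //; rewrite ger0_norm// ltW.
apply: le_trans (lerD H1 H2) _; apply: ler_of_eq; ring.
Qed.

End cone_cells.

(** * Restricting a radial double integral to pairs in a common angular cell *)

Lemma measure_bigsetU_le d (T : measurableType d) (R : realType)
    (mu : {measure set T -> \bar R}) (I : Type) (s : seq I) (F : I -> set T) :
  (forall i, measurable (F i)) ->
  (mu (\big[setU/set0]_(i <- s) F i) <= \sum_(i <- s) mu (F i))%E.
Proof.
move=> mF; elim: s => [|i s IH]; first by rewrite !big_nil measure0.
rewrite !big_cons; have mU : measurable (\big[setU/set0]_(j <- s) F j).
  exact: bigsetU_measurable.
by apply: le_trans; [exact: measureU2|exact: leeD2l].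
Qed.

Section cone_decoupling.
Context {R : realType} (n : nat).
Local Notation mu := (lebesgue_rV R n.+1).

Let kappa := cone_ratio (@pos_cone R n).

Lemma cone_ratio_pos_cone_gt0 : 0 < kappa.
Proof.
rewrite divr_gt0 ?cone_massT_gt0//; apply: cone_mass_gt0.
- exact: measurable_pos_cone.
- exact: cone_pos_cone.
- move=> x /= [/andP[h1 h2] xi]; split => [|i]; first by lra.
  by have /andP[h3 h4] := xi i; apply/andP; split; lra.
Qed.

Lemma cone_ratio_le_sum m :
  kappa <= \sum_(W : {ffun 'I_n -> 'I_m.+1}) cone_ratio (cone_cell W).
Proof.
rewrite /kappa /cone_ratio -mulr_suml ler_pM2r ?invr_gt0 ?cone_massT_gt0//.
have mB : measurable [set x : 'rV[R]_n.+1 | enorm x < 1] by exact: measurable_enorm_lt.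
rewrite -lee_fin -cone_massE; last exact: measurable_pos_cone.
rewrite -sumEFin.
under eq_bigr => W _ do rewrite -(cone_massE (measurable_cone_cell W)).
set A := _ `&` _.
apply: (@le_trans _ _ (mu (\big[setU/set0]_(W : {ffun 'I_n -> 'I_m.+1})
    (cone_cell W `&` [set x | (enorm x < 1)%R])))).
  apply: le_measure; rewrite ?inE.
  - by apply: measurableI => //; exact: measurable_pos_cone.
  - apply: bigsetU_measurable => W _; apply: measurableI => //.
    exact: measurable_cone_cell.
  - move=> x [xp xB]; have [W xW] := pos_cone_cover m xp.
    by rewrite -bigcup_seq/=; exists W => //=; rewrite mem_index_enum.
apply: measure_bigsetU_le => W; apply: measurableI => //.
exact: measurable_cone_cell.
Qed.

(** Cauchy-Schwarz for ratios whose sum is at least [kappa], obtained by expanding the squared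
    deviations from [kappa / N]. Cells of unequal solid angle are thereby allowed. *)
Lemma sum_cone_ratio_sq m : kappa ^+ 2 / (m.+1 ^ n)%:R <=
  \sum_(W : {ffun 'I_n -> 'I_m.+1}) cone_ratio (cone_cell W) ^+ 2.
Proof.
set S := (X in _ <= X); pose N : R := (m.+1 ^ n)%:R.
have N0 : 0 < N by rewrite ltr0n expn_gt0.
have k0 := cone_ratio_pos_cone_gt0.
have ks := cone_ratio_le_sum m.
set K := \sum_W _ in ks.
have : 0 <= \sum_(W : {ffun 'I_n -> 'I_m.+1}) (cone_ratio (cone_cell W) - kappa / N) ^+ 2.
  by apply: sumr_ge0 => W _; exact: sqr_ge0.
have -> : \sum_(W : {ffun 'I_n -> 'I_m.+1}) (cone_ratio (cone_cell W) - kappa / N) ^+ 2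
    = S - 2 * (kappa / N) * K + (kappa / N) ^+ 2 * N.
  under eq_bigr do rewrite sqrrB.
  rewrite big_split/= sumrB -/S; congr (_ - _ + _).
    by rewrite mulr_sumr; apply: eq_bigr => W _; rewrite -mulr_natl; ring.
  by rewrite sumr_const card_ffun !card_ord -[LHS]mulr_natr.
have -> : (kappa / N) ^+ 2 * N = kappa ^+ 2 / N by field; rewrite gt_eqF.
have : (kappa / N) * kappa <= (kappa / N) * K.
  by rewrite ler_pM2l// divr_gt0.
have -> : kappa / N * kappa = kappa ^+ 2 / N by ring.
rewrite -/N; lra.
Qed.

Variable H : R -> R -> R.
Hypothesis mH : measurable_fun [set: R * R] (fun z => H z.1 z.2).
Hypothesis H0 : forall r t, 0 <= H r t.

Let me : measurable_fun [set: 'rV[R]_n.+1] (@enorm R n.+1).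
Proof. exact: measurable_enorm. Qed.

Lemma measurable_radial_pair :
  measurable_fun [set: 'rV[R]_n.+1 * 'rV[R]_n.+1] (fun z => H (enorm z.1) (enorm z.2)).
Proof.
apply: (measurableT_comp mH (g := fun z : 'rV[R]_n.+1 * 'rV[R]_n.+1 => (enorm z.1, enorm z.2))).
apply/measurable_fun_pairP; split.
  exact: (measurableT_comp me measurable_fst).
exact: (measurableT_comp me measurable_snd).
Qed.

(** For fixed [x] the integrand is radial in [y], so [cone_integralE] extracts one ratio. What
    remains, [G], is radial in [x] and yields the second. *)
Lemma cone_cell_pair_integral C : measurable C -> is_cone C ->
  (\int[mu \x mu]_z (H (enorm z.1) (enorm z.2) * \1_C z.1 * \1_C z.2)%:E =
   (cone_ratio C ^+ 2)%:E * \int[mu \x mu]_z (H (enorm z.1) (enorm z.2))%:E)%E.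
Proof.
move=> mC coneC.
have mi : measurable_fun setT (\1_C : _ -> R) by exact: measurable_indic.
have m1 : measurable_fun [set: 'rV[R]_n.+1 * 'rV[R]_n.+1]
    (fun z => (H (enorm z.1) (enorm z.2) * \1_C z.1 * \1_C z.2)%:E).
  apply/measurable_EFinP; apply: measurable_funM.
    apply: measurable_funM; first exact: measurable_radial_pair.
    exact: (measurableT_comp mi measurable_fst).
  exact: (measurableT_comp mi measurable_snd).
have m2 : measurable_fun [set: 'rV[R]_n.+1 * 'rV[R]_n.+1]
    (fun z => (H (enorm z.1) (enorm z.2))%:E).
  by apply/measurable_EFinP; exact: measurable_radial_pair.
rewrite fubini_tonelli1//; last first.
  by move=> z; rewrite lee_fin !mulr_ge0.
rewrite fubini_tonelli1//; last by move=> z; rewrite lee_fin.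
rewrite /fubini_F/=.
pose G r := (\int[mu]_y (H r (enorm y))%:E)%E.
have G0 r : (0 <= G r)%E by apply: integral_ge0 => y _; rewrite lee_fin.
have mG : measurable_fun [set: R] G.
  pose h (z : R * 'rV[R]_n.+1) := (H z.1 (enorm z.2))%:E.
  have mh : measurable_fun setT h.
    apply/measurable_EFinP.
    apply: (measurableT_comp mH (g := fun z : R * 'rV[R]_n.+1 => (z.1, enorm z.2))).
    apply/measurable_fun_pairP; split; first exact: measurable_fst.
    exact: (measurableT_comp me measurable_snd).
  by apply: (measurable_fun_fubini_tonelli_F (m2 := mu) h mh) => z; rewrite lee_fin.
have mHr r : measurable_fun [set: R] (fun t => (H r t)%:E).
  apply/measurable_EFinP.
  exact: (measurableT_comp mH (measurable_pair1 r)).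
transitivity (\int[mu]_(x in C) ((cone_ratio C)%:E * G (enorm x)))%E.
  rewrite [RHS]integral_mkcond; apply: eq_integral => x _.
  rewrite patchE; have [xC|xC] := boolP (x \in C); last first.
    apply: integral0_eq => y _.
    by rewrite indicE (negbTE xC) mulr0 mul0r.
  rewrite /G -(cone_integralE (F := fun t => (H (enorm x) t)%:E) mC coneC (mHr _)); last first.
    by move=> t; rewrite lee_fin.
  rewrite [RHS]integral_mkcond; apply: eq_integral => y _.
  rewrite patchE indicE xC mulr1 indicE.
  by case: (y \in C); rewrite ?mulr1 ?mulr0.
have mGe : measurable_fun C (fun x => G (enorm x)).
  by apply: measurable_funTS; exact: (measurableT_comp mG me).
rewrite ge0_integralZl_EFin ?cone_ratio_ge0//.
by rewrite cone_integralE// muleA -EFinM -expr2.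
Qed.

(** Radii and angles are independent for a radial integrand: a cell keeps exactly the square of its
    ratio. Summed over the cells, the loss is at most their number, up to [kappa^2]. *)
Lemma cone_decoupling m :
  ((kappa ^+ 2 / (m.+1 ^ n)%:R)%:E * \int[mu \x mu]_z (H (enorm z.1) (enorm z.2))%:E <=
   \int[mu \x mu]_z (H (enorm z.1) (enorm z.2) *
     \sum_(W : {ffun 'I_n -> 'I_m.+1}) \1_(cone_cell W) z.1 * \1_(cone_cell W) z.2)%:E)%E.
Proof.
apply: (@le_trans _ _ (\sum_(W : {ffun 'I_n -> 'I_m.+1}) (cone_ratio (cone_cell W) ^+ 2)%:E *
   \int[mu \x mu]_z (H (enorm z.1) (enorm z.2))%:E)%E).
  rewrite -ge0_sume_distrl; last by move=> W _; rewrite lee_fin sqr_ge0.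
  rewrite sumEFin; apply: lee_wpmul2r; last by rewrite lee_fin sum_cone_ratio_sq.
  by apply: integral_ge0 => z _; rewrite lee_fin.
under eq_bigr => W _ do
  rewrite -(cone_cell_pair_integral (measurable_cone_cell W) (@cone_cone_cell R n m W)).
have mW (W : {ffun 'I_n -> 'I_m.+1}) :
    measurable_fun setT (\1_(@cone_cell R n m W) : _ -> R).
  by apply: measurable_indic; exact: measurable_cone_cell.
rewrite -(ge0_integral_sum _ measurableT (f := fun (W : {ffun 'I_n -> 'I_m.+1}) z =>
  (H (enorm z.1) (enorm z.2) * \1_(cone_cell W) z.1 * \1_(cone_cell W) z.2)%:E)); last 2 first.
- move=> W; apply/measurable_EFinP; apply: measurable_funM.
    apply: measurable_funM; first exact: measurable_radial_pair.
    apply: (measurableT_comp (mW W)); exact: measurable_fst.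
  apply: (measurableT_comp (mW W)); exact: measurable_snd.
- by move=> W z _; rewrite lee_fin !mulr_ge0.
rewrite le_eqVlt; apply/orP; left; apply/eqP; apply: eq_integral => z _.
rewrite sumEFin; congr EFin; rewrite mulr_sumr; apply: eq_bigr => W _.
by rewrite mulrA.
Qed.

End cone_decoupling.

Section seminorm_lower_bound.
Context {R : realType} (n : nat).
Local Notation mu := (lebesgue_rV R n.+1).
Variables (p s Lam : R).
Hypotheses (p1 : 1 < p) (s0 : 0 < s) (Lam1 : 1 < Lam).

Let e : R := n.+1%:R + s * p.
Let V : R := Lam ^+ n.+1 - 1.
Let kappa := cone_ratio (@pos_cone R n).
Let B : R := n.+1%:R * (n.+1%:R * V + 2 * n%:R * Lam + Lam).

Let p0 : 0 < p. Proof. exact: lt_trans p1. Qed.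
Let e0 : 0 < e. Proof. by rewrite ltr_wpDr// mulr_ge0// ltW. Qed.
Let V0 : 0 < V. Proof. by rewrite subr_gt0 exprn_egt1. Qed.
Let Lam0 : 0 < Lam. Proof. exact: lt_trans Lam1. Qed.
Let B0 : 0 < B.
Proof.
rewrite mulr_gt0// ltr_wpDl// addr_ge0// ?mulr_ge0// ltW//.
Qed.
Let kappa0 : 0 < kappa. Proof. exact: cone_ratio_pos_cone_gt0. Qed.

Definition shell_seminorm (r0 : R) (u : 'rV[R]_n.+1 -> R) : \bar R :=
  (\int[mu]_(y in shell n r0 (Lam * r0)) \int[mu]_(x in shell n r0 (Lam * r0))
    (`|u x - u y| `^ p / enorm (x - y) `^ (n.+1%:R + s * p))%:E)%E.

Section fixed_shell.
Variables (r0 : R) (phi : R -> R).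
Hypotheses (r00 : 0 < r0) (mphi : measurable_fun setT phi).

Let E := shell n r0 (Lam * r0).
Let u (x : 'rV[R]_n.+1) := phi (enorm x).
Let M := shell_mass n r0 Lam.
Let chiE (r : R) : R := \1_(`[r0, Lam * r0[%classic) r.
Let osc_j j (r t : R) : R := `|phi r - phi t| `^ p *
  (shell_idx n r0 Lam j r == shell_idx n r0 Lam j t)%:R * (chiE r * chiE t).
Let cells j (x y : 'rV[R]_n.+1) : R := \sum_(W : {ffun 'I_n -> 'I_(2 ^ j).-1.+1})
  \1_(cone_cell W) x * \1_(cone_cell W) y.

Let M0 : 0 < M. Proof. exact: shell_mass_gt0. Qed.

Let chiEE x : chiE (enorm x) = \1_E x.
Proof. by rewrite /chiE !indicE; congr (_%:R); congr nat_of_bool; rewrite !mem_setE !inE. Qed.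

Let mosc_j j : measurable_fun [set: R * R] (fun z => osc_j j z.1 z.2).
Proof.
apply: measurable_funM.
  apply: measurable_funM.
    apply: (measurableT_comp (measurable_powR _)); apply: measurableT_comp => //.
    apply: measurable_funB; first exact: measurableT_comp measurable_fst.
    exact: measurableT_comp measurable_snd.
  apply: (measurable_eq_nat (idx := shell_idx n r0 Lam j)) => k.
  exact: measurable_shell_idx.
have mc : measurable_fun setT chiE by apply: measurable_indic; exact: measurable_itv.
apply: measurable_funM; first exact: measurableT_comp measurable_fst.
exact: measurableT_comp measurable_snd.
Qed.

Let osc_j_ge0 j r t : 0 <= osc_j j r t.
Proof. by rewrite !mulr_ge0 ?powR_ge0. Qed.

Let mosc_je j : measurable_fun [set: 'rV[R]_n.+1 * 'rV[R]_n.+1]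
  (fun z => (osc_j j (enorm z.1) (enorm z.2))%:E).
Proof. by apply/measurable_EFinP; exact: measurable_radial_pair. Qed.

Let mE : measurable E. Proof. exact: measurable_shell. Qed.

Let mu_ : 'rV[R]_n.+1 -> R := u.

Let mu_meas : measurable_fun [set: 'rV[R]_n.+1] u.
Proof. exact: (measurableT_comp mphi (@measurable_enorm R n.+1)). Qed.

Let integral_osc_term j :
  (\int[mu]_(x in E) osc_term mu E (fun j x => shell_idx n r0 Lam j (enorm x)) u p j x =
   \int[mu \x mu]_z (osc_j j (enorm z.1) (enorm z.2))%:E)%E.
Proof.
rewrite fubini_tonelli1//; last by move=> z; rewrite lee_fin.
rewrite /fubini_F/= integral_mkcond; apply: eq_integral => x _.
rewrite patchE /osc_term; have [xE|xE] := boolP (x \in E); last first.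
  by apply/esym/integral0_eq => y _; rewrite /osc_j chiEE indicE (negbTE xE) mul0r mulr0.
rewrite integral_mkcond; apply: eq_integral => y _.
rewrite patchE /osc_j !chiEE !indicE xE mul1r.
by case: (y \in E); rewrite ?mulr1 ?mulr0.
Qed.

Let pred2 j : ((2 ^ j).-1.+1 = 2 ^ j)%N.
Proof. by rewrite prednK// expn_gt0. Qed.

Let cells_le j x y (D : R) : (forall W, @cone_cell R n (2 ^ j).-1 W x -> cone_cell W y -> 1 <= D) ->
  0 <= D -> cells j x y <= D.
Proof.
move=> HD D0; have [[W [xW yW]]|noW]
  := pselect (exists W, @cone_cell R n (2 ^ j).-1 W x /\ cone_cell W y).
  rewrite /cells (bigD1 W)//= big1 => [|W' W'W].
    by rewrite !indicE !mem_set// mulr1 addr0; exact: HD yW.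
  rewrite indicE memNset ?mul0r// => xW'.
  by move/eqP : W'W; apply; exact: cone_cell_uniq xW' xW.
rewrite /cells big1// => W _; rewrite !indicE.
have [xW|] := boolP (x \in cone_cell W); last by rewrite mul0r.
have [yW|] := boolP (y \in cone_cell W); last by rewrite mulr0.
by exfalso; apply: noW; exists W; split; apply/set_mem.
Qed.

Let cells_ge0 j x y : 0 <= cells j x y.
Proof. by apply: sumr_ge0 => W _; rewrite mulr_ge0. Qed.

Let mcells j : measurable_fun [set: 'rV[R]_n.+1 * 'rV[R]_n.+1] (fun z => cells j z.1 z.2).
Proof.
apply: measurable_rsum => W.
have mW : measurable_fun setT (\1_(@cone_cell R n (2 ^ j).-1 W) : _ -> R).
  by apply: measurable_indic; exact: measurable_cone_cell.
apply: measurable_funM; apply: (measurableT_comp mW); [exact: measurable_fst|exact: measurable_snd].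
Qed.

Let target (z : 'rV[R]_n.+1 * 'rV[R]_n.+1) : \bar R :=
  (`|u z.1 - u z.2| `^ p / enorm (z.1 - z.2) `^ e * (\1_E z.1 * \1_E z.2))%:E.

Let target_ge0 z : (0 <= target z)%E.
Proof. by rewrite lee_fin !mulr_ge0 ?invr_ge0 ?powR_ge0. Qed.

Let mtarget : measurable_fun setT target.
Proof.
apply/measurable_EFinP; apply: measurable_funM; last first.
  have mi : measurable_fun setT (\1_E : _ -> R) by exact: measurable_indic.
  apply: measurable_funM; apply: (measurableT_comp mi);
    [exact: measurable_fst|exact: measurable_snd].
apply: measurable_funM.
  apply: (measurableT_comp (measurable_powR _)); apply: measurableT_comp => //.
  apply: measurable_funB; apply: (measurableT_comp mu_meas);
    [exact: measurable_fst|exact: measurable_snd].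
under eq_fun do rewrite -powRN.
apply: (measurableT_comp (measurable_powR _)).
apply: (measurableT_comp (@measurable_enorm R n.+1)).
apply: measurable_fun_rV => i; under eq_fun do rewrite mxE [X in _ + X]mxE.
by apply: measurable_funB; apply: (measurableT_comp (measurable_coord i));
  [exact: measurable_fst|exact: measurable_snd].
Qed.

Let integral_target : (\int[mu \x mu]_z target z = shell_seminorm r0 u)%E.
Proof.
rewrite fubini_tonelli2// /fubini_G/= /shell_seminorm -/E [RHS]integral_mkcond.
apply: eq_integral => y _; rewrite patchE; have [yE|yE] := boolP (y \in E); last first.
  by apply: integral0_eq => x _; rewrite /target/= [\1_E y]indicE (negbTE yE) !mulr0.
rewrite [RHS]integral_mkcond; apply: eq_integral => x _.
rewrite patchE /target/= !indicE yE mulr1.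
by case: (x \in E); rewrite ?mulr1 ?mulr0.
Qed.

(** The weight of level [j] in [osc] times the cost of decoupling into [(2^j)^n] cells. By [c_jE]
    this cost raises the exponent [1 + s p] to [e = d + s p], the exponent of the kernel. *)
Let c_j j : R := expR ((1 + s * p) * ln 2 * j%:R) / M * ((2 ^ j) ^ n)%:R / kappa ^+ 2.

Let c_j_ge0 j : 0 <= c_j j.
Proof. by rewrite !mulr_ge0 ?invr_ge0 ?expR_ge0 ?sqr_ge0// ltW. Qed.

Let c_jE j : c_j j = expR (e * ln 2 * j%:R) / (M * kappa ^+ 2).
Proof.
have -> : expR (e * ln 2 * j%:R) = expR ((1 + s * p) * ln 2 * j%:R) * ((2 ^ j) ^ n)%:R.
  have -> : e * ln 2 * j%:R = (1 + s * p) * ln 2 * j%:R + ln 2 * (j * n)%:R.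
    by rewrite /e -natr1 natrM; ring.
  by rewrite expRD -expnM natrX [expR (ln 2 * _)]expRM_natr lnK// posrE.
by rewrite /c_j; field; rewrite !gt_eqF.
Qed.

(** Level [j] is decoupled into [2^j] cells per angular coordinate, as fine as the radial cells. A
    surviving pair is then at distance at most [B r0 / 2^j], and the weights of all levels allowed
    for a pair add up to a multiple of the kernel by [HK]. *)
Lemma osc_le_shell_seminorm K :
  (forall (Y : R) J, 0 < Y ->
    \sum_(j < J) expR (e * ln 2 * j%:R) * ((2 ^+ j : R) <= Y)%R%:R <= K * Y `^ e) ->
  (\int[mu]_(x in E) osc mu E M (fun j x => shell_idx n r0 Lam j (enorm x)) u s p x <=
   (K * (B * r0) `^ e / (M * kappa ^+ 2))%:E * shell_seminorm r0 u)%E.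
Proof.
move=> HK; have K0 : 0 <= K.
  by have := HK 1 0%N ltr01; rewrite big_ord0 powR1 mulr1.
have midx j k : measurable [set y : 'rV[R]_n.+1 | shell_idx n r0 Lam j (enorm y) = k].
  exact: (@measurable_enorm_preimage R n.+1 _ (measurable_shell_idx n r0 Lam j k)).
rewrite /osc integral_nneseries//; last 2 first.
- move=> j; apply: emeasurable_funM; first exact: measurable_cst.
  by apply: measurable_funTS; exact: measurable_osc_term.
- move=> j x _; rewrite mule_ge0 ?osc_term_ge0// lee_fin divr_ge0 ?expR_ge0//.
  exact: ltW.
have mPsi j : measurable_fun [set: 'rV[R]_n.+1 * 'rV[R]_n.+1]
    (fun z => (osc_j j (enorm z.1) (enorm z.2) * cells j z.1 z.2)%:E).
  apply/measurable_EFinP; apply: measurable_funM; last exact: mcells.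
  by apply/measurable_EFinP; exact: mosc_je.
have Psi0 j z : (0 <= (osc_j j (enorm z.1) (enorm z.2) * cells j z.1 z.2)%:E)%E.
  by rewrite lee_fin mulr_ge0.
have cPsi0 j z : (0 <= (c_j j)%:E *
    (osc_j j (enorm z.1) (enorm z.2) * cells j z.1 z.2)%:E)%E.
  by rewrite mule_ge0 ?lee_fin ?c_j_ge0// -lee_fin; exact: Psi0.
(* Decoupling is an inequality between integrals, so it is applied level by level; only afterwards
   does the series enter the integral, where it is compared with the kernel pointwise. *)
apply: (@le_trans _ _ (\sum_(j <oo) \int[mu \x mu]_z
    ((c_j j)%:E * (osc_j j (enorm z.1) (enorm z.2) * cells j z.1 z.2)%:E))%E).
  apply: lee_nneseries => [j _ _|j _].
    apply: integral_ge0 => x _; rewrite mule_ge0 ?osc_term_ge0//.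
    by rewrite lee_fin divr_ge0 ?expR_ge0// ltW.
  rewrite ge0_integralZl_EFin//; last 3 first.
  - by move=> x _; exact: osc_term_ge0.
  - by apply: measurable_funTS; exact: measurable_osc_term.
  - by rewrite divr_ge0 ?expR_ge0// ltW.
  rewrite ge0_integralZl_EFin// integral_osc_term.
  have := cone_decoupling n (mosc_j j) (osc_j_ge0 j) (2 ^ j).-1.
  have pE : (((2 ^ j).-1.+1 ^ n)%:R : R) = ((2 ^ j) ^ n)%:R by rewrite pred2.
  rewrite -/kappa pE => /(lee_wpmul2l (x := (c_j j)%:E)) H.
  apply: le_trans (H _); last by rewrite lee_fin.
  rewrite muleA -EFinM le_eqVlt; apply/orP; left; apply/eqP; congr (_%:E * _)%E.
  by rewrite /c_j; field; rewrite !gt_eqF// ltr0n expn_gt0 expn_gt0.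
rewrite -integral_nneseries//; last first.
  by move=> j; apply: emeasurable_funM => //; exact: measurable_cst.
have T0 z : setT z -> (0 <= target z)%E by [].
have Mk0 : 0 <= M * kappa ^+ 2 by rewrite mulr_ge0 ?sqr_ge0// ltW.
have KB0 : 0 <= K * (B * r0) `^ e / (M * kappa ^+ 2).
  by rewrite divr_ge0// mulr_ge0 ?powR_ge0.
rewrite -integral_target -ge0_integralZl_EFin//.
apply: ge0_le_integral => //.
- by move=> z _; apply: nneseries_ge0 => j _ _; exact: cPsi0.
- apply: ge0_emeasurable_sum => [j z _ _|j _]; first exact: cPsi0.
  by apply: emeasurable_funM => //; exact: measurable_cst.
- by apply: emeasurable_funM => //; exact: measurable_cst.
move=> [x y] _ /=; apply: nneseries_le => [j|J]; first exact: (cPsi0 j (x, y)).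
under eq_bigr do rewrite -EFinM.
rewrite sumEFin /target/= -EFinM lee_fin.
pose A : R := `|u x - u y| `^ p.
have A0 : 0 <= A by exact: powR_ge0.
have osc_jE j : osc_j j (enorm x) (enorm y) = A *
    (shell_idx n r0 Lam j (enorm x) == shell_idx n r0 Lam j (enorm y))%:R * (\1_E x * \1_E y).
  by rewrite /osc_j !chiEE.
rewrite -/A.
have [/andP[xE yE]|/negP nE] := boolP ((x \in E) && (y \in E)); last first.
  have E0 : \1_E x * \1_E y = 0 :> R.
    rewrite !indicE; move: nE; case: (x \in E) => /=; last by rewrite mul0r.
    by case: (y \in E) => [/(_ isT)//|_]; rewrite mulr0.
  rewrite E0 !mulr0 big1// => j _; rewrite osc_jE E0 mulr0 mul0r mulr0//.
(* On the diagonal every oscillation is 0, and the kernel, a division by zero, only has to be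
   nonnegative. *)
have [->|xy] := eqVneq x y.
  rewrite big1 => [|j _]; last first.
    by rewrite /osc_j subrr normr0 powR0 ?lt0r_neq0// !mul0r mulr0.
  by rewrite mulr_ge0// mulr_ge0 ?divr_ge0 ?powR_ge0// mulr_ge0.
pose D := enorm (x - y).
have D0 : 0 < D.
  rewrite lt_neqAle enorm_ge0 andbT eq_sym; apply: contra xy => /eqP /enorm_eq0 /eqP.
  by rewrite subr_eq0.
have Br0 : 0 < B * r0 by rewrite mulr_gt0.
have Y0 : 0 < B * r0 / D by rewrite divr_gt0.
(* At most one cell contains both points, and if one does while the radial indices agree, then
   [D <= B r0 / 2^j]; the indicator records this condition. *)
apply: (@le_trans _ _ (A / (M * kappa ^+ 2) * \sum_(j < J)
    expR (e * ln 2 * j%:R) * ((2 ^+ j : R) <= B * r0 / D)%R%:R)).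
  rewrite mulr_sumr; apply: ler_sum => j _.
  have -> : A / (M * kappa ^+ 2) * (expR (e * ln 2 * j%:R) * ((2 ^+ j : R) <= B * r0 / D)%R%:R) =
    c_j j * (A * ((2 ^+ j : R) <= B * r0 / D)%R%:R) by rewrite c_jE; ring.
  rewrite ler_wpM2l// osc_jE !indicE xE yE !mulr1 -mulrA ler_wpM2l//.
  have [idxE|_] := eqVneq; last by rewrite mul0r.
  rewrite mul1r; apply: cells_le => // W xW yW.
  have -> : (2 ^+ j <= B * r0 / D)%R = true => //.
  have := @cone_cell_dist R n r0 Lam j (2 ^ j).-1 W x y r00 Lam1 (pred2 j)
    (set_mem xE) (set_mem yE) xW yW idxE.
  by rewrite -/V -/B -/D ler_pdivlMr ?exprn_gt0// ler_pdivlMr// mulrC.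
apply: le_trans (ler_wpM2l _ (HK _ J Y0)) _.
  by rewrite divr_ge0// mulr_ge0 ?sqr_ge0// ltW.
rewrite !indicE xE yE !mulr1 -/D.
rewrite powRM ?invr_ge0 ?(ltW Br0) ?(ltW D0)//.
have -> : D^-1 `^ e = (D `^ e)^-1.
  by rewrite -powR_inv1 ?(ltW D0)// -powRrM mulN1r powRN.
by apply: ler_of_eq; ring.
Qed.

End fixed_shell.
End seminorm_lower_bound.

(** * Gagliardo-Nirenberg on a shell and summation over shells *)

Section recursion.
Context {R : realType}.

Lemma convex_powR_le (tau th x y : R) : 1 <= tau -> 0 < th < 1 -> 0 <= x -> 0 <= y ->
  (th * x + (1 - th) * y) `^ tau <= th * x `^ tau + (1 - th) * y `^ tau.
Proof.
move=> tau1 /andP[th0 th1] x0 y0.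
have th01 : 0 <= th <= 1 by apply/andP; split; lra.
have xI : x \in (`[0, +oo[%classic : set R) by rewrite inE/= in_itv/= x0.
have yI : y \in (`[0, +oo[%classic : set R) by rewrite inE/= in_itv/= y0.
have := convex_powR tau1 (Itv01 (proj1 (andP th01)) (proj2 (andP th01))) xI yI.
by rewrite !convRE/=.
Qed.

(** Convexity of [t^tau] with weights [th] and [1 - th] passes the recursion to [x^tau] with the
    same factor [th]; splitting the sum by a power of 2 could destroy the contraction. Summing from
    [x 0 = 0], the term [th] times the sum is absorbed, which divides by [1 - th]. *)
Lemma contraction_sum_le (tau th c : R) : 1 <= tau -> 0 < th < 1 -> 0 < c ->
  exists2 C, 0 < C & forall (x D : nat -> R) (B : R),
    (forall i, 0 <= x i) -> (forall i, 0 <= D i) -> x 0%N = 0 ->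
    (forall i, x i.+1 <= th * x i + c * (D i `^ tau^-1 + D i.+1 `^ tau^-1)) ->
    (forall J, \sum_(i < J) D i <= B) ->
    forall J, \sum_(i < J) x i `^ tau <= C * B.
Proof.
move=> tau1 /[dup] th01 /andP[th0 th1] c0.
have tau0 : 0 < tau by lra.
have th1' : 0 < 1 - th by lra.
pose k := (1 - th) * (c / (1 - th)) `^ tau * 2 `^ tau.
have k0 : 0 < k by rewrite !mulr_gt0 ?powR_gt0// ?divr_gt0.
exists (2 * k / (1 - th)); first by rewrite divr_gt0// mulr_gt0.
move=> x D B x0 D0 x00 xS DB J.
have B0 : 0 <= B by have := DB 0%N; rewrite big_ord0.
have step i : x i.+1 `^ tau <= th * x i `^ tau + k * (D i + D i.+1).
  pose y := c / (1 - th) * (D i `^ tau^-1 + D i.+1 `^ tau^-1).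
  have y0 : 0 <= y.
    apply: mulr_ge0; last by rewrite addr_ge0 ?powR_ge0.
    by apply: divr_ge0; exact: ltW.
  have : x i.+1 <= th * x i + (1 - th) * y.
    apply: le_trans (xS i) _; rewrite lerD2l /y mulrA [(1 - th) * _]mulrC divfK//.
    by rewrite gt_eqF.
  move=> /(ge0_ler_powR (ltW tau0)); rewrite !nnegrE => H.
  apply: le_trans (H (x0 _) _) _; first by (apply: addr_ge0; apply: mulr_ge0 => //; exact: ltW).
  apply: le_trans (convex_powR_le tau1 th01 (x0 i) y0) _; rewrite lerD2l.
  rewrite /y powRM ?divr_ge0 ?(ltW c0) ?(ltW th1') ?addr_ge0 ?powR_ge0//.
  rewrite mulrA /k -[leRHS]mulrA ler_wpM2l ?mulr_ge0 ?powR_ge0 ?(ltW th1')//.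
  apply: le_trans (powR_add_le (ltW tau0) (powR_ge0 _ _) (powR_ge0 _ _)) _.
  by rewrite -!powRrM mulVf ?gt_eqF// !powRr1.
have Sx J' : \sum_(i < J') x i `^ tau <= \sum_(i < J'.+1) x i `^ tau.
  by rewrite big_ord_recr/= lerDl powR_ge0.
have main J' : \sum_(i < J'.+1) x i `^ tau <= th * \sum_(i < J') x i `^ tau + 2 * k * B.
  rewrite big_ord_recl/= x00 powR0 ?gt_eqF// add0r.
  apply: (@le_trans _ _ (\sum_(i < J') (th * x i `^ tau + k * (D i + D i.+1)))).
    by apply: ler_sum => j _; exact: step.
  rewrite big_split/= -!mulr_sumr lerD2l big_split/=.
  have H1 := DB J'; have H2 : \sum_(i < J') D i.+1 <= B.
    have := DB J'.+1; rewrite big_ord_recl/= => H2.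
    by apply: le_trans H2; rewrite lerDr.
  have := ler_wpM2l (ltW k0) (lerD H1 H2); lra.
have := main J; have := Sx J.
have -> : 2 * k / (1 - th) * B = 2 * k * B / (1 - th) by ring.
rewrite ler_pdivlMr//; lra.
Qed.

(** A substitute for the discrete Hölder inequality when the exponents add up to more than 1: the
    product is at most [m^(x + y)] for the larger entry [m], and [m <= K] lets the excess power be
    bounded by a constant. *)
Lemma powR_product_le (x y t r K : R) : 0 <= x -> 0 <= y -> 1 <= x + y -> 1 <= K ->
    0 < t <= K -> 0 < r <= K -> t `^ x * r `^ y <= K `^ (x + y) * (t + r).
Proof.
move=> x0 y0 xy K1 /andP[t0 tK] /andP[r0 rK].
have K0 : 0 < K by lra.
pose m := Num.max t r.
have m0 : 0 < m by rewrite lt_max t0.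
have mK : m <= K by rewrite ge_max tK.
have tm : t <= m by rewrite /m le_max lexx.
have rm : r <= m by rewrite /m le_max lexx orbT.
have mtr : m <= t + r by rewrite ge_max; apply/andP; split; lra.
apply: (@le_trans _ _ (m `^ (x + y))).
  rewrite powRD; last by apply/implyP => _; rewrite gt_eqF.
  by apply: ler_pM; rewrite ?powR_ge0//;
    apply: ge0_ler_powR; rewrite ?nnegrE ?(ltW t0) ?(ltW r0) ?(ltW m0).
rewrite (_ : m `^ (x + y) = (K * (m / K)) `^ (x + y)); last by rewrite mulrC divfK// gt_eqF.
rewrite powRM ?divr_ge0 ?(ltW K0) ?(ltW m0)// ler_wpM2l ?powR_ge0//.
apply: (@le_trans _ _ (m / K)).
  apply: ge1r_powR => //; apply/andP; split; first exact: divr_gt0.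
  by rewrite ler_pdivrMr// mul1r.
apply: (@le_trans _ _ m); first by rewrite ler_pdivrMr// ler_peMr// ltW.
exact: mtr.
Qed.

End recursion.

Section shell_gagliardo_nirenberg.
Context {R : realType} (n : nat).
Local Notation mu := (lebesgue_rV R n.+1).
Variables (p q tau s a Lam : R).
Hypotheses (p1 : 1 < p) (q1 : 1 <= q) (tau1 : 1 <= tau) (s0 : 0 < s).
Hypotheses (ha : 0 < a <= 1) (Lam1 : 1 < Lam).
Hypothesis kappa_le : a * (p^-1 - s) + (1 - a) / q <= tau^-1.

(** The power of [r0] is the one dictated by dilations; it arises from the mass [M], of order
    [r0^d], and from the factor [(B r0)^e] of the seminorm bound. The constant collects the parts of
    [M], [m] and [k] free of [r0], [n0] and [q0]. *)
Lemma shell_gagliardo_nirenberg : exists2 C : R, 0 < C &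
  forall (r0 : R) (phi : R -> R) (n0 q0 : R), 0 < r0 -> measurable_fun setT phi ->
    let E := shell n r0 (Lam * r0) in let u x := phi (enorm x) in
    mu.-integrable E (EFin \o u) -> 0 < n0 -> 0 < q0 ->
    (shell_seminorm p s Lam r0 u <= n0%:E)%E ->
    (a < 1 -> (\int[mu]_(x in E) (`|u x| `^ q)%:E <= q0%:E)%E) ->
  (\int[mu]_(x in E) (`|u x - average mu E u| `^ tau)%:E <=
   (C * expR ((n.+1%:R + tau * (a * (s - n.+1%:R / p) - (1 - a) * n.+1%:R / q)) * ln r0
      + tau * (a / p * ln n0 + (1 - a) / q * ln q0)))%:E)%E.
Proof.
have p0 : 0 < p by exact: lt_trans p1.
have q00 : 0 < q by exact: lt_le_trans q1.
have L0 : 0 < ln (2 : R) by rewrite ln_gt0// ltr1n.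
have [C0 C00 HC0] := pointwise_bound p1 q1 tau1 s0 ha L0 (c := 16) (ltr0n _ 16) kappa_le.
pose e : R := n.+1%:R + s * p.
have e0 : 0 < e by rewrite ltr_wpDr// mulr_ge0// ltW.
have [K K0 HK] := dyadic_sum_le e0.
pose V : R := Lam ^+ n.+1 - 1.
have V0 : 0 < V by rewrite subr_gt0 exprn_egt1.
pose kap := cone_ratio (@pos_cone R n).
have kap0 : 0 < kap by exact: cone_ratio_pos_cone_gt0.
pose B : R := n.+1%:R * (n.+1%:R * V + 2 * n%:R * Lam + Lam).
have B0 : 0 < B.
  by rewrite mulr_gt0// ltr_wpDl ?(lt_trans _ Lam1)// addr_ge0
    ?mulr_ge0 ?(ltW V0)// ltW// (lt_trans _ Lam1).
pose c0 := @cone_mass R n setT.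
have c00 : 0 < c0 by exact: cone_massT_gt0.
have cV0 : 0 < c0 * V by rewrite mulr_gt0.
pose lc := ln (c0 * V).
pose C1 := C0 * (3 + 2 `^ q * (1 + 2 `^ q)).
have C10 : 0 < C1.
  by rewrite mulr_gt0// addr_gt0// mulr_gt0 ?powR_gt0// addr_gt0 ?powR_gt0.
exists (C1 * expR (lc + tau * (a * (ln K + e * ln B - ln (kap ^+ 2) - 2 * lc) / p
    - (1 - a) * lc / q))); first by rewrite mulr_gt0 ?expR_gt0.
move=> r0 phi n0 q0 r00 mphi E u intu n00 q000 Sn fq.
pose M := shell_mass n r0 Lam.
have M0 : 0 < M by exact: shell_mass_gt0.
have ME : M = expR (lc + n.+1%:R * ln r0).
  rewrite /M /shell_mass expRD lnK ?posrE//; congr (_ * _).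
  by rewrite mulrC expRM_natr lnK ?posrE.
(* [m] and [k] solve [M expR (p m) = K (B r0)^e n0 / (M kap^2)] and [M expR (q k) = q0]. *)
pose m := (ln K + e * (ln B + ln r0) - ln (kap ^+ 2) + ln n0
   - 2 * (lc + n.+1%:R * ln r0)) / p.
pose k := (ln q0 - (lc + n.+1%:R * ln r0)) / q.
have pm : p * m = ln K + e * (ln B + ln r0) - ln (kap ^+ 2) + ln n0
   - 2 * (lc + n.+1%:R * ln r0) by rewrite /m mulrC divfK// gt_eqF.
have qk : q * k = ln q0 - (lc + n.+1%:R * ln r0) by rewrite /k mulrC divfK// gt_eqF.
have oscm : (\int[mu]_(x in E) osc mu E M (fun j x => shell_idx n r0 Lam j (enorm x)) u s p x
    <= (M * expR (p * m))%:E)%E.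
  apply: (le_trans (osc_le_shell_seminorm p1 Lam1 r00 mphi HK)).
  have KB0 : (0 <= (K * (B * r0) `^ e / (M * kap ^+ 2))%:E)%E.
    rewrite lee_fin; apply: divr_ge0; apply: mulr_ge0.
    - exact: ltW.
    - exact: powR_ge0.
    - exact: ltW.
    - exact: sqr_ge0.
  apply: (le_trans (lee_wpmul2l KB0 Sn)).
  rewrite -EFinM lee_fin; apply: ler_of_eq.
  rewrite -/M -/V -/B -/kap -/e.
  have -> : (B * r0) `^ e = expR (e * (ln B + ln r0)).
    have Br0 : 0 < B * r0 by exact: mulr_gt0.
    by rewrite -lnM ?posrE// /powR (gt_eqF Br0).
  rewrite pm invfM ME -expRN.
  have -> : (kap ^+ 2)^-1 = expR (- ln (kap ^+ 2)).
    by rewrite expRN lnK// posrE exprn_gt0.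
  have {1}-> : K = expR (ln K) by rewrite lnK ?posrE.
  have {1}-> : n0 = expR (ln n0) by rewrite lnK ?posrE.
  by rewrite -!expRD; congr expR; ring.
have fq' : a < 1 -> (\int[mu]_(y in E) (`|u y| `^ q)%:E <= (M * expR (q * k))%:E)%E.
  move=> /fq /le_trans; apply; rewrite lee_fin; apply: ler_of_eq.
  by rewrite ME qk -expRD addrC subrK lnK.
have mu_ : measurable_fun setT u by exact: (measurableT_comp mphi (@measurable_enorm R n.+1)).
have := integral_sub_average_le (shell_partition n r00 Lam1) mu_ intu p1 q1 tau1 s0
  C00 HC0 oscm fq'.
move=> /le_trans; apply; rewrite lee_fin -/M ME; apply: ler_of_eq.
rewrite -/C1 -!(mulrA C1) -!expRD; congr (_ * expR _).
rewrite /m /k /e; field.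
by rewrite !gt_eqF.
Qed.

End shell_gagliardo_nirenberg.

Lemma powR_expR (R : realType) (x r : R) : 0 < x -> x `^ r = expR (r * ln x).
Proof. by move=> x0; rewrite /powR gt_eqF. Qed.

Section average_comparison.
Context d (T : measurableType d) (R : realType) (mu : {measure set T -> \bar R}).

(** Used with [A] the common part of two shells and [c] the average over one of them;
    [average_sub_le] applies at the level [Z = (B / v)^(1 / tau)]. *)
Lemma average_subset_sub_le (A E : set T) (f : T -> R) (tau c v B : R) :
    1 <= tau -> measurable A -> measurable E -> A `<=` E -> measurable_fun setT f ->
    mu.-integrable E (EFin \o f) -> mu A = v%:E -> 0 < v -> 0 < B ->
    (\int[mu]_(x in E) (`|f x - c| `^ tau)%:E <= B%:E)%E ->
  `|average mu A f - c| <= 2 * (B / v) `^ tau^-1.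
Proof.
move=> tau1 mA mE AE mf intf muA v0 B0 fB.
have tau0 : 0 < tau by exact: lt_le_trans tau1.
apply: (average_sub_le tau1 mA muA v0).
- by rewrite powR_gt0// divr_gt0.
- exact: integrableS intf.
- have -> : v * ((B / v) `^ tau^-1) `^ tau = B.
    have Bv0 : 0 <= B / v by rewrite divr_ge0 ?(ltW B0) ?(ltW v0).
    by rewrite -powRrM mulVf ?gt_eqF// powRr1// mulrC divfK// gt_eqF.
  apply: (le_trans _ fB).
  apply: ge0_subset_integral => //.
  apply: measurable_funTS; apply/measurable_EFinP.
  apply: (measurableT_comp (measurable_powR _)); apply: measurableT_comp => //.
  by apply: measurable_funB.
Qed.

Lemma integral_powR_le_sub (E : set T) (f : T -> R) (tau c M B : R) :
    1 <= tau -> measurable E -> measurable_fun setT f -> mu E = M%:E ->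
    (\int[mu]_(x in E) (`|f x - c| `^ tau)%:E <= B%:E)%E ->
  (\int[mu]_(x in E) (`|f x| `^ tau)%:E <= (2 `^ tau * (B + M * `|c| `^ tau))%:E)%E.
Proof.
move=> tau1 mE mf muE fB.
have tau0 : 0 < tau by exact: lt_le_trans tau1.
have mfc : measurable_fun E (fun x => (`|f x - c| `^ tau)%:E).
  apply: measurable_funTS; apply/measurable_EFinP.
  apply: (measurableT_comp (measurable_powR _)); apply: measurableT_comp => //.
  exact: measurable_funB.
have mf' : measurable_fun E (fun x => (`|f x| `^ tau)%:E).
  apply: measurable_funTS; apply/measurable_EFinP.
  by apply: (measurableT_comp (measurable_powR _)); exact: measurableT_comp.
have fc0 x : E x -> (0 <= (`|f x - c| `^ tau)%:E)%E by rewrite lee_fin powR_ge0.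
have f0 x : E x -> (0 <= (`|f x| `^ tau)%:E)%E by rewrite lee_fin powR_ge0.
have c0 x : E x -> (0 <= (`|c| `^ tau)%:E)%E by rewrite lee_fin powR_ge0.
have fcc0 x : E x -> (0 <= (`|f x - c| `^ tau)%:E + (`|c| `^ tau)%:E)%E.
  by move=> Ex; rewrite adde_ge0 ?fc0 ?(c0 _ Ex).
have mfcc : measurable_fun E (fun x => (`|f x - c| `^ tau)%:E + (`|c| `^ tau)%:E)%E.
  by apply: emeasurable_funD => //; exact: measurable_cst.
apply: (@le_trans _ _ (\int[mu]_(x in E)
    ((2 `^ tau)%:E * ((`|f x - c| `^ tau)%:E + (`|c| `^ tau)%:E)))%E).
  apply: ge0_le_integral => //.
    by apply: emeasurable_funM => //; exact: measurable_cst.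
  move=> x _; rewrite -EFinD -EFinM lee_fin.
  apply: le_trans (powR_add_le (ltW tau0) (normr_ge0 _) (normr_ge0 _)).
  apply: ge0_ler_powR; rewrite ?nnegrE ?addr_ge0 ?(ltW tau0)//.
  by rewrite -{1}[f x](subrK c) ler_normD.
rewrite ge0_integralZl_EFin ?powR_ge0// ge0_integralD// integral_cst// muE.
rewrite EFinM; apply: lee_wpmul2l; first by rewrite lee_fin powR_ge0.
by rewrite EFinD -EFinM [_ `^ _ * M]mulrC; apply: leeD.
Qed.

End average_comparison.

(* The added geometric sequence makes the majorant strictly positive. *)
Lemma positive_summable_majorant (R : realType) (t : (\bar R)^nat) (N : R) : 0 < N ->
    (forall i, 0 <= t i)%E -> (forall J, \sum_(i < J) t i <= N%:E)%E ->
  exists r : nat -> R, [/\ forall i, 0 < r i, forall i, (t i <= (r i)%:E)%E,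
    forall J, \sum_(i < J) r i <= 2 * N & forall i, r i <= 2 * N].
Proof.
move=> N0 t0 tN.
have tfin i : t i \is a fin_num.
  rewrite ge0_fin_numE//; apply: (@le_lt_trans _ _ N%:E); last exact: ltey.
  by apply: le_trans (tN i.+1); rewrite big_ord_recr/= leeDr// sume_ge0.
have h0 j : 0 < N * 2^-1 * 2^-1 ^+ j by rewrite !mulr_gt0 ?exprn_gt0 ?invr_gt0.
exists (fun i => fine (t i) + N * 2^-1 * 2^-1 ^+ i).
have S J : \sum_(i < J) (fine (t i) + N * 2^-1 * 2^-1 ^+ i) <= 2 * N.
  rewrite big_split/= -mulr_sumr.
  have H1 : \sum_(i < J) fine (t i) <= N.
    rewrite -lee_fin -sumEFin; apply: le_trans (tN J).
    by under eq_bigr do rewrite fineK//.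
  have r01 : 0 <= (2^-1 : R) < 1 by apply/andP; split; lra.
  have H2 := geometric_sum_le J r01.
  have : N * 2^-1 * \sum_(j < J) 2^-1 ^+ j <= N * 2^-1 * (1 - 2^-1)^-1.
    by rewrite ler_wpM2l// mulr_ge0 ?invr_ge0// ltW.
  have -> : N * 2^-1 * (1 - 2^-1)^-1 = N by field.
  lra.
have r0 i : 0 < fine (t i) + N * 2^-1 * 2^-1 ^+ i.
  by rewrite ltr_wpDl// fine_ge0.
split => // i; first by rewrite EFinD fineK// leeDl// lee_fin ltW.
apply: le_trans (S i.+1); rewrite big_ord_recr/= lerDr sumr_ge0// => j _.
exact: ltW.
Qed.

Section shells_estimate.
Context {R : realType} (n : nat).
Local Notation mu := (lebesgue_rV R n.+1).
Local Notation d := (n.+1%:R : R).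
Variables (p q tau s a alpha beta gamma Lam b w om : R).
Hypotheses (p1 : 1 < p) (q1 : 1 <= q) (tau1 : 1 <= tau) (s0 : 0 < s).
Hypotheses (ha : 0 < a <= 1).
Hypothesis kappa_le : a * (p^-1 - s) + (1 - a) / q <= tau^-1.
Hypothesis tau_le : tau^-1 <= a / p + (1 - a) / q.
Hypothesis balance : tau^-1 + gamma / d =
  a * (p^-1 + (alpha - s) / d) + (1 - a) * (q^-1 + beta / d).
Hypotheses (b1 : 1 < b) (Lamb : Lam = b ^+ 2) (om0 : 0 < om).
Hypotheses (w1 : 1 <= w) (wom : om <= w) (wb : w <= b) (wbom : w <= b * om).
Hypothesis contr : om `^ (gamma + d / tau) < 1.

(** The conditions on [w] say that the shell of ratio [b] starting at [w rho i] lies in both [E i]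
    and [E i.+1]. Each shell contributes its deviation from the average, controlled by [D i], and
    the average itself, controlled through the contraction. *)
Lemma shells_estimate : exists2 C : R, 0 < C &
  forall (rho0 : R) (phi : R -> R) (N Q : R), 0 < rho0 -> measurable_fun setT phi ->
    let rho i := rho0 * om ^+ i in
    let E i := shell n (rho i) (Lam * rho i) in
    let u x := phi (enorm x) in
    (forall i, mu.-integrable (E i) (EFin \o u)) ->
    (forall x, E 0%N x -> u x = 0) -> 0 < N -> 0 < Q ->
    (forall J, (\sum_(i < J) (rho i `^ (alpha * p))%:E * shell_seminorm p s Lam (rho i) u
      <= N%:E)%E) ->
    (a < 1 -> forall J, (\sum_(i < J) (rho i `^ (beta * q))%:E *
      \int[mu]_(x in E i) (`|u x| `^ q)%:E <= Q%:E)%E) ->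
  forall J, (\sum_(i < J) (rho i `^ (gamma * tau))%:E *
      \int[mu]_(x in E i) (`|u x| `^ tau)%:E <=
    (C * expR (tau * (a / p * ln N + (1 - a) / q * ln Q)))%:E)%E.
Proof.
have p0 : 0 < p by exact: lt_trans p1.
have q0 : 0 < q by exact: lt_le_trans q1.
have tau0 : 0 < tau by exact: lt_le_trans tau1.
have b0 : 0 < b by exact: lt_trans b1.
have w0 : 0 < w by exact: lt_le_trans w1.
have [a0 a1] := andP ha.
have Lam1 : 1 < Lam by rewrite Lamb exprn_egt1.
have Lam0 : 0 < Lam by exact: lt_trans Lam1.
have d0 : 0 < d by rewrite ltr0n.
have [CL CL0 HL] := shell_gagliardo_nirenberg n p1 q1 tau1 s0 ha Lam1 kappa_le.
pose x : R := tau * (a / p); pose y : R := tau * ((1 - a) / q).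
have x0 : 0 <= x by rewrite mulr_ge0 ?divr_ge0 ?ltW.
have y0 : 0 <= y by rewrite mulr_ge0 ?divr_ge0 ?subr_ge0 ?(ltW tau0) ?(ltW q0).
have xy1 : 1 <= x + y.
  by rewrite /x /y -mulrDr -ler_pdivrMl// mulr1.
pose c0 := @cone_mass R n setT.
have c00 : 0 < c0 by exact: cone_massT_gt0.
pose cA : R := c0 * (b ^+ n.+1 - 1) * w ^+ n.+1.
have cA0 : 0 < cA by rewrite !mulr_gt0 ?exprn_gt0// subr_gt0 exprn_egt1.
pose cE : R := c0 * (Lam ^+ n.+1 - 1).
have cE0 : 0 < cE by rewrite mulr_gt0// subr_gt0 exprn_egt1.
pose delta : R := gamma + d / tau.
have th01 : 0 < om `^ delta < 1 by rewrite powR_gt0.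
(* The two summands come from comparing the average over the common part with [v i] and with
   [v i.+1]. The measure of that part is [cA rho_i^d], that is [cA / om^d] times [rho_(i+1)^d]. *)
pose cc : R := 2 * (om `^ delta * cA^-1 `^ tau^-1 + (om ^+ n.+1 / cA) `^ tau^-1).
have cc0 : 0 < cc.
  by rewrite mulr_gt0// addr_gt0// ?mulr_gt0 ?powR_gt0 ?divr_gt0 ?exprn_gt0 ?invr_gt0.
have [CS CS0 HCS] := contraction_sum_le tau1 th01 cc0.
pose CD : R := CL * 2 `^ (x + y).
have CD0 : 0 < CD by rewrite mulr_gt0 ?powR_gt0.
have CDE0 : 0 < CS * (CD * 4) by apply: mulr_gt0 => //; apply: mulr_gt0.
exists (2 `^ tau * (CD * 4 + cE * (CS * (CD * 4)))).
  rewrite mulr_gt0 ?powR_gt0// addr_gt0//; first exact: mulr_gt0.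
  exact: (mulr_gt0 cE0).
move=> rho0 phi N Q rho00 mphi rho E u intu u0 N0 Q0 SN SQ J.
have mu_ : measurable_fun setT u by exact: (measurableT_comp mphi (@measurable_enorm R n.+1)).
have rho_gt0 i : 0 < rho i by rewrite mulr_gt0 ?exprn_gt0.
have rhoS i : rho i.+1 = om * rho i by rewrite /rho exprS; ring.
have mE i : measurable (E i) by exact: measurable_shell.
set W := expR _.
have W0 : 0 < W by exact: expR_gt0.
have S0 i : (0 <= shell_seminorm p s Lam (rho i) u)%E.
  rewrite /shell_seminorm; apply: integral_ge0 => y1 _; apply: integral_ge0 => x1 _.
  by rewrite lee_fin divr_ge0 ?powR_ge0.
have F0 t i : (0 <= \int[mu]_(x in E i) (`|u x| `^ t)%:E)%E.
  by apply: integral_ge0 => ? _; rewrite lee_fin powR_ge0.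
have [nn [nn0 nnS nnN nn2]] := positive_summable_majorant N0
  (fun i => mule_ge0 (powR_ge0 (rho i) (alpha * p) : (0 <= _%:E)%E) (S0 i)) SN.
(* For [a = 1] there is no L^q control. The zero sequence then still yields a majorant [qq], which
   enters with the exponent [y = 0]. *)
pose tq i := (if (a < 1)%R then (rho i `^ (beta * q))%:E *
  \int[mu]_(x in E i) (`|u x| `^ q)%:E else 0)%E.
have tq0 i : (0 <= tq i)%E.
  by rewrite /tq; case: ifP => // _; rewrite mule_ge0// lee_fin powR_ge0.
have tqQ I : (\sum_(i < I) tq i <= Q%:E)%E.
  rewrite /tq; case: (boolP (a < 1)) => [/SQ|_]; first exact.
  by rewrite big1// lee_fin ltW.
have [qq [qq0 qqS qqQ qq2]] := positive_summable_majorant Q0 tq0 tqQ.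
(* [D i] dominates the local product of powers: [nn i / N] and [qq i / Q] lie in []0, 2]], so
   [powR_product_le] with [K = 2] replaces the product by a sum. Each of the two sums is at most 2,
   whence the 4. *)
pose D i : R := CD * W * (nn i / N + qq i / Q).
have D0 i : 0 < D i.
  by rewrite !mulr_gt0 ?expR_gt0// addr_gt0// divr_gt0.
have DS I : \sum_(i < I) D i <= CD * W * 4.
  have CDW : 0 <= CD * W by rewrite ltW ?mulr_gt0.
  rewrite -mulr_sumr ler_wpM2l// big_split/= -!mulr_suml.
  have h1 : (\sum_(i < I) nn i) / N <= 2 by rewrite ler_pdivrMr.
  have h2 : (\sum_(i < I) qq i) / Q <= 2 by rewrite ler_pdivrMr.
  lra.
pose v i := average mu (E i) u.
have HD i : (\int[mu]_(x in E i) (`|u x - v i| `^ tau)%:E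
    <= (rho i `^ (- (gamma * tau)) * D i)%:E)%E.
  have r0 := rho_gt0 i.
  have n00 : 0 < nn i * rho i `^ (- (alpha * p)) by rewrite mulr_gt0 ?powR_gt0.
  have q00 : 0 < qq i * rho i `^ (- (beta * q)) by rewrite mulr_gt0 ?powR_gt0.
  have shift (t e : R) (T : \bar R) : (0 <= T)%E -> ((rho i `^ e)%:E * T <= t%:E)%E ->
      (T <= (t * rho i `^ (- e))%:E)%E.
    move=> T0 Tt; rewrite powRN EFinM lee_pdivlMr ?powR_gt0//.
    by rewrite muleC.
  have := HL (rho i) phi _ _ r0 mphi (intu i) n00 q00.
  have h1 : (shell_seminorm p s Lam (rho i) u <= (nn i * rho i `^ (- (alpha * p)))%:E)%E.
    exact: shift.
  have h2 : (a < 1 -> (\int[mu]_(x in E i) (`|u x| `^ q)%:E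
      <= (qq i * rho i `^ (- (beta * q)))%:E)%E).
    by move=> a1'; apply: shift => //; move: (qqS i); rewrite /tq a1'.
  move=> /(_ h1 h2); move/le_trans; apply.
  have ln1 t e : 0 < t -> ln (t * rho i `^ e) = ln t + e * ln (rho i).
    by move=> t0; rewrite lnM ?posrE ?powR_gt0// ln_powR.
  rewrite lee_fin ln1// ln1//.
  have -> : (d + tau * (a * (s - d / p) - (1 - a) * d / q)) * ln (rho i) +
      tau * (a / p * (ln (nn i) + - (alpha * p) * ln (rho i)) +
        (1 - a) / q * (ln (qq i) + - (beta * q) * ln (rho i))) =
      - (gamma * tau) * ln (rho i) + (x * ln (nn i / N) + y * ln (qq i / Q) +
      tau * (a / p * ln N + (1 - a) / q * ln Q)).
    rewrite !ln_div ?posrE// /x /y.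
    (* The balance condition, solved for [gamma], cancels every power of [rho i] except
       [- (gamma * tau)]. *)
    have -> : gamma = d * (a * (p^-1 + (alpha - s) / d) + (1 - a) * (q^-1 + beta / d) - tau^-1).
      by rewrite -balance; field; rewrite !gt_eqF.
    by field; rewrite !gt_eqF.
  rewrite expRD -powR_expR// expRD expRD.
  rewrite -!powR_expR ?divr_gt0// -/W.
  have := @powR_product_le _ x y (nn i / N) (qq i / Q) 2 x0 y0 xy1.
  rewrite !divr_gt0// !ler_pdivrMr// nn2 qq2 ler1n => /(_ isT isT isT) hxy.
  rewrite mulrCA; apply: ler_wpM2l; first exact: powR_ge0.
  rewrite /D /CD mulrA mulrAC -!(mulrA CL); apply: ler_wpM2l; first exact: ltW.
  have -> : 2 `^ (x + y) * W * (nn i / N + qq i / Q)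
    = 2 `^ (x + y) * (nn i / N + qq i / Q) * W by ring.
  by rewrite mulrC; apply: ler_wpM2r => //; exact: ltW.
(* consecutive shells are compared through their common part [A i] *)
pose A i := shell n (w * rho i) (b * (w * rho i)).
have mA i : measurable (A i) by exact: measurable_shell.
have AE i : A i `<=` E i.
  move=> z; rewrite /A /E /shell/= => /andP[lo hi]; apply/andP; split.
    by apply: (le_trans _ lo); rewrite ler_peMl// ltW.
  apply: (lt_le_trans hi); rewrite mulrA ler_wpM2r ?(ltW (rho_gt0 i))//.
  by rewrite Lamb expr2 ler_wpM2l// ltW.
have AE1 i : A i `<=` E i.+1.
  move=> z; rewrite /A /E rhoS /shell/= => /andP[lo hi]; apply/andP; split.
    by apply: (le_trans _ lo); rewrite ler_wpM2r// ltW.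
  apply: (lt_le_trans hi); move: (rho i) (rho_gt0 i) => r r0.
  by rewrite !mulrA ler_wpM2r ?(ltW r0)// Lamb expr2 -mulrA ler_wpM2l// ltW.
have muA i : mu (A i) = (cA * rho i ^+ n.+1)%:E.
  rewrite lebesgue_rV_shell ?(mulr_gt0 w0 (rho_gt0 i))//; last first.
    by apply: ler_peMl; apply/ltW => //; apply: mulr_gt0.
  by congr EFin; rewrite /cA /c0 !exprMn; ring.
have muE i : mu (E i) = (cE * rho i ^+ n.+1)%:E.
  rewrite lebesgue_rV_shell//; last first.
    by apply: ler_peMl; apply/ltW.
  by congr EFin; rewrite /cE /c0 !exprMn; ring.
(* The exponent [delta = gamma + d / tau] appears here: the weight gives [gamma], and dividing by a
   measure of order [r^d] under the [tau]-th root gives [d / tau]. *)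
have scale r k D' : 0 < r -> 0 < k -> 0 < D' ->
    (r `^ (- (gamma * tau)) * D' / (k * r ^+ n.+1)) `^ tau^-1
    = r `^ (- delta) * k^-1 `^ tau^-1 * D' `^ tau^-1.
  move=> r0 k0 D'0.
  rewrite -mulrA -[r ^+ n.+1]powR_mulrn ?(ltW r0)//.
  rewrite [D' / _]mulrC invfM mulrA [_ `^ _ * (_ * _)]mulrA mulrC.
  rewrite powRM ?mulr_ge0 ?invr_ge0 ?powR_ge0 ?(ltW D'0) ?(ltW k0)//.
  rewrite mulrC; congr (_ * _).
  rewrite mulrAC powRM ?mulr_ge0 ?invr_ge0 ?powR_ge0 ?(ltW k0)//; congr (_ * _).
  rewrite -powRN -powRD; last by rewrite (gt_eqF r0) implybT.
  by rewrite -powRrM; congr (_ `^ _); rewrite /delta; field; rewrite gt_eqF.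
pose xi i := rho i `^ delta * `|v i|.
have xi0 i : 0 <= xi i by rewrite mulr_ge0 ?powR_ge0.
have dist i j (k : R) : 0 < k -> A i `<=` E j -> mu (A i) = (k * rho j ^+ n.+1)%:E ->
    `|average mu (A i) u - v j| <=
    2 * (rho j `^ (- delta) * k^-1 `^ tau^-1 * D j `^ tau^-1).
  move=> k0 AiE muAi; rewrite -scale//.
  have v0 : 0 < k * rho j ^+ n.+1 by rewrite mulr_gt0// exprn_gt0// rho_gt0.
  have B0 : 0 < rho j `^ (- (gamma * tau)) * D j by rewrite mulr_gt0// powR_gt0.
  by apply: (average_subset_sub_le tau1 (mA i) (mE j) AiE mu_ (intu j)).
have xiS i : xi i.+1 <= om `^ delta * xi i + cc * (D i `^ tau^-1 + D i.+1 `^ tau^-1).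
  have h1 := dist i i cA cA0 (AE i) (muA i).
  have k0 : 0 < cA / om ^+ n.+1 by rewrite divr_gt0// exprn_gt0.
  have omn : om ^+ n.+1 != 0 by rewrite gt_eqF// exprn_gt0.
  have muA1 : mu (A i) = (cA / om ^+ n.+1 * rho i.+1 ^+ n.+1)%:E.
    by rewrite muA rhoS; congr EFin; rewrite [(om * _) ^+ _]exprMn; field.
  have := dist i i.+1 _ k0 (AE1 i) muA1.
  rewrite rhoS powRM ?(ltW om0) ?(ltW (rho_gt0 i))// invf_div => h2.
  set av := average mu (A i) u in h1 h2.
  have hv : `|v i.+1| <= `|v i| + `|av - v i| + `|av - v i.+1|.
    have {1}-> : v i.+1 = v i + (av - v i) - (av - v i.+1) by ring.
    by apply: (le_trans (ler_normB _ _)); rewrite lerD2r ler_normD.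
  have od0 : 0 < om `^ delta by exact: powR_gt0.
  have rd0 : 0 < rho i `^ delta by exact: powR_gt0.
  rewrite /xi rhoS powRM ?(ltW om0) ?(ltW (rho_gt0 i))//.
  have h3 : om `^ delta * rho i `^ delta * `|v i.+1| <=
      om `^ delta * rho i `^ delta * (`|v i|
        + 2 * (rho i `^ (- delta) * cA^-1 `^ tau^-1 * D i `^ tau^-1)
        + 2 * (om `^ (- delta) * rho i `^ (- delta) * (om ^+ n.+1 / cA) `^ tau^-1 *
           D i.+1 `^ tau^-1)).
    apply: ler_wpM2l; first by rewrite mulr_ge0 ?powR_ge0.
    by apply: (le_trans hv); rewrite lerD// lerD2l.
  apply: (le_trans h3).
  rewrite !powRN /cc.
  set P := om `^ delta in od0 *; set Rr := rho i `^ delta in rd0 *.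
  set ka := cA^-1 `^ tau^-1; set kb := (_ / cA) `^ _.
  set D1 := D i `^ _; set D2 := D i.+1 `^ _.
  have -> : P * Rr * (`|v i| + 2 * (Rr^-1 * ka * D1) + 2 * (P^-1 * Rr^-1 * kb * D2)) =
      P * (Rr * `|v i|) + 2 * (P * ka * D1) + 2 * (kb * D2).
    by field; rewrite !gt_eqF.
  rewrite -addrA lerD2l -mulrDr -[leRHS]mulrA ler_wpM2l//.
  have [kaP kbP D1P D2P] : [/\ 0 <= P * ka, 0 <= kb, 0 <= D1 & 0 <= D2].
    by rewrite mulr_ge0 ?powR_ge0 ?(ltW od0).
  rewrite mulrDl !mulrDr lerD//; first by rewrite lerDl mulr_ge0.
  by rewrite lerDr mulr_ge0.
have v00 : v 0%N = 0.
  rewrite /v /average (_ : \int[mu]_(y in E 0%N) u y = 0) ?mulr0//.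
  by rewrite /Rintegral integral0_eq// => z Ez; rewrite /= u0.
have xi00 : xi 0%N = 0 by rewrite /xi v00 normr0 mulr0.
have Sxi := HCS xi D _ xi0 (fun i => ltW (D0 i)) xi00 xiS DS J.
have term i : ((rho i `^ (gamma * tau))%:E * \int[mu]_(x in E i) (`|u x| `^ tau)%:E
    <= (2 `^ tau * (D i + cE * xi i `^ tau))%:E)%E.
  have h := integral_powR_le_sub tau1 (mE i) mu_ (muE i) (HD i).
  apply: (le_trans (lee_wpmul2l _ h)); first by rewrite lee_fin powR_ge0.
  rewrite -EFinM lee_fin; apply: ler_of_eq.
  have g0 : 0 < rho i `^ (gamma * tau) by exact: powR_gt0.
  rewrite /xi powRM ?powR_ge0// -powRrM.
  have -> : delta * tau = gamma * tau + d by rewrite /delta; field; rewrite gt_eqF.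
  rewrite powRD; last by rewrite (gt_eqF (rho_gt0 i)) implybT.
  rewrite powRN powR_mulrn ?(ltW (rho_gt0 i))//.
  by field; rewrite gt_eqF.
have h := lee_sum (index_enum 'I_J) (P := xpredT) (fun i _ => term (nat_of_ord i)).
apply: (le_trans h).
rewrite sumEFin lee_fin -mulr_sumr big_split/= -[leRHS]mulrA.
apply: ler_wpM2l; first exact: powR_ge0.
have -> : (CD * 4 + cE * (CS * (CD * 4))) * W = CD * W * 4 + cE * (CS * (CD * W * 4)).
  by ring.
apply: lerD; first exact: DS.
by rewrite -mulr_sumr; apply: ler_wpM2l; first exact: ltW.
Qed.

End shells_estimate.

(** * Weighted norms on the whole space *)

Section euclidean_norm_topology.
Context {R : realType} (n : nat).
Local Notation mu := (lebesgue_rV R n.+1).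
Local Notation V := 'rV[R]_n.+1.

Lemma continuous_enorm : continuous (@enorm R n.+1).
Proof.
move=> x; apply: continuous_comp; last exact: sqrt_continuous.
have H (s : seq 'I_n.+1) : {for x, continuous (fun z : V => \sum_(i <- s) z ord0 i ^+ 2)}.
  elim: s => [|i s IH].
    rewrite (_ : (fun z : V => _) = fun=> 0); first exact: (@cst_continuous V R 0 x).
    by apply/funext => z; rewrite big_nil.
  rewrite (_ : (fun z : V => _) =
      (fun z : V => z ord0 i ^+ 2 + \sum_(j <- s) z ord0 j ^+ 2)); last first.
    by apply/funext => z; rewrite big_cons.
  apply: cvgD IH.
  by apply: (@continuous_comp V R R (fun z => z ord0 i) (fun t => t ^+ 2));
    [exact: coord_continuous|exact: exprn_continuous].
exact: H.
Qed.

Lemma compact_annulus (r r' : R) : compact [set x : V | r <= enorm x <= r'].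
Proof.
apply: (@subclosed_compact _ _ [set v : V | forall i, `[- r', r']%classic (v ord0 i)]).
- have -> : [set x : V | r <= enorm x <= r'] = @enorm R n.+1 @^-1` `[r, r']%classic.
    by apply/seteqP; split => x /=; rewrite in_itv.
  by apply: closed_comp => [x _|]; [exact: continuous_enorm|exact: interval_closed].
- by apply: (@rV_compact R n.+1 (fun=> `[- r', r']%classic)) => i; exact: segment_compact.
- move=> x /= /andP[_ xr] i; rewrite in_itv/= -ler_norml.
  exact: le_trans (le_coord_enorm _ _) xr.
Qed.

Lemma compact_support_enorm (u : V -> R) : compact (closure [set x | u x != 0]) ->
  exists2 M, 0 < M & forall x, M <= enorm x -> u x = 0.
Proof.
move=> cu.
have : compact (@enorm R n.+1 @` closure [set x | u x != 0]).
  by apply: continuous_compact => //; apply: continuous_subspaceT; exact: continuous_enorm.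
move=> /compact_bounded [M [_ /(_ (`|M| + 1))]].
rewrite ltr_pwDr ?ler_norm// => /(_ isT) HM.
exists (`|M| + 2); first by rewrite ltr_wpDl.
move=> x Mx; apply/eqP/negPn/negP => ux.
have : `|enorm x| <= `|M| + 1 by apply: HM; exists x => //; exact: subset_closure.
rewrite ger0_norm ?enorm_ge0//; lra.
Qed.

Lemma near0_enorm (u : V -> R) : (\forall x \near (0 : V), u x = 0) ->
  exists2 e, 0 < e & forall x, enorm x < e -> u x = 0.
Proof.
move=> /nbhs_ballP [e/= e0 He]; exists e => // x xe; apply: He.
split => // i j; rewrite /ball/= mxE sub0r normrN (ord1 i).
exact: le_lt_trans (le_coord_enorm _ _) xe.
Qed.

(** The origin is fixed by doubling, which multiplies measure by [2^d > 1]; a finite measure with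
    this property is 0. *)
Lemma lebesgue_rV_set1_0 : measurable [set (0 : V)] /\ mu [set 0] = 0%E.
Proof.
have E0 : [set (0 : V)] = [set x : V | [set 0] (enorm x)].
  apply/seteqP; split => x /=; last exact: enorm_eq0.
  by move=> ->; rewrite -(scale0r 0) enormZ// mul0r.
have m0 : measurable [set (0 : V)] by rewrite E0; apply: measurable_enorm_preimage.
split => //.
have fin : mu [set 0] \is a fin_num.
  rewrite ge0_fin_numE//; apply: le_lt_trans (lebesgue_rV_ball_fin n.+1 1).
  apply: le_measure; rewrite ?inE//; first exact: measurable_enorm_lt.
  by move=> x -> /=; rewrite -(scale0r 0) enormZ// mul0r.
have := lebesgue_rV_scale (ltr0n R 2) m0.
have -> : [set x : V | [set 0] (2 *: x)] = [set 0].
  apply/seteqP; split => x /=; last by move=> ->; rewrite scaler0.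
  by move/eqP; rewrite scaler_eq0 pnatr_eq0/= => /eqP.
rewrite -(fineK fin) -EFinM => -[] /eqP; rewrite -subr_eq0 -[X in _ - X]mul1r -mulrBl.
rewrite mulf_eq0 subr_eq0 gt_eqF/=; last by rewrite exprn_egt1// ltr1n.
by move=> /eqP ->.
Qed.

(** The profile is [u] along a coordinate ray. Measurability on the punctured space extends across
    the measurable singleton of the origin. *)
Lemma radial_profile (u : V -> R) : radial u -> L1loc (~` [set 0]) u ->
  exists2 phi : R -> R, measurable_fun setT phi & forall x, u x = phi (enorm x).
Proof.
move=> ru [mu_ _]; have [m0 _] := lebesgue_rV_set1_0.
have mU : measurable_fun setT u.
  rewrite -(setvU [set (0 : V)]) measurable_funU//; last exact: measurableC.
  by split => //; exact: measurable_fun_set1.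
pose e1 : V := delta_mx ord0 ord0.
have e1E : enorm e1 = 1.
  rewrite /enorm (bigD1 ord0)//= big1 => [|i i0]; first by rewrite mxE !eqxx expr1n addr0 sqrtr1.
  by rewrite mxE (negbTE i0) andbF expr0n.
exists (fun r => u (r *: e1)).
  apply: (measurableT_comp mU); apply: measurable_fun_rV => i.
  by under eq_fun do rewrite mxE; apply: measurable_funM => //; exact: measurable_cst.
by move=> x; apply: ru; rewrite enormZ ?enorm_ge0// e1E mulr1.
Qed.

Lemma integrable_shell (u : V -> R) (r r' : R) : 0 < r -> L1loc (~` [set 0]) u ->
  mu.-integrable (shell n r r') (EFin \o u).
Proof.
move=> r0 [mu_ Lu].
have [m0 _] := lebesgue_rV_set1_0; have mC := measurableC m0.
have Z : shell n r r' `<=` ~` [set 0].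
  move=> x /= /andP[rx _] x0; move: rx; rewrite x0 -(scale0r 0) enormZ// mul0r.
  by rewrite leNgt r0.
apply/integrableP; split.
  by apply/measurable_EFinP; apply: measurable_funS mu_.
have K0 : [set x : V | r <= enorm x <= r'] `<=` ~` [set 0].
  move=> x /= /andP[rx _] x0; move: rx; rewrite x0 -(scale0r 0) enormZ// mul0r.
  by rewrite leNgt r0.
apply: le_lt_trans (Lu _ K0 (@compact_annulus r r')).
have mK : measurable [set x : V | r <= enorm x <= r'].
  have := @measurable_enorm_preimage R n.+1 `[r, r']%classic (measurable_itv _).
  by congr measurable; apply/seteqP; split => x /=; rewrite in_itv.
apply: ge0_subset_integral => //; first exact: measurable_shell.
  apply/measurable_EFinP; apply: measurableT_comp => //.
  exact: measurable_funS mu_.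
by move=> x /= /andP[-> /ltW].
Qed.

End euclidean_norm_topology.

(** In logarithms the two radii differ by at most [ln L]; the absolute value of [e] makes one
    constant serve both signs of the exponent. *)
Lemma powR_weight_le (R : realType) (r t L e : R) : 0 < r -> 1 < L -> r <= t <= L * r ->
  r `^ e <= L `^ `|e| * t `^ e /\ t `^ e <= L `^ `|e| * r `^ e.
Proof.
move=> r0 L1 /andP[rt tL].
have t0 : 0 < t by exact: lt_le_trans rt.
have L0 : 0 < L by exact: lt_trans L1.
have lrt : ln r <= ln t by rewrite ler_ln.
have ltL : ln t <= ln L + ln r by rewrite -lnM// ler_ln// posrE mulr_gt0.
have H x y : `|x| <= ln L -> 0 <= `|e| -> e * y - e * (y + x) <= `|e| * ln L.
  move=> xL e0; have -> : e * y - e * (y + x) = - (e * x) by ring.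
  by rewrite (le_trans (ler_norm _))// normrN normrM ler_wpM2l.
rewrite !powR_expR// -!expRD !ler_expR; split.
  have := H (ln t - ln r) (ln r); rewrite subrKC => /(_ _ (normr_ge0 _)) h.
  by rewrite -lerBlDr; apply: h; rewrite ler_norml; apply/andP; split; lra.
have := H (ln r - ln t) (ln t); rewrite subrKC => /(_ _ (normr_ge0 _)) h.
by rewrite -lerBlDr; apply: h; rewrite ler_norml; apply/andP; split; lra.
Qed.

(** * Geometric families of shells and frozen weights *)

Section geometric_shells.
Context {R : realType} (n : nat).
Local Notation mu := (lebesgue_rV R n.+1).
Variables (b om : R).
Hypotheses (b1 : 1 < b) (omb : om = b \/ om = b^-1).

Lemma geometric_shells_trivIset (r : R) : 0 < r ->
  trivIset setT (fun i => shell n (r * om ^+ i) (b * (r * om ^+ i))).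
Proof.
move=> r0; have b0 : 0 < b by exact: lt_trans b1.
apply: ltn_trivIset => i j ji; apply/seteqP; split => // x [/= /andP[l1 h1] /andP[l2 h2]].
case: omb => omE; subst om.
- have h : b * (r * b ^+ j) <= r * b ^+ i.
    rewrite mulrCA -exprS; apply: ler_wpM2l; first exact: ltW.
    by apply: ler_weXn2l => //; exact: ltW.
  by move: (lt_le_trans h1 (le_trans h l2)); rewrite ltxx.
- have h : b * (r * b^-1 ^+ i) <= r * b^-1 ^+ j.
    rewrite -(prednK (leq_ltn_trans (leq0n j) ji)) exprS mulrCA mulVKf ?gt_eqF//.
    apply: ler_wpM2l; first exact: ltW.
    apply: ler_wiXn2l; first by rewrite invr_ge0 ltW.
      by rewrite invf_le1// ltW.
    by rewrite -ltnS (ltn_predK ji).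
  by move: (lt_le_trans h2 (le_trans h l1)); rewrite ltxx.
Qed.

(** A shell of ratio [b^2] is the disjoint union of two tiles of ratio [b]. The first halves and the
    second halves form two disjoint families, whence the factor 2. *)
Lemma sum_geometric_shells_le (r : R) (g : 'rV[R]_n.+1 -> \bar R) J : 0 < r ->
    measurable_fun setT g -> (forall x, (0 <= g x)%E) ->
  (\sum_(i < J) \int[mu]_(x in shell n (r * om ^+ i) (b ^+ 2 * (r * om ^+ i))) g x
    <= 2%:E * \int[mu]_x g x)%E.
Proof.
move=> r0 mg g0; have b0 : 0 < b by exact: lt_trans b1.
have om0 : 0 < om by case: omb => ->; rewrite ?invr_gt0.
pose F r i := shell n (r * om ^+ i) (b * (r * om ^+ i)).
have mF r1 i : measurable (F r1 i) by exact: measurable_shell.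
have HF r1 : 0 < r1 -> (\sum_(i < J) \int[mu]_(x in F r1 i) g x <= \int[mu]_x g x)%E.
  move=> r10.
  rewrite -(big_mkord xpredT (fun i => \int[mu]_(x in F r1 i) g x)%E).
  rewrite -(@ge0_integral_bigsetU _ _ _ _ _ (F r1))//.
  - apply: ge0_subset_integral => //.
    by apply: bigsetU_measurable => i _; exact: mF.
  - exact: iota_uniq.
  - by apply: (sub_trivIset _ (geometric_shells_trivIset r10)).
  - exact: measurable_funTS.
have split_shell i : (\int[mu]_(x in shell n (r * om ^+ i) (b ^+ 2 * (r * om ^+ i))) g x =
    \int[mu]_(x in F r i) g x + \int[mu]_(x in F (b * r)%R i) g x)%E.
  have t0 : 0 < r * om ^+ i by rewrite mulr_gt0// exprn_gt0.
  rewrite -ge0_integral_setU//; last 2 first.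
  - exact: measurable_funTS.
  - apply/disj_set2P; apply/seteqP; split => // x [/= /andP[_ h] /andP[l _]].
    by move: l; rewrite leNgt -mulrA h.
  congr (integral _ _ _); rewrite /F -(mulrA b r); move: (r * om ^+ i) t0 => t t0.
  have tb : t <= b * t by rewrite ler_peMl ?ltW.
  have tb2 : b * t <= b ^+ 2 * t by rewrite expr2 -mulrA ler_peMl ?ltW// mulr_gt0.
  apply/seteqP; rewrite /shell; split => x /=.
    move=> /andP[h1 h2]; case: (ltP (enorm x) (b * t)) => h; [left|right] => /=.
      by rewrite h1 ?h.
    by rewrite ?h mulrA -expr2 h2.
  case=> /= /andP[h1 h2].
    by rewrite h1 (lt_le_trans h2).
  by rewrite (le_trans tb)//= expr2 -mulrA.
under eq_bigr do rewrite split_shell.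
rewrite mule_natl mule2n big_split/=; apply: leeD; apply: HF => //.
exact: mulr_gt0.
Qed.

End geometric_shells.

(** The integral of a nonnegative function is a supremum over the simple functions below it, and
    those below [f] are also below [g]. *)
Lemma ge0_le_integral_dominated d (T : measurableType d) (R : realType)
    (mu : {measure set T -> \bar R}) (D : set T) (f g : T -> \bar R) :
    (forall x, D x -> (0 <= f x)%E) -> (forall x, D x -> (f x <= g x)%E) ->
  (\int[mu]_(x in D) f x <= \int[mu]_(x in D) g x)%E.
Proof.
move=> f0 fg; have g0 x : D x -> (0 <= g x)%E by move=> Dx; rewrite (le_trans (f0 x Dx)) ?fg.
rewrite !ge0_integralE//; apply: le_ereal_sup => _ [h hf <-].
exists h => // x; apply: le_trans (hf x) _.
rewrite !patchE; case: ifPn => // /set_mem; exact: fg.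
Qed.

Section weighted_integrals.
Context {R : realType} (n : nat).
Local Notation mu := (lebesgue_rV R n.+1).
Implicit Type u : 'rV[R]_n.+1 -> R.

Definition weighted_integral (t e : R) u : \bar R :=
  (\int[mu]_x (`|enorm x `^ e * u x| `^ t)%:E)%E.

Definition sobolev_integral (s p alpha Lambda : R) u : \bar R :=
  (\int[mu]_y \int[mu]_x
      (`|u x - u y| `^ p * enorm x `^ (alpha * p)
       / enorm (x - y) `^ (n.+1%:R + s * p)
       * chi Lambda (enorm x) (enorm y))%R%:E)%E.

Lemma weighted_integralE t e u x :
  `|enorm x `^ e * u x| `^ t = enorm x `^ (e * t) * `|u x| `^ t.
Proof.
by rewrite normrM (ger0_norm (powR_ge0 _ _)) powRM ?powR_ge0// -powRrM.
Qed.

Lemma measurable_weighted t e u : measurable_fun setT u ->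
  measurable_fun setT (fun x => (`|enorm x `^ e * u x| `^ t)%:E).
Proof.
move=> mu_; apply/measurable_EFinP; apply: (measurableT_comp (measurable_powR _)).
apply: measurableT_comp => //; apply: measurable_funM => //.
by apply: (measurableT_comp (measurable_powR _)); exact: measurable_enorm.
Qed.

Lemma chi_ge0 (L r1 r2 : R) : 0 <= chi L r1 r2.
Proof. by rewrite /chi; case: ifP. Qed.

Lemma measurable_sobolev_integrand (s p alpha L : R) u : measurable_fun setT u ->
  measurable_fun setT (fun z : 'rV[R]_n.+1 * 'rV[R]_n.+1 =>
    (`|u z.1 - u z.2| `^ p * enorm z.1 `^ (alpha * p)
       / enorm (z.1 - z.2) `^ (n.+1%:R + s * p) * chi L (enorm z.1) (enorm z.2))%:E).
Proof.
move=> mu_; have me := @measurable_enorm R n.+1.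
have me1 : measurable_fun setT (fun z : 'rV[R]_n.+1 * 'rV[R]_n.+1 => enorm z.1).
  exact: (measurableT_comp me measurable_fst).
have me2 : measurable_fun setT (fun z : 'rV[R]_n.+1 * 'rV[R]_n.+1 => enorm z.2).
  exact: (measurableT_comp me measurable_snd).
apply/measurable_EFinP; apply: measurable_funM; last first.
  rewrite (_ : (fun z => _) = \1_([set z : 'rV[R]_n.+1 * 'rV[R]_n.+1 |
      L^-1 * enorm z.1 <= enorm z.2] `&` [set z | enorm z.2 <= L * enorm z.1])); last first.
    apply/funext => z; rewrite /chi indicE; case: ifPn => h.
      by rewrite mem_set//=; move/andP: h.
    by rewrite memNset//= => -[h1 h2]; move: h; rewrite h1 h2.
  apply: measurable_indic; apply: measurableI; apply: measurable_set_le => //;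
    by apply: measurable_funM => //; exact: measurable_cst.
apply: measurable_funM.
  apply: measurable_funM; apply: (measurableT_comp (measurable_powR _)) => //.
  apply: measurableT_comp => //.
  apply: measurable_funB; apply: (measurableT_comp mu_);
    [exact: measurable_fst|exact: measurable_snd].
under eq_fun do rewrite -powRN.
apply: (measurableT_comp (measurable_powR _)); apply: (measurableT_comp me).
apply: measurable_fun_rV => i; under eq_fun do rewrite mxE [X in _ + X]mxE.
by apply: measurable_funB; apply: (measurableT_comp (measurable_coord i));
  [exact: measurable_fst|exact: measurable_snd].
Qed.

Variables (b om : R).
Hypotheses (b1 : 1 < b) (omb : om = b \/ om = b^-1).

Let b0 : 0 < b. Proof. exact: lt_trans b1. Qed.
Let om0 : 0 < om. Proof. by case: omb => ->; rewrite ?invr_gt0. Qed.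
Let Lam1 : 1 < b ^+ 2. Proof. by rewrite exprn_egt1. Qed.

Lemma sum_weighted_shells_le (r t e : R) u J : 0 < r -> measurable_fun setT u ->
  (\sum_(i < J) ((r * om ^+ i) `^ (e * t))%:E *
     \int[mu]_(x in shell n (r * om ^+ i) (b ^+ 2 * (r * om ^+ i))) (`|u x| `^ t)%:E
   <= (2 * (b ^+ 2) `^ `|e * t|)%:E * weighted_integral t e u)%E.
Proof.
move=> r0 mu_; have mw := measurable_weighted t e mu_.
set K := (b ^+ 2) `^ _.
have K0 : 0 <= K by exact: powR_ge0.
apply: (@le_trans _ _ (\sum_(i < J) (K%:E *
   \int[mu]_(x in shell n (r * om ^+ i) (b ^+ 2 * (r * om ^+ i)))
     (`|enorm x `^ e * u x| `^ t)%:E))%E).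
  apply: lee_sum => i _; have t0 : 0 < r * om ^+ i by rewrite mulr_gt0// exprn_gt0.
  have mE : measurable (shell n (r * om ^+ i) (b ^+ 2 * (r * om ^+ i))) by exact: measurable_shell.
  have mw' := measurable_funTS (D := shell n (r * om ^+ i) (b ^+ 2 * (r * om ^+ i))) mw.
  have mut : measurable_fun (shell n (r * om ^+ i) (b ^+ 2 * (r * om ^+ i)))
      (fun x => (`|u x| `^ t)%:E).
    apply: measurable_funTS; apply/measurable_EFinP.
    by apply: (measurableT_comp (measurable_powR _)); exact: measurableT_comp.
  rewrite -!ge0_integralZl_EFin ?powR_ge0//; try by move=> x _; rewrite lee_fin powR_ge0.
  apply: ge0_le_integral_dominated => x Ex; rewrite -EFinM lee_fin.
    by rewrite mulr_ge0 ?powR_ge0.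
  rewrite weighted_integralE mulrA ler_wpM2r ?powR_ge0//.
  have := @powR_weight_le R _ (enorm x) (b ^+ 2) (e * t) t0 Lam1.
  by case; move: Ex => //= /andP[-> /ltW ->].
rewrite -ge0_sume_distrr; last by move=> i _; apply: integral_ge0 => x _; rewrite lee_fin powR_ge0.
rewrite [2 * K]mulrC EFinM -muleA; apply: lee_wpmul2l; first by rewrite lee_fin.
by apply: sum_geometric_shells_le => // x; rewrite lee_fin powR_ge0.
Qed.

Lemma sum_shell_seminorms_le (s p alpha r : R) u J : 0 < r -> measurable_fun setT u ->
  (\sum_(i < J) ((r * om ^+ i) `^ (alpha * p))%:E * shell_seminorm p s (b ^+ 2) (r * om ^+ i) u
   <= (2 * (b ^+ 2) `^ `|alpha * p|)%:E * sobolev_integral s p alpha (b ^+ 2) u)%E.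
Proof.
move=> r0 mu_; have mG := measurable_sobolev_integrand s p alpha (b ^+ 2) mu_.
set K := (b ^+ 2) `^ _.
have K0 : 0 <= K by exact: powR_ge0.
set G := (fun z => _) in mG.
have G0 z : (0 <= G z)%E by rewrite lee_fin !mulr_ge0 ?invr_ge0 ?powR_ge0 ?chi_ge0.
pose g y := (\int[mu]_x G (x, y))%E.
have g0 y : (0 <= g y)%E by exact: integral_ge0.
have mg : measurable_fun setT g by exact: (measurable_fun_fubini_tonelli_G (m1 := mu) G mG G0).
apply: (@le_trans _ _ (\sum_(i < J) (K%:E *
   \int[mu]_(y in shell n (r * om ^+ i) (b ^+ 2 * (r * om ^+ i))) g y))%E).
  apply: lee_sum => i _; have t0 : 0 < r * om ^+ i by rewrite mulr_gt0// exprn_gt0.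
  set rho := r * om ^+ i in t0 *.
  have w0 : 0 < rho `^ (alpha * p) by exact: powR_gt0.
  have mE : measurable (shell n rho (b ^+ 2 * rho)) by exact: measurable_shell.
  suff main : (shell_seminorm p s (b ^+ 2) rho u <=
      ((rho `^ (alpha * p))^-1 * K)%:E * \int[mu]_(y in shell n rho (b ^+ 2 * rho)) g y)%E.
    have w0' : (0 <= (rho `^ (alpha * p))%:E)%E by rewrite lee_fin ltW.
    apply: (le_trans (lee_wpmul2l w0' main)).
    by rewrite muleA -EFinM mulrA divff ?mul1r// gt_eqF.
  rewrite -ge0_integralZl_EFin//; last 2 first.
  - exact: measurable_funTS.
  - by rewrite mulr_ge0// invr_ge0 ltW.
  rewrite /shell_seminorm; apply: ge0_le_integral_dominated => y Ey.
    by apply: integral_ge0 => x _; rewrite lee_fin divr_ge0 ?powR_ge0.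
  have mGy : measurable_fun setT (fun x => G (x, y)).
    by apply: (measurableT_comp mG); exact: measurable_pair2.
  rewrite -ge0_integralZl_EFin//; last by rewrite mulr_ge0// invr_ge0 ltW.
  rewrite [leLHS]integral_mkcond; apply: ge0_le_integral_dominated => x _.
    by rewrite patchE; case: ifP => // _; rewrite lee_fin divr_ge0 ?powR_ge0.
  have c0 : 0 <= (rho `^ (alpha * p))^-1 * K by rewrite mulr_ge0// invr_ge0 ltW.
  rewrite patchE; case: ifPn => [/set_mem Ex|_]; last by rewrite mule_ge0.
  rewrite /G/= /chi.
  have [/andP[x1 x2] /andP[y1 y2]] := (Ex, Ey).
  have b2 : 0 < b ^+ 2 by rewrite exprn_gt0.
  rewrite ifT; last first.
    rewrite ler_pdivrMl// (le_trans (ltW x2)) ?ler_wpM2l ?(ltW b2)//=.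
    by rewrite (le_trans (ltW y2)) ?ler_wpM2l ?(ltW b2).
  rewrite mulr1 -EFinM lee_fin.
  have [h _] : rho `^ (alpha * p) <= K * enorm x `^ (alpha * p) /\
      enorm x `^ (alpha * p) <= K * rho `^ (alpha * p).
    by apply: powR_weight_le => //; rewrite x1 ltW.
  set P := `|u x - u y| `^ p; set Q := (_ `^ _)^-1.
  have -> : (rho `^ (alpha * p))^-1 * K * (P * enorm x `^ (alpha * p) * Q) =
    P * Q * (K * enorm x `^ (alpha * p) / rho `^ (alpha * p)) by ring.
  rewrite ler_peMr ?mulr_ge0 ?invr_ge0 ?powR_ge0//.
  by rewrite ler_pdivlMr// mul1r.
rewrite -ge0_sume_distrr; last by move=> i _; exact: integral_ge0.
rewrite [2 * K]mulrC EFinM -muleA; apply: lee_wpmul2l; first by rewrite lee_fin.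
exact: sum_geometric_shells_le.
Qed.

End weighted_integrals.

Section weighted_estimate.
Context {R : realType} (n : nat).
Local Notation mu := (lebesgue_rV R n.+1).
Variables (b om : R).
Hypotheses (b1 : 1 < b) (omb : om = b \/ om = b^-1).

Let b0 : 0 < b. Proof. exact: lt_trans b1. Qed.
Let om0 : 0 < om. Proof. by case: omb => ->; rewrite ?invr_gt0. Qed.
Let Lam1 : 1 < b ^+ 2. Proof. by rewrite exprn_egt1. Qed.

(** The tiles of ratio [b] are disjoint and carry the whole integral, the origin being null. On each
    of them the weight is frozen at its inner radius, and the tile is then enlarged to the shell of
    ratio [b^2] for which estimates are available. *)
Lemma weighted_integral_le_shells (r t e B : R) (u : 'rV[R]_n.+1 -> R) : 0 < r ->
    measurable_fun setT u ->
    (forall x, x != 0 -> u x != 0 ->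
      exists i, shell n (r * om ^+ i) (b * (r * om ^+ i)) x) -> t != 0 ->
    (forall J, \sum_(i < J) ((r * om ^+ i) `^ (e * t))%:E *
       \int[mu]_(x in shell n (r * om ^+ i) (b ^+ 2 * (r * om ^+ i))) (`|u x| `^ t)%:E
     <= B%:E)%E ->
  (weighted_integral t e u <= ((b ^+ 2) `^ `|e * t| * B)%:E)%E.
Proof.
move=> r0 mu_ cov tn0 HB; have mw := measurable_weighted t e mu_.
have [m0 mu0] := @lebesgue_rV_set1_0 R n.
set K := (b ^+ 2) `^ _.
have K0 : 0 <= K by exact: powR_ge0.
pose f (x : 'rV[R]_n.+1) := (`|enorm x `^ e * u x| `^ t)%:E.
have f0 x : (0 <= f x)%E by rewrite lee_fin powR_ge0.
pose F i := shell n (r * om ^+ i) (b * (r * om ^+ i)).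
have mF i : measurable (F i) by exact: measurable_shell.
have mU : measurable (\bigcup_i F i) by exact: bigcup_measurable.
rewrite /weighted_integral (ge0_negligible_integral m0 measurableT mw)//.
apply: (@le_trans _ _ (\int[mu]_(x in \bigcup_i F i) f x)%E).
  rewrite [leLHS]integral_mkcond [leRHS]integral_mkcond.
  apply: ge0_le_integral_dominated => x _.
    by rewrite patchE; case: ifP => // _; exact: f0.
  rewrite !patchE; case: ifPn => [/set_mem[_ /= x0]|_]; last by case: ifP.
  case: ifPn => // /negP xU.
  have [->|ux] := eqVneq (u x) 0; first by rewrite mulr0 normr0 powR0.
  have /cov[//|i Fi] : x != 0 by apply/eqP.
  by exfalso; apply: xU; apply/mem_set; exists i.
rewrite ge0_integral_bigcup//; last 2 first.
- exact: measurable_funTS.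
- exact: geometric_shells_trivIset.
apply: nneseries_le => [i|J]; first by apply: integral_ge0.
apply: (@le_trans _ _ (\sum_(i < J) (K%:E * (((r * om ^+ i) `^ (e * t))%:E *
   \int[mu]_(x in shell n (r * om ^+ i) (b ^+ 2 * (r * om ^+ i))) (`|u x| `^ t)%:E)))%E).
  apply: lee_sum => i _; have t0 : 0 < r * om ^+ i by rewrite mulr_gt0// exprn_gt0.
  have mE : measurable (shell n (r * om ^+ i) (b ^+ 2 * (r * om ^+ i))) by exact: measurable_shell.
  have mut : measurable_fun (shell n (r * om ^+ i) (b ^+ 2 * (r * om ^+ i)))
      (fun x => (`|u x| `^ t)%:E).
    apply: measurable_funTS; apply/measurable_EFinP.
    by apply: (measurableT_comp (measurable_powR _)); exact: measurableT_comp.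
  rewrite muleA -EFinM -ge0_integralZl_EFin ?mulr_ge0 ?powR_ge0//;
    try by move=> x _; rewrite lee_fin powR_ge0.
  rewrite [leLHS]integral_mkcond [leRHS]integral_mkcond.
  apply: ge0_le_integral_dominated => x _.
    by rewrite patchE; case: ifP => // _; exact: f0.
  rewrite !patchE; case: ifPn => [/set_mem/= /andP[h1 h2]|_]; last first.
    by case: ifP => // _; rewrite -EFinM lee_fin !mulr_ge0 ?powR_ge0.
  have h4 : enorm x < b ^+ 2 * (r * om ^+ i).
    rewrite expr2 -mulrA (lt_trans h2)// ltr_pMl//; exact: (mulr_gt0 b0 t0).
  have h3 := ltW h4.
  rewrite ifT; last by apply/mem_set; rewrite /shell/= h1 h4.
  rewrite -EFinM lee_fin weighted_integralE ler_wpM2r ?powR_ge0//.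
  have := @powR_weight_le R _ (enorm x) (b ^+ 2) (e * t) t0 Lam1.
  by rewrite h1 h3 => -[].
rewrite -ge0_sume_distrr; last first.
  move=> i _; rewrite mule_ge0 ?lee_fin ?powR_ge0//.
  by apply: integral_ge0 => x _; rewrite lee_fin powR_ge0.
by rewrite EFinM; apply: lee_wpmul2l; rewrite ?lee_fin.
Qed.

End weighted_estimate.

(** The weight is positive off the null origin, so either integral vanishes exactly when [u] is 0
    almost everywhere. *)
Lemma weighted_integral_eq0 (R : realType) (n : nat) (t e t' e' : R)
    (u : 'rV[R]_n.+1 -> R) : measurable_fun setT u -> t' != 0 ->
  weighted_integral t e u = 0%E -> weighted_integral t' e' u = 0%E.
Proof.
move=> mu_ t'0 H; have [m0 mu0] := @lebesgue_rV_set1_0 R n.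
have aenz : {ae lebesgue_rV R n.+1, forall x, x != 0}.
  by exists [set 0]; split => // x /= /negP; rewrite negbK => /eqP.
have mw := measurable_weighted t e mu_; have mw' := measurable_weighted t' e' mu_.
have H0 : ae_eq (lebesgue_rV R n.+1) setT (fun x => (`|enorm x `^ e * u x| `^ t)%:E) (cst 0%E).
  apply/(ae_eq_integral_abs _ measurableT mw); rewrite -[RHS]H; apply: eq_integral => x _.
  by rewrite gee0_abs// lee_fin powR_ge0.
rewrite /weighted_integral.
have -> : (\int[lebesgue_rV R n.+1]_x (`|enorm x `^ e' * u x| `^ t')%:E =
    \int[lebesgue_rV R n.+1]_x `|(`|enorm x `^ e' * u x| `^ t')%:E|)%E.
  by apply: eq_integral => x _; rewrite gee0_abs// lee_fin powR_ge0.
apply/(ae_eq_integral_abs _ measurableT mw').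
apply: filterS2 H0 aenz => x /(_ I) + x0 _ /=; rewrite weighted_integralE => -[] /eqP.
have ex0 : 0 < enorm x.
  by rewrite lt_neqAle enorm_ge0 andbT eq_sym; apply/eqP => /enorm_eq0/eqP; exact/negP.
rewrite mulf_eq0 powR_eq0 (gt_eqF ex0)/= powR_eq0 normr_eq0 => /andP[/eqP -> _].
by rewrite mulr0 normr0 powR0.
Qed.

Section weighted_gagliardo_nirenberg.
Context {R : realType} (n : nat).
Local Notation mu := (lebesgue_rV R n.+1).
Local Notation d := (n.+1%:R : R).
Variables (b om : R).
Hypotheses (b1 : 1 < b) (omb : om = b \/ om = b^-1).

Let b0 : 0 < b. Proof. exact: lt_trans b1. Qed.
Let om0 : 0 < om. Proof. by case: omb => ->; rewrite ?invr_gt0. Qed.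
Let Lam1 : 1 < b ^+ 2. Proof. by rewrite exprn_egt1. Qed.

(** Neighbouring shells of ratio [b^2] share the tile starting at [b rho] when the radii grow, and
    at [rho] when they shrink. *)
Let ex_w : exists w, [/\ 1 <= w, om <= w, w <= b & w <= b * om].
Proof.
case: omb => ->; [exists b|exists 1]; split; rewrite ?(ltW b1)//.
- by rewrite ler_peMl// ltW.
- by rewrite invf_le1// ltW.
- by rewrite divff// gt_eqF.
Qed.

(** The common form of the two support conditions: [u] vanishes on the first shell of ratio [b^2],
    which starts the recursion at 0, and the tiles of ratio [b] reach every nonzero point where [u]
    is nonzero. *)
Definition shellwise_admissible (r : R) (u : 'rV[R]_n.+1 -> R) := [/\ 0 < r,
  exists2 phi : R -> R, measurable_fun setT phi & forall x, u x = phi (enorm x),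
  forall i, mu.-integrable (shell n (r * om ^+ i) (b ^+ 2 * (r * om ^+ i))) (EFin \o u),
  forall x, shell n r (b ^+ 2 * r) x -> u x = 0 &
  forall x, x != 0 -> u x != 0 ->
    exists i, shell n (r * om ^+ i) (b * (r * om ^+ i)) x].

Variables (p q tau s a alpha beta gamma : R).
Hypotheses (p1 : 1 < p) (q1 : 1 <= q) (tau1 : 1 <= tau) (s0 : 0 < s).
Hypothesis contr : om `^ (gamma + d / tau) < 1.

Lemma weighted_integral_le (ha : 0 < a <= 1)
    (kappa_le : a * (p^-1 - s) + (1 - a) / q <= tau^-1)
    (tau_le : tau^-1 <= a / p + (1 - a) / q)
    (balance : tau^-1 + gamma / d =
       a * (p^-1 + (alpha - s) / d) + (1 - a) * (q^-1 + beta / d)) :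
  exists2 C : R, 0 < C & forall r u N Q, shellwise_admissible r u -> 0 < N -> 0 < Q ->
    (sobolev_integral s p alpha (b ^+ 2) u <= N%:E)%E ->
    (a < 1 -> (weighted_integral q beta u <= Q%:E)%E) ->
  (weighted_integral tau gamma u <=
    (C * expR (tau * (a / p * ln N + (1 - a) / q * ln Q)))%:E)%E.
Proof.
have [w [w1 wom wb wbom]] := ex_w.
have tau0 : tau != 0 by rewrite gt_eqF// (lt_le_trans _ tau1).
have [C0 C00 HC] := shells_estimate p1 q1 tau1 s0 ha kappa_le tau_le balance b1
  (erefl (b ^+ 2)) om0 w1 wom wb wbom contr.
pose K1 : R := 2 * (b ^+ 2) `^ `|alpha * p|; pose K2 : R := 2 * (b ^+ 2) `^ `|beta * q|.
have K10 : 0 < K1 by rewrite mulr_gt0// powR_gt0// exprn_gt0.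
have K20 : 0 < K2 by rewrite mulr_gt0// powR_gt0// exprn_gt0.
exists ((b ^+ 2) `^ `|gamma * tau| *
   (C0 * expR (tau * (a / p * ln K1 + (1 - a) / q * ln K2)))).
  by rewrite !mulr_gt0// ?expR_gt0// powR_gt0// exprn_gt0.
move=> r u N Q [r0 [phi mphi uphi] intu u0 cov] N0 Q0 SN SQ.
have uE : u = (fun x => phi (enorm x)) by exact/funext.
clear uphi; subst u.
have mu_ : measurable_fun setT (fun x : 'rV[R]_n.+1 => phi (enorm x)).
  exact: (measurableT_comp mphi (@measurable_enorm R n.+1)).
have KN : 0 < K1 * N by exact: mulr_gt0.
have KQ : 0 < K2 * Q by exact: mulr_gt0.
have h0 x : shell n (r * om ^+ 0) (b ^+ 2 * (r * om ^+ 0)) x -> phi (enorm x) = 0.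
  by rewrite expr0 mulr1; exact: u0.
have HH := HC r phi _ _ r0 mphi intu h0 KN KQ.
apply: (le_trans (weighted_integral_le_shells b1 omb r0 mu_ cov tau0 (HH _ _))).
- move=> J; apply: (le_trans (sum_shell_seminorms_le b1 omb s p alpha J r0 mu_)).
  by rewrite [leRHS]EFinM; apply: lee_wpmul2l => //; rewrite lee_fin ltW.
- move=> a1 J; apply: (le_trans (sum_weighted_shells_le b1 omb q beta J r0 mu_)).
  by rewrite [leRHS]EFinM; apply: lee_wpmul2l; [rewrite lee_fin ltW|exact: SQ].
rewrite lee_fin (_ : ln (K1 * N) = ln K1 + ln N); last by rewrite lnM.
rewrite (_ : ln (K2 * Q) = ln K2 + ln Q); last by rewrite lnM.
have -> : tau * (a / p * (ln K1 + ln N) + (1 - a) / q * (ln K2 + ln Q)) =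
  tau * (a / p * ln K1 + (1 - a) / q * ln K2) + tau * (a / p * ln N + (1 - a) / q * ln Q).
  by ring.
by rewrite expRD !mulrA.
Qed.

(** A zero seminorm has no logarithm. All shell seminorms then vanish, so their weighted sums lie
    below every [N > 0] for any choice of weight. The shell estimate with [a = 1] and [tau = p]
    bounds a weighted integral by a multiple of [N], so that integral is 0, and
    [weighted_integral_eq0] passes to the original exponents. *)
Lemma weighted_integral_eq0_of_sobolev r u : shellwise_admissible r u ->
  sobolev_integral s p alpha (b ^+ 2) u = 0%E -> weighted_integral tau gamma u = 0%E.
Proof.
move=> [r0 [phi mphi uphi] intu u0 cov] S0.
have [w [w1 wom wb wbom]] := ex_w.
have tau0 : tau != 0 by rewrite gt_eqF// (lt_le_trans _ tau1).
have p0 : 0 < p by exact: lt_trans p1.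
have d0 : 0 < d by rewrite ltr0n.
have uE : u = (fun x => phi (enorm x)) by exact/funext.
clear uphi; subst u.
have mu_ : measurable_fun setT (fun x : 'rV[R]_n.+1 => phi (enorm x)).
  exact: (measurableT_comp mphi (@measurable_enorm R n.+1)).
(* [gamma'] leaves the contraction exponent unchanged, [gamma' + d / p = gamma + d / tau];
   [alpha' = gamma' + s] is the balance condition for [a = 1] and [tau = p]. *)
pose gamma' := gamma + d / tau - d / p; pose alpha' := gamma' + s.
have one01 : 0 < (1 : R) <= 1 by rewrite ltr01 lexx.
have kap : 1 * (p^-1 - s) + (1 - 1) / 1 <= p^-1 by move: (s0) => ?; lra.
have tl : p^-1 <= 1 / p + (1 - 1) / 1 by lra.
have bal : p^-1 + gamma' / d = 1 * (p^-1 + (alpha' - s) / d) + (1 - 1) * (1^-1 + 0 / d).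
  by rewrite subrr mul0r addr0 mul1r /alpha' addrK.
have ctr : om `^ (gamma' + d / p) < 1 by rewrite /gamma' subrK.
have [C0 C00 HC] := shells_estimate p1 (lexx 1) (ltW p1) s0 one01 kap tl bal b1
  (erefl (b ^+ 2)) om0 w1 wom wb wbom ctr.
have Sge0 i : (0 <= shell_seminorm p s (b ^+ 2) (r * om ^+ i)
  (fun x : 'rV[R]_n.+1 => phi (enorm x)))%E.
  rewrite /shell_seminorm; apply: integral_ge0 => y _; apply: integral_ge0 => x _.
  by rewrite lee_fin divr_ge0 ?powR_ge0.
have Si0 i : shell_seminorm p s (b ^+ 2) (r * om ^+ i) (fun x : 'rV[R]_n.+1 => phi (enorm x)) = 0%E.
  have rho0 : 0 < (r * om ^+ i) `^ (alpha * p) by rewrite powR_gt0// mulr_gt0// exprn_gt0.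
  have := sum_shell_seminorms_le b1 omb s p alpha i.+1 r0 mu_.
  rewrite S0 mule0 big_ord_recr/= => h; apply/eqP; rewrite eq_le Sge0 andbT.
  rewrite -(@lee_pmul2l _ ((r * om ^+ i) `^ (alpha * p))%:E)// mule0.
  apply: le_trans h; rewrite leeDr// sume_ge0// => j _.
  by rewrite mule_ge0// lee_fin powR_ge0.
suff : weighted_integral p gamma' (fun x : 'rV[R]_n.+1 => phi (enorm x)) = 0%E.
  exact: weighted_integral_eq0.
apply/eqP; rewrite eq_le; apply/andP; split; last first.
  by apply: integral_ge0 => x _; rewrite lee_fin powR_ge0.
set K := (b ^+ 2) `^ `|gamma' * p|.
have K0 : 0 < K by rewrite powR_gt0// exprn_gt0.
have bnd N : 0 < N -> (weighted_integral p gamma'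
  (fun x : 'rV[R]_n.+1 => phi (enorm x)) <= (K * (C0 * N))%:E)%E.
  move=> N0; apply: (weighted_integral_le_shells b1 omb r0 mu_ cov); first by rewrite gt_eqF.
  move=> J; have := HC r phi N 1 r0 mphi => /(_ intu).
  have h0 x : shell n (r * om ^+ 0) (b ^+ 2 * (r * om ^+ 0)) x -> phi (enorm x) = 0.
    by rewrite expr0 mulr1; exact: u0.
  move=> /(_ h0 N0 ltr01) H; apply: (le_trans (H _ _ J)).
  - by move=> I; rewrite big1 ?lee_fin ?ltW// => i _; rewrite Si0 mule0.
  - by rewrite ltxx.
  rewrite subrr !mul0r addr0 mul1r mulrA divff ?gt_eqF// mul1r lnK ?posrE//.
apply/lee_addgt0Pr => e e0; rewrite add0e.
have := bnd (e / (K * C0)); rewrite divr_gt0 ?mulr_gt0// => /(_ isT).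
by rewrite mulrA mulrC divfK// gt_eqF// mulr_gt0.
Qed.

End weighted_gagliardo_nirenberg.

Lemma weighted_LnormE (R : realType) (n : nat) (t e : R) (u : 'rV[R]_n.+1 -> R) :
  weighted_Lnorm t e u = (weighted_integral t e u `^ t^-1%R)%E.
Proof. by rewrite /weighted_Lnorm Lnorm.unlock. Qed.

(* Takes care of the conventions on [0] and [+oo] in the product. *)
Lemma poweR_product_le (R : realType) (p q tau a C : R) (S T I : \bar R) :
    0 < p -> 0 < q -> 0 < tau -> 0 < a <= 1 -> 0 < C ->
    (0 <= S)%E -> (0 <= T)%E -> (0 <= I)%E ->
    (S = 0%E -> I = 0%E) -> (a < 1 -> T = 0%E -> I = 0%E) ->
    (forall N Q : R, 0 < N -> 0 < Q -> (S <= N%:E)%E -> (a < 1 -> (T <= Q%:E)%E) ->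
      (I <= (C * expR (tau * (a / p * ln N + (1 - a) / q * ln Q)))%:E)%E) ->
  (I `^ tau^-1%R <=
    (C `^ tau^-1)%:E * (S `^ p^-1%R) `^ a * (T `^ q^-1%R) `^ (1 - a)%R)%E.
Proof.
move=> p0 q0 tau0 /andP[a0 a1] C0 S0 T0 I0 SI0 TI0 HC.
have Cp : (0 < (C `^ tau^-1)%:E)%E by rewrite lte_fin powR_gt0.
have I_eq0 : I = 0%E -> (I `^ tau^-1%R <=
    (C `^ tau^-1)%:E * (S `^ p^-1%R) `^ a * (T `^ q^-1%R) `^ (1 - a)%R)%E.
  move=> ->; rewrite poweR0r ?invr_eq0 ?gt_eqF//.
  by rewrite !mule_ge0 ?poweR_ge0// ltW.
have [SE|Sn0] := eqVneq S 0%E.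
  by apply: I_eq0; exact: SI0.
have Sgt0 : (0 < S)%E by rewrite lt0e Sn0.
have SS : (0 < (S `^ p^-1%R) `^ a)%E by rewrite !poweR_gt0.
have [TE|Tn0] := boolP ((a < 1) && (T == 0%E)).
  by apply: I_eq0; case/andP: TE => a1' /eqP; exact: TI0.
have TT : (0 < (T `^ q^-1%R) `^ (1 - a)%R)%E.
  move: a1; rewrite le_eqVlt => /predU1P[->|a1]; first by rewrite subrr poweRe0.
  by move: Tn0; rewrite a1 andTb => Tn0; do 2!apply: poweR_gt0; rewrite lt0e Tn0.
have [SE|Sfin] := eqVneq S +oo%E.
  rewrite SE !poweRyr ?invr_eq0 ?gt_eqF//.
  by rewrite gt0_muley// gt0_mulye// leey.
have [TE|Tfin] := boolP ((a < 1) && (T == +oo%E)).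
  case/andP: TE => a1' /eqP TE.
  rewrite TE [((+oo%E) `^ _)%E]poweRyr ?invr_eq0 ?gt_eqF// [((+oo%E) `^ (1 - a)%R)%E]poweRyr.
    by rewrite gt0_muley ?leey// mule_gt0.
  by rewrite subr_eq0 gt_eqF.
have SN : S = (fine S)%:E by rewrite fineK// ge0_fin_numE// lt_neqAle Sfin leey.
have N0 : 0 < fine S by rewrite -lte_fin -SN.
(* For [a = 1] the last factor is a power with exponent 0, equal to 1 even if [T] is infinite;
   [Q = 1] is a placeholder. *)
have [Q [Q0 TQ TQE]] : exists Q : R, [/\ 0 < Q, a < 1 -> (T <= Q%:E)%E &
    ((T `^ q^-1%R) `^ (1 - a)%R = (expR ((1 - a) / q * ln Q))%:E)%E].
  move: a1; rewrite le_eqVlt => /predU1P[->|a1].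
    by exists 1; split; rewrite ?ltxx// subrr !mul0r expR0 poweRe0.
  move: Tn0 Tfin; rewrite a1 andTb => Tn0 Tfin.
  have TE : T = (fine T)%:E by rewrite fineK// ge0_fin_numE// lt_neqAle Tfin leey.
  have T0' : 0 < fine T by rewrite -lte_fin -TE lt0e Tn0.
  exists (fine T); split => //; first by rewrite -TE.
  rewrite [in LHS]TE; move: (fine T) T0' => t t0; rewrite !poweR_EFin -powRrM powR_expR//.
  by rewrite [q^-1 * _]mulrC.
have SNle : (S <= (fine S)%:E)%E by rewrite -SN.
have HI := HC _ Q N0 Q0 SNle TQ.
rewrite TQE SN !poweR_EFin -!EFinM.
have inv0 : 0 <= tau^-1 by rewrite invr_ge0 ltW.
apply: (le_trans (gt0_ler_poweR inv0 _ _ HI)).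
- by rewrite in_itv/= I0 leey.
- by rewrite in_itv/= leey andbT lee_fin mulr_ge0 ?expR_ge0 ?(ltW C0).
rewrite poweR_EFin lee_fin powRM ?expR_ge0 ?(ltW C0)//; apply: ler_of_eq.
rewrite -[RHS]mulrA; congr (_ * _).
rewrite (powR_expR _ (expR_gt0 _)) expRK -powRrM powR_expR// -expRD; congr expR.
by field; rewrite !gt_eqF.
Qed.

Section norm_inequality.
Context {R : realType} (n : nat).
Local Notation d := (n.+1%:R : R).
Variables (b om : R).
Hypotheses (b1 : 1 < b) (omb : om = b \/ om = b^-1).
Variables (p q tau s a alpha beta gamma : R).
Hypotheses (p1 : 1 < p) (q1 : 1 <= q) (tau1 : 1 <= tau) (s0 : 0 < s).
Hypotheses (ha : 0 < a <= 1).
Hypothesis kappa_le : a * (p^-1 - s) + (1 - a) / q <= tau^-1.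
Hypothesis tau_le : tau^-1 <= a / p + (1 - a) / q.
Hypothesis balance : tau^-1 + gamma / d =
  a * (p^-1 + (alpha - s) / d) + (1 - a) * (q^-1 + beta / d).
Hypothesis contr : om `^ (gamma + d / tau) < 1.

Lemma weighted_Lnorm_le : exists2 C : R, 0 < C & forall r u, shellwise_admissible b om r u ->
  (weighted_Lnorm tau gamma u <=
     C%:E * (@sobolev_seminorm R n.+1 setT s p alpha (b ^+ 2) u) `^ a
          * (weighted_Lnorm q beta u) `^ (1 - a)%R)%E.
Proof.
have p0 : 0 < p by exact: lt_trans p1.
have q0 : 0 < q by exact: lt_le_trans q1.
have tau0 : 0 < tau by exact: lt_le_trans tau1.
have [a0 a1] := andP ha.
have [C C0 HC] := weighted_integral_le b1 omb p1 q1 tau1 s0 contr ha kappa_le tau_le balance.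
exists (C `^ tau^-1) => [|r u adm]; first exact: powR_gt0.
have [_ [phi mphi uphi] _ _ _] := adm.
have mu_ : measurable_fun setT u.
  rewrite (_ : u = (fun x => phi (enorm x))); last exact/funext.
  exact: (measurableT_comp mphi (@measurable_enorm R n.+1)).
rewrite !weighted_LnormE /sobolev_seminorm.
rewrite -[X in (X `^ p^-1%R)%E]/(sobolev_integral s p alpha (b ^+ 2) u).
set S := sobolev_integral _ _ _ _ _; set T := weighted_integral q beta u.
set I := weighted_integral tau gamma u.
have S0 : (0 <= S)%E.
  apply: integral_ge0 => y _; apply: integral_ge0 => x _.
  by rewrite lee_fin !mulr_ge0 ?invr_ge0 ?powR_ge0 ?chi_ge0.
have T0 : (0 <= T)%E by apply: integral_ge0 => x _; rewrite lee_fin powR_ge0.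
have I0 : (0 <= I)%E by apply: integral_ge0 => x _; rewrite lee_fin powR_ge0.
have SI0 : S = 0%E -> I = 0%E.
  exact: (weighted_integral_eq0_of_sobolev b1 omb p1 tau1 s0 contr adm).
have TI0 : a < 1 -> T = 0%E -> I = 0%E.
  by move=> _; apply: weighted_integral_eq0 => //; rewrite gt_eqF.
have HI N Q := HC r u N Q adm.
exact: (poweR_product_le p0 q0 tau0 ha C0 S0 T0 I0 SI0 TI0 HI).
Qed.

End norm_inequality.

(** * The two support conditions and the conclusion *)

Lemma exists_switch (P : pred nat) : (exists k, P k) -> ~~ P 0%N ->
  exists k, ~~ P k /\ P k.+1.
Proof.
move=> exP P0; case: (ex_minnP exP) => -[|k] Pk mink; first by rewrite Pk in P0.
by exists k; split => //; apply/negP => /mink; rewrite ltnn.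
Qed.

Lemma exprn_unbounded (R : realType) (b y : R) : 1 < b -> exists k, y < b ^+ k.
Proof.
move=> b1; have b0 : 0 < b by exact: lt_trans b1.
have lb : 0 < ln b by rewrite ln_gt0.
exists (Num.truncn (`|y| / ln b)).+1.
have -> : b ^+ (Num.truncn (`|y| / ln b)).+1 = expR ((Num.truncn (`|y| / ln b)).+1%:R * ln b).
  by rewrite -powR_mulrn ?(ltW b0)// powR_expR.
apply: lt_le_trans (expR_ge1Dx _); rewrite (le_lt_trans (ler_norm y))//.
have : `|y| < (Num.truncn (`|y| / ln b)).+1%:R * ln b.
  by rewrite -ltr_pdivrMr// truncnS_gt.
by move/lt_le_trans; apply; rewrite lerDr.
Qed.

Section admissibility.
Context {R : realType} (n : nat).
Variables (b : R).
Hypotheses (b1 : 1 < b).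
Variable u : 'rV[R]_n.+1 -> R.
Hypotheses (ru : radial u) (Lu : L1loc (~` [set 0]) u).

Let b0 : 0 < b. Proof. exact: lt_trans b1. Qed.

Let enorm_gt0 (x : 'rV[R]_n.+1) : x != 0 -> 0 < enorm x.
Proof.
move=> x0; rewrite lt_neqAle enorm_ge0 andbT eq_sym; apply/eqP => /enorm_eq0/eqP.
exact/negP.
Qed.

(** The starting radius [M] bounds the support, so the first shell lies outside it; the radii then
    shrink towards the origin. *)
Lemma compact_support_admissible : compact (closure [set x | u x != 0]) ->
  exists r, shellwise_admissible b b^-1 r u.
Proof.
move=> /compact_support_enorm[M M0 uM]; exists M; split => //.
- exact: radial_profile.
- move=> i; apply: integrable_shell => //.
  by rewrite mulr_gt0// exprn_gt0// invr_gt0.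
- by move=> x /= /andP[/uM].
move=> x x0 ux; have ex0 := enorm_gt0 x0.
have xM : enorm x < M by rewrite ltNge; apply: contra ux => /uM ->.
have [k [h1 h2]] : exists k, ~~ (M / enorm x <= b ^+ k) /\ M / enorm x <= b ^+ k.+1.
  apply: (@exists_switch (fun k => M / enorm x <= b ^+ k)).
    by have [k /ltW] := exprn_unbounded (M / enorm x) b1; exists k.
  by rewrite expr0 -ltNge ltr_pdivlMr// mul1r.
(* Here [b^k < M / |x| <= b^(k+1)], so [x] lies in the tile from [M / b^(k+1)] to [M / b^k], whose
   index is [k + 1]; the tile of index 0 lies beyond [M]. *)
exists k.+1; rewrite /shell/=.
have bk m : 0 < b ^+ m by rewrite exprn_gt0.
rewrite exprVn ler_pdivrMr// mulrC -ler_pdivrMr// h2/=.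
have -> : b * (M / b ^+ k.+1) = M / b ^+ k.
  by rewrite exprS; field; rewrite !gt_eqF.
by move: h1; rewrite -ltNge ltr_pdivlMr// mulrC -ltr_pdivlMr.
Qed.

(** The starting radius [e / b^2] places the whole first shell, of ratio [b^2], inside the ball of
    radius [e] where [u] vanishes; the radii then grow. *)
Lemma near0_vanishing_admissible : (\forall x \near (0 : 'rV[R]_n.+1), u x = 0) ->
  exists r, shellwise_admissible b b r u.
Proof.
move=> /near0_enorm[e e0 ue]; have b20 : 0 < b ^+ 2 by rewrite exprn_gt0.
have r0 : 0 < e / b ^+ 2 by rewrite divr_gt0.
exists (e / b ^+ 2); split => //.
- exact: radial_profile.
- by move=> i; apply: integrable_shell => //; rewrite mulr_gt0// exprn_gt0.
- by move=> x /= /andP[_]; rewrite mulrC divfK ?gt_eqF// => /ue.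
move=> x x0 ux.
have xe : e <= enorm x by rewrite leNgt; apply: contra ux => /ue ->.
set r := e / _ in r0 *.
have rx : r <= enorm x.
  by apply: le_trans xe; rewrite ler_pdivrMr// ler_peMr ?(ltW e0)// exprn_ege1// ltW.
have [k [h1 h2]] : exists k, ~~ (enorm x / r < b ^+ k) /\ enorm x / r < b ^+ k.+1.
  apply: (@exists_switch (fun k => enorm x / r < b ^+ k)); first exact: exprn_unbounded.
  by rewrite expr0 -leNgt ler_pdivlMr// mul1r.
exists k; rewrite /shell/=.
move: h1; rewrite -leNgt ler_pdivlMr// mulrC => -> /=.
by move: h2; rewrite ltr_pdivrMr// exprS -mulrA (mulrC (b ^+ k)).
Qed.

End admissibility.

Theorem theorem1p1 (R : realType) (d : nat)
    (s p q tau a alpha beta gamma Lambda sigma : R)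
    (hd : (2 <= d)%N) (hs : 0 < s < 1) (hp : 1 < p) (hq : 1 <= q)
    (htau : 1 <= tau) (ha : 0 < a <= 1) (hLambda : 1 < Lambda)
    (hsigma : gamma = a * sigma + (1 - a) * beta)
    (hbalance : tau^-1 + gamma / d%:R =
       a * (p^-1 + (alpha - s) / d%:R) + (1 - a) * (q^-1 + beta / d%:R))
    (hrange : - (d%:R - 1) * s <= alpha - sigma < 0) :
  exists C : R, [/\ 0 < C,
    0 < tau^-1 + gamma / d%:R ->
      forall u : 'rV[R]_d -> R,
        radial u -> L1loc (~` [set 0]) u ->
        compact (closure [set x | u x != 0]) ->
        (weighted_Lnorm tau gamma u <=
          C%:E * (sobolev_seminorm setT s p alpha Lambda u) `^ a
               * (weighted_Lnorm q beta u) `^ (1 - a)%R)%E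
    & tau^-1 + gamma / d%:R < 0 ->
      forall u : 'rV[R]_d -> R,
        radial u -> L1loc (~` [set 0]) u ->
        (\forall x \near (0 : 'rV[R]_d), u x = 0) ->
        (weighted_Lnorm tau gamma u <=
          C%:E * (sobolev_seminorm setT s p alpha Lambda u) `^ a
               * (weighted_Lnorm q beta u) `^ (1 - a)%R)%E ].
Proof.
case: d hd hbalance hrange => [//|n] _ hbalance hrange.
have d0 : 0 < n.+1%:R :> R by rewrite ltr0n.
have [s0 _] := andP hs; have [a0 a1] := andP ha.
have tau0 : 0 < tau by exact: lt_le_trans htau.
(* Substituting [gamma = a sigma + (1 - a) beta] eliminates [beta] and [gamma]. The quotient
   [(alpha - sigma - s) / d] is at least [-s] by the lower bound on [alpha - sigma], and negative by
   the upper bound; these give [kappa_le] and [tau_le]. *)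
have tauE : tau^-1 = a / p + (1 - a) / q + a * ((alpha - sigma - s) / n.+1%:R).
  have -> : tau^-1 = tau^-1 + gamma / n.+1%:R - gamma / n.+1%:R by rewrite addrK.
  by rewrite hbalance hsigma; ring.
have [hr1 hr2] := andP hrange.
have kappa_le : a * (p^-1 - s) + (1 - a) / q <= tau^-1.
  have : a * - s <= a * ((alpha - sigma - s) / n.+1%:R).
    apply: ler_wpM2l; first exact: ltW.
    rewrite ler_pdivlMr// (_ : - s * _ = - (n.+1%:R - 1) * s - s); first by lra.
    by ring.
  by rewrite tauE mulrBr mulrN; move: (_ / n.+1%:R) => X; lra.
have tau_le : tau^-1 <= a / p + (1 - a) / q.
  have : a * ((alpha - sigma - s) / n.+1%:R) <= 0.
    by rewrite mulr_ge0_le0 ?(ltW a0)// pmulr_lle0 ?invr_gt0//; lra.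
  by rewrite tauE; move: (_ / n.+1%:R) => X; lra.
(* The square root makes shells of ratio [Lambda], the widest on which the cutoff is 1 for all
   pairs, consist of two tiles of ratio [b]. *)
set b := Num.sqrt Lambda.
have bE : b ^+ 2 = Lambda by rewrite sqr_sqrtr// ltW// (lt_trans _ hLambda).
have b1 : 1 < b by rewrite -sqrtr1 ltr_sqrt// (lt_trans _ hLambda).
have b0 : 0 < b by exact: lt_trans b1.
have lb : 0 < ln b by rewrite ln_gt0.
have expE : gamma + n.+1%:R / tau = n.+1%:R * (tau^-1 + gamma / n.+1%:R).
  by field; rewrite !gt_eqF.
pose C_of om (h : om = b \/ om = b^-1) c :=
  weighted_Lnorm_le b1 h hp hq htau s0 ha kappa_le tau_le hbalance c.
have [hpos|hnpos] := ltP 0 (tau^-1 + gamma / n.+1%:R).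
  have c : b^-1 `^ (gamma + n.+1%:R / tau) < 1.
    rewrite expE powR_expR ?invr_gt0// lnV ?posrE// -[ltRHS]expR0 ltr_expR.
    by rewrite mulrN oppr_lt0 !mulr_gt0.
  have [C C0 HC] := C_of _ (or_intror erefl) c.
  exists C; split => [//|_ u ru Lu cu|].
    have [r adm] := compact_support_admissible b1 ru Lu cu.
    by rewrite -bE; exact: HC adm.
  by move=> /(lt_trans hpos); rewrite ltxx.
have [hneg|hnneg] := ltP (tau^-1 + gamma / n.+1%:R) 0; last first.
  (* If [1/tau + gamma/d = 0], neither claim applies and any constant will do. *)
  by exists 1; split; first exact: ltr01.
have c : b `^ (gamma + n.+1%:R / tau) < 1.
  rewrite expE powR_expR// -[ltRHS]expR0 ltr_expR.
  by rewrite pmulr_llt0// pmulr_rlt0.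
have [C C0 HC] := C_of _ (or_introl erefl) c.
exists C; split => [//|//|_ u ru Lu nu].
have [r adm] := near0_vanishing_admissible b1 ru Lu nu.
by rewrite -bE; exact: HC adm.
Qed.
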